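(* The construction described in the context, which associates to a decorated tiling of an oriented surface with marked points an ordered quiver, gives a 1:1 correspondence between decorated tilings and ST-compatible quivers (both considered up to isomorphism).
   Context: Quivers. All quivers are finite. A quiver is an oriented graph (multiple arrows allowed) without self-loops and oriented 2-cycles; $Q_0$ is its set of nodes. A 2-colored quiver is a quiver whose arrows are partitioned into parallel arrows (color $0$) and crossing arrows (color $1$). Its pruned quiver $Q^{\mathrm{pr}}$ is obtained by removing all pairs formed by a parallel and a crossing arrow between the same two nodes; such a removed pair is called a commutative arrow. An ordered quiver is a 2-colored quiver $Q$ together with, at every node $k$, a splitting of the incoming and outgoing arrows of $Q^{\mathrm{pr}}$ at $k$ into ordered tuples $\mathrm{In}_f(k),\mathrm{Out}_f(k)$, $f\in\mathbb{Z}/2\mathbb{Z}$ (possibly empty), the two sides of the node; side $0$ is called empty ($\circ$) and side $1$ filled ($\bullet$). An arrow of color $t$ from side $f$ of $i$ to side $g$ of $j$ is written $i\xrightarrow{f\,t\,g}j$. An isomorphism of ordered quivers is a quiver isomorphism preserving colors, sides and all ordered tuples. ST-compatibility. $\mathcal{Q}_Q$ is the $\mathbb{Q}$-algebra generated by $X_i^{(f)},Y_i^{(f)}$ ($i\in Q_0$, $f\in\mathbb{Z}/2\mathbb{Z}$) with $X_i^{(f)}Y_i^{(f+1)}=Y_i^{(f)}X_i^{(f+1)}$ central, localized by its center; $\sigma,\tau$ are the commuting anti-automorphisms $\sigma:X_i^{(f)}\mapsto X_i^{(f+1)},Y_i^{(f)}\mapsto Y_i^{(f+1)}$ and $\tau:X_i^{(f)}\mapsto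 Y_i^{(f+1)},Y_i^{(f)}\mapsto X_i^{(f+1)}$; $X_i:=X_i^{(0)}$. The angle on side $g$ of $k$ is the ordered product $$\Delta_g(k)=\prod_{i\xrightarrow{f\,t\,g}k\ \in\,\mathrm{In}_g(k)}\sigma^f(\sigma\tau)^{t+1}(X_i)\cdot\sigma^g(X_k)\cdot\prod_{k\xrightarrow{g\,t\,f}j\ \in\,\mathrm{Out}_g(k)}\sigma^f(\sigma\tau)^{t+1}(X_j).$$ $Q$ is ST-compatible if for every arrow $i\xrightarrow{f\,t\,g}j$ of $Q^{\mathrm{pr}}$ the relations $\Delta_f(i)=\sigma(\Delta_f(i))$ and $\Delta_g(j)=\sigma(\Delta_g(j))$ are equivalent (imposing one in $\mathcal{Q}_Q$ implies the other). Decorated polygons. A decorated polygon is an $n$-gon $P_n$ ($n\ge2$) with: an orientation of each side; an admissible partition of its vertices (''angles'') into parallel (color $0$) and crossing (color $1$) angles, where admissible means that the number of parallel angles is odd; a choice of a vertex for every side such that the straight lines joining the midpoint of each side to its chosen vertex (the angle indicators) intersect pairwise (intersections at endpoints allowed). It is singular if all angle indicators end at the same vertex, regular otherwise. Decorated tilings. A decorated tiling of an oriented surface with marked points consists of: a set of non-intersecting oriented arcs between marked points whose complementary regions are polygons; for every such polygon an admissible decoration such that the orientations of the sides agree with those of the arcs; and a choice of arrows connecting the arcs (commutative arrows) such that any such arrow connecting two sides $A$ and $B$ of the same polygon has the angle indicator of $A$ (equivalently of $B$) on its right-hand side with respect to the orientation of the arrow. The quiver of a decorated polygon. Nodes are the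 sides. For a side $A$, a side $B\ne A$ gives an arrow $B\to A$ if $B$ lies to the right of the angle indicator of $A$ (directed from the midpoint of $A$ to its chosen vertex), and $A\to B$ if it lies to the left. The color of the arrow between $A$ and $B$ is $\sum_{\alpha}(1+c(\alpha))+1\in\mathbb{Z}/2\mathbb{Z}$, the sum being over the angles $\alpha$ on that part of the boundary between $A$ and $B$ which contains no endpoint of the angle indicators of $A$ and $B$, $c(\alpha)$ being the color of $\alpha$. At each node $A$ all these arrows lie on one side of the node and are ordered so that incoming nodes, $A$, outgoing nodes appear in the clockwise cyclic order of the sides of the polygon; the empty side $\circ$ of the node is the one on the right-hand side of the oriented side $A$. The quiver of a decorated tiling. Nodes are the arcs; each polygon contributes the arrows of its quiver (an arc adjacent to two polygons carries the arrows of these on its two sides); each commutative arrow contributes one parallel and one crossing arrow.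
   Formalization: Tilings are restricted to those whose arrows form no loops or 2-cycles and whose polygon arrows do not cancel in the pruned quiver (otherwise the map is undefined or not injective); arcs adjacent to no polygon are allowed, to account for isolated nodes. *)

(* Defs.v *)
From HB Require Import structures.
From mathcomp Require Import all_boot all_order all_algebra.
From mathcomp Require Import finmap monalg.

Set Implicit Arguments.
Unset Strict Implicit.
Unset Printing Implicit Defensive.

Import GRing.Theory.
Local Open Scope ring_scope.

(* Z/2Z is represented by bool throughout: colors (false = parallel,
   true = crossing) and sides of a node (false = empty, true = filled). *)

(** * Ordered quivers *)

Record quiver_data := QuiverData {
  node : finType;
  arrow : finType;
  src : arrow -> node;
  tgt : arrow -> node;
  col : arrow -> bool;
  (* the arrows of the pruned quiver *)
  pruned : {set arrow};
  inc : bool -> node -> seq arrow;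
  out : bool -> node -> seq arrow
}.

Section OrderedQuiver.
Variable Q : quiver_data.

Definition loopless := forall a : arrow Q, src a != tgt a.

Definition no_2cycle :=
  forall a b : arrow Q, ~~ ((src a == tgt b) && (tgt a == src b)).

Definition arrows_between (t : bool) (i j : node Q) : {set arrow Q} :=
  [set a | [&& src a == i, tgt a == j & col a == t]].

(* Removing all pairs made of a parallel and a crossing arrow from i to j
   leaves m_t - m_(1-t) arrows of color t (truncated subtraction), where m_t
   is the number of arrows i -> j of color t.  Which of the indistinguishable
   arrows are removed is part of the data. *)
Definition is_pruning :=
  forall (t : bool) (i j : node Q),
    #|pruned Q :&: arrows_between t i j| =
    (#|arrows_between t i j| - #|arrows_between (~~ t) i j|)%N.

Definition is_splitting :=
  forall k : node Q,
    perm_eq (inc false k ++ inc true k)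
            (enum [set a in pruned Q | tgt a == k]) /\
    perm_eq (out false k ++ out true k)
            (enum [set a in pruned Q | src a == k]).

Definition is_ordered_quiver :=
  [/\ loopless, no_2cycle, is_pruning & is_splitting].

End OrderedQuiver.

Record ordered_quiver := OrderedQuiver {
  oq_data :> quiver_data;
  oq_axioms : is_ordered_quiver oq_data
}.

Definition quiver_iso (Q Q' : quiver_data) :=
  exists (fn : node Q -> node Q') (fa : arrow Q -> arrow Q'),
    [/\ bijective fn, bijective fa,
        forall a, [/\ src (fa a) = fn (src a), tgt (fa a) = fn (tgt a),
                      col (fa a) = col a
                    & (fa a \in pruned Q') = (a \in pruned Q)]
      & forall f k, inc f (fn k) = map fa (inc f k) /\
                    out f (fn k) = map fa (out f k)].

(** * ST-compatibility *)

Section ST.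
Variable Q : ordered_quiver.

(* (i, false, f) stands for X_i^(f) and (i, true, f) for Y_i^(f). *)
Definition gen : Type := (node Q * bool * bool)%type.

(* The free associative unital Q-algebra on the generators. *)
Definition free_alg := {malg rat[{fmonom gen}]}.

Definition X (i : node Q) (f : bool) : free_alg := << fmu (i, false, f) >>.
Definition Y (i : node Q) (f : bool) : free_alg := << fmu (i, true, f) >>.

(* The anti-endomorphism of the free algebra extending h. *)
Definition antimorphism (h : gen -> gen) (p : free_alg) : free_alg :=
  \sum_(m <- msupp p) p@_m *: << FMonom (rev (map h m)) >>.

Definition sigma : free_alg -> free_alg :=
  antimorphism (fun x => let: (i, y, f) := x in (i, y, ~~ f)).
Definition tau : free_alg -> free_alg :=
  antimorphism (fun x => let: (i, y, f) := x in (i, ~~ y, ~~ f)).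

(* P_Q is the algebra generated by the X_i^(f), Y_i^(f) with
   X_i^(f) Y_i^(f+1) = Y_i^(f) X_i^(f+1) =: z_i central, and QQ is P_Q
   localized by its center.  Both algebras are given by their universal
   properties: the morphisms out of them are the morphisms phi out of the
   free algebra with [factors_P phi], resp. [factors_QQ phi].

   z_i is taken to be the same element for f = 0 and f = 1.  This holds
   anyway once the z_i are invertible, since
   X_i^(0) (X_i^(1) Y_i^(0)) = (X_i^(0) Y_i^(1)) X_i^(0); without it the
   difference of the two would be a nonzero central zero divisor of P_Q and
   localizing at the nonzero central elements would give the zero ring. *)
Definition factors_P (A : algType rat) (phi : {lrmorphism free_alg -> A}) :=
  forall i : node Q,
    (forall f g, phi (X i f * Y i (~~ f)) = phi (Y i g * X i (~~ g))) /\
    (forall f (p : free_alg),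
        phi (X i f * Y i (~~ f) * p) = phi (p * (X i f * Y i (~~ f)))).

Definition zero_in_P (p : free_alg) :=
  forall (A : algType rat) (phi : {lrmorphism free_alg -> A}),
    factors_P phi -> phi p = 0.

Definition central_in_P (p : free_alg) :=
  forall q : free_alg, zero_in_P (p * q - q * p).

Definition factors_QQ (A : algType rat) (phi : {lrmorphism free_alg -> A}) :=
  factors_P phi /\
  forall p, central_in_P p -> ~ zero_in_P p ->
    exists b, b * phi p = 1 /\ phi p * b = 1.

(* Imposing u = v in QQ implies u' = v': the second relation holds in every
   algebra under QQ in which the first one holds, equivalently in the quotient
   of QQ by the two-sided ideal generated by u - v. *)
Definition imposing_implies (u v u' v' : free_alg) :=
  forall (A : algType rat) (phi : {lrmorphism free_alg -> A}),
    factors_QQ phi -> phi u = phi v -> phi u' = phi v'.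

(* sigma^f (sigma tau)^(t+1) (X_i) *)
Definition letter (f t : bool) (i : node Q) : free_alg :=
  iter f sigma (iter t.+1 (sigma \o tau) (X i false)).

Definition src_side (a : arrow Q) : bool := a \in out true (src a).
Definition tgt_side (a : arrow Q) : bool := a \in inc true (tgt a).

Definition Delta (g : bool) (k : node Q) : free_alg :=
  (\prod_(a <- inc g k) letter (src_side a) (col a) (src a))
  * iter g sigma (X k false)
  * (\prod_(a <- out g k) letter (tgt_side a) (col a) (tgt a)).

Definition ST_compatible :=
  forall a : arrow Q, a \in pruned Q ->
    let u := Delta (src_side a) (src a) in
    let v := Delta (tgt_side a) (tgt a) in
    imposing_implies u (sigma u) v (sigma v) /\
    imposing_implies v (sigma v) u (sigma u).

End ST.

(** * Decorated polygons *)

(* The sides of an n-gon are numbered by 'I_n clockwise, and vertex u is the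
   one between side u and side u + 1 (mod n).  [cwdist i j] is the number of
   clockwise steps from i to j, so going clockwise from side A one meets
   vertex A, side A + 1, vertex A + 1, ... *)
Definition cwdist n (i j : 'I_n) : nat := ((j + n - i) %% n)%N.

(* The vertices on the boundary part running clockwise from side A to B. *)
Definition cwpart n (A B : 'I_n) : {set 'I_n} :=
  [set u | (cwdist A u < cwdist A B)%N].

(* Sides and vertices to the left and to the right of the segment directed
   from the midpoint of side A to vertex v: the left-hand part of the boundary
   is the one running clockwise from A to v. *)
Section Chord.
Variables (n : nat) (A v : 'I_n).
Definition side_left (B : 'I_n) := (0 < cwdist A B <= cwdist A v)%N.
Definition side_right (B : 'I_n) := (cwdist A v < cwdist A B)%N.
Definition vertex_left (u : 'I_n) := (cwdist A u < cwdist A v)%N.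
Definition vertex_right (u : 'I_n) := (cwdist A v < cwdist A u)%N.
End Chord.

(* Two such segments, starting at distinct sides A and B, intersect iff they
   end at the same vertex or the endpoints of one separate those of the
   other on the boundary. *)
Definition chords_meet n (A v B w : 'I_n) : bool :=
  [|| v == w, side_left A v B && vertex_right A v w
    | side_right A v B && vertex_left A v w].

Record decorated_polygon := DecoratedPolygon {
  nsides : nat;
  (* the side is oriented clockwise, i.e. has the polygon on its right *)
  clockwise : 'I_nsides -> bool;
  (* the color of the angles *)
  angle : 'I_nsides -> bool;
  (* the chosen vertex, at which the angle indicator ends *)
  chosen : 'I_nsides -> 'I_nsides;
  nsides_ge2 : (2 <= nsides)%N;
  admissible : odd #|[set u | ~~ angle u]|;
  indicators_meet :
    forall A B, A != B -> chords_meet A (chosen A) B (chosen B)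
}.

Section PolygonQuiver.
Variable P : decorated_polygon.
Implicit Types A B : 'I_(nsides P).

(* There is an arrow A -> B iff B is to the left of the indicator of A; as
   the indicators meet, this amounts to A being to the right of that of B. *)
Definition parrow : finType :=
  {e : 'I_(nsides P) * 'I_(nsides P) | side_left e.1 (chosen e.1) e.2}.
Definition psrc (a : parrow) : 'I_(nsides P) := (val a).1.
Definition ptgt (a : parrow) : 'I_(nsides P) := (val a).2.

Definition free_part A B : {set 'I_(nsides P)} :=
  if (chosen A \in cwpart A B) || (chosen B \in cwpart A B)
  then cwpart B A else cwpart A B.

Definition pcol (a : parrow) : bool :=
  odd (\sum_(u in free_part (psrc a) (ptgt a)) (1 + angle u) + 1)%N.

(* Incoming nodes, A, outgoing nodes are in clockwise cyclic order. *)
Definition pin A : seq parrow :=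
  sort (relpre (fun a => cwdist A (psrc a)) leq) (enum [set a | ptgt a == A]).
Definition pout A : seq parrow :=
  sort (relpre (fun a => cwdist A (ptgt a)) leq) (enum [set a | psrc a == A]).

(* The side of the node A carrying its arrows: empty iff the polygon is on the
   right-hand side of A. *)
Definition pside A : bool := ~~ clockwise A.

End PolygonQuiver.

(** * Decorated tilings *)

(* A tiling of an oriented surface is given by its oriented arcs, its polygons
   (with boundary oriented by the surface) and the map sending each side of
   each polygon to the arc it is glued to; the surface is recovered, up to
   homeomorphism, by gluing.  A boundary arc is adjacent to a single polygon;
   an arc adjacent to no polygon is a degenerate component of the surface. *)
Record tiling_data := TilingData {
  arc : finType;
  tile : finType;
  polygon : tile -> decorated_polygon;
  glue : {p : tile & 'I_(nsides (polygon p))} -> arc;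
  comm : finType;
  csrc : comm -> arc;
  ctgt : comm -> arc
}.

Section Tiling.
Variable T : tiling_data.

Definition side : finType := {p : tile T & 'I_(nsides (polygon p))}.

Definition side_of (p : tile T) (A : 'I_(nsides (polygon p))) : side :=
  Tagged (fun p => 'I_(nsides (polygon p))) A.

(* The polygon lies on the right of the arc iff side_of_arc is false. *)
Definition side_of_arc (s : side) : bool := pside (tagged s).

(* Each of the two sides of an arc is adjacent to at most one polygon; in
   particular the orientations of the polygon sides agree with the arcs. *)
Definition gluing_axiom :=
  forall s s' : side,
    glue s = glue s' -> side_of_arc s = side_of_arc s' -> s = s'.

(* The right-hand side of a segment directed from side A to side B is the
   boundary part running clockwise from B to A. *)
Definition comm_axiom :=
  forall (c : comm T) (p : tile T) (A B : 'I_(nsides (polygon p))),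
    glue (side_of A) = csrc c -> glue (side_of B) = ctgt c ->
    chosen A \in cwpart B A.

Definition is_decorated_tiling := gluing_axiom /\ comm_axiom.

Definition tarrow : finType := {p : tile T & parrow (polygon p)}.

Definition tarrow_of (p : tile T) (a : parrow (polygon p)) : tarrow :=
  Tagged (fun p => parrow (polygon p)) a.

Definition tsrc (a : tarrow + comm T * bool) : arc T :=
  match a with
  | inl a => glue (side_of (psrc (tagged a)))
  | inr c => csrc c.1
  end.

Definition ttgt (a : tarrow + comm T * bool) : arc T :=
  match a with
  | inl a => glue (side_of (ptgt (tagged a)))
  | inr c => ctgt c.1
  end.

Definition tcol (a : tarrow + comm T * bool) : bool :=
  match a with
  | inl a => pcol (tagged a)
  | inr c => c.2
  end.

(* At most one polygon side is glued to side f of the arc k. *)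
Definition sides_at (f : bool) (k : arc T) : seq side :=
  enum [set s | (glue s == k) && (side_of_arc s == f)].

Definition tin (f : bool) (k : arc T) : seq (tarrow + comm T * bool) :=
  flatten [seq [seq inl (tarrow_of a) | a <- pin (tagged s)]
          | s <- sides_at f k].
Definition tout (f : bool) (k : arc T) : seq (tarrow + comm T * bool) :=
  flatten [seq [seq inl (tarrow_of a) | a <- pout (tagged s)]
          | s <- sides_at f k].

Definition tiling_quiver : quiver_data :=
  {| node := arc T;
     arrow := (tarrow + comm T * bool)%type;
     src := tsrc; tgt := ttgt; col := tcol;
     pruned := [set a | if a is inl _ then true else false];
     inc := tin; out := tout |}.

Definition next_side (s : side) : side := side_of (ordS (tagged s)).

(* Via the numbering, vertex u of a polygon is identified with side u. *)
Definition chosen_side (s : side) : side := side_of (chosen (tagged s)).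

Definition angle_after (s : side) : bool := angle (tagged s).

End Tiling.

(* The construction associates an ordered quiver to a tiling if no polygon is
   glued to itself along an arc, the arrows form no oriented 2-cycles, and the
   arrows contributed by the polygons do not cancel each other in the pruned
   quiver. *)
Record decorated_tiling := DecoratedTiling {
  dt_data :> tiling_data;
  dt_axioms : is_decorated_tiling dt_data;
  dt_quiver : is_ordered_quiver (tiling_quiver dt_data)
}.

Definition quiver_of (T : decorated_tiling) : ordered_quiver :=
  OrderedQuiver (dt_quiver T).

(* Orientation-preserving isomorphisms. *)
Definition tiling_iso (T T' : tiling_data) :=
  exists (fk : arc T -> arc T') (fp : tile T -> tile T')
         (fs : side T -> side T') (fc : comm T -> comm T'),
    [/\ [/\ bijective fk, bijective fp, bijective fs & bijective fc],
        forall s, [/\ tag (fs s) = fp (tag s),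
                      fs (next_side s) = next_side (fs s)
                    & glue (fs s) = fk (glue s)],
        forall s, [/\ clockwise (tagged (fs s)) = clockwise (tagged s),
                      angle_after (fs s) = angle_after s
                    & fs (chosen_side s) = chosen_side (fs s)]
      & forall c, csrc (fc c) = fk (csrc c) /\ ctgt (fc c) = fk (ctgt c)].

(* Main.v *)
Require Import Defs.
From HB Require Import structures.
From mathcomp Require Import all_boot all_order all_algebra fraction.
From mathcomp Require Import finmap monalg boolp zify.
From mathcomp Require mpoly.

(* Up to the invertible central elements z_i, the relation Delta = sigma Delta
   for an angle w says that w w' = 1 in the free group on the X_i^(f), where w'
   is w with all colors changed.  It determines the cyclic word of w w', and
   the sides of a polygon, seen from any of them, give one and the same such
   cyclic word; hence tilings are ST-compatible.

   Conversely, X_i^(f) occurs only once in the angle at side f of i, so that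
   imposing its relation amounts to eliminating the generator X_i^(f+1).  After
   this elimination, the relation at the other end j of an arrow i -> j must hold
   in a free group, and the cancellations it requires show that the two cyclic
   words coincide.  So the slots (node, side) occurring in an angle form a
   polygon: the cyclic word gives the order of the sides and the angles, and the
   place where the angle at a slot starts in it gives the indicator.  Angle
   indicators meet because, if they did not for A and B, a side C between their
   ends would have A -> C -> B, whereas C -> B forces C -> A.

   The free group acts on the functions from its elements to a field containing
   independent z_i; nonzero central elements act by nonzero scalars. *)

Set Implicit Arguments.
Unset Strict Implicit.
Unset Printing Implicit Defensive.

(* The notations of mpoly clash with those of monalg. *)
Import (canonicals, coercions) mpoly.
(* [col] is also a matrix operation. *)
Import GRing.Theory Defs.

(** * Words in a free group *)

(** For an arrow from [i] to [j], the angle at [j] could a priori contain letters at [i] several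
    times. The innermost cancellation therefore gives the match of the two cyclic words only up to a
    nonempty middle segment of unknown length. The converse implication gives the same with [i] and
    [j] exchanged, and comparing lengths shrinks the segment to one letter. Cancellations can be
    controlled because an angle word is reduced even after doubling: pruning leaves only one color
    between two nodes, and there are no 2-cycles. The localized algebra is available only through
    its universal property, so a consequence of a relation has to be tested in a concrete algebra in
    which every nonzero central element becomes invertible. The coefficients of a central element on
    the free group are invariant under conjugation and finitely supported, which leaves only the
    neutral element. That the remaining scalar vanishes only for the zero element is what the
    independence of the z_i provides. *)

Section FreeGroup.
Variable T : eqType.
Notation L := (T * bool * bool)%type.
Implicit Types (x y l : L) (s t u v w : seq L) (i j : T).

(* The letter (i, y, f) stands for X_i^(f) if y = false and for Y_i^(f) if
   y = true.  Up to the central element z_i, the inverse of X_i^(f) is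
   Y_i^(f+1); gsig is the effect of sigma on generators. *)
Definition ginv x : L := let: (i, y, f) := x in (i, ~~ y, ~~ f).
Definition gflip x : L := let: (i, y, f) := x in (i, ~~ y, f).
Definition gsig x : L := let: (i, y, f) := x in (i, y, ~~ f).
Definition gnode x : T := x.1.1.

Lemma ginvK : involutive ginv.
Proof. by case=> [[i y] f]; rewrite /= !negbK. Qed.
Lemma gflipK : involutive gflip.
Proof. by case=> [[i y] f]; rewrite /= !negbK. Qed.
Lemma gsigE x : gsig x = ginv (gflip x).
Proof. by case: x => [[i y] f]; rewrite /= !negbK. Qed.
Lemma gflip_inv x : gflip (ginv x) = ginv (gflip x).
Proof. by case: x => [[i y] f]. Qed.
Lemma gnode_inv x : gnode (ginv x) = gnode x.
Proof. by case: x => [[i y] f]. Qed.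
Lemma gnode_flip x : gnode (gflip x) = gnode x.
Proof. by case: x => [[i y] f]. Qed.

Definition invw s := rev (map ginv s).
Definition flw s := map gflip s.

Lemma flwK : involutive flw.
Proof. by move=> s; rewrite /flw -map_comp map_id_in // => x _ /=; rewrite gflipK. Qed.
Lemma invwK : involutive invw.
Proof.
move=> s; rewrite /invw map_rev revK -map_comp map_id_in // => x _ /=.
by rewrite ginvK.
Qed.
Lemma invw_cat s t : invw (s ++ t) = invw t ++ invw s.
Proof. by rewrite /invw map_cat rev_cat. Qed.
Lemma flw_cat s t : flw (s ++ t) = flw s ++ flw t.
Proof. exact: map_cat. Qed.
Lemma size_flw s : size (flw s) = size s.
Proof. exact: size_map. Qed.
Lemma mem_invw x s : (x \in invw s) = (ginv x \in s).
Proof. by rewrite mem_rev -{1}(ginvK x) (mem_map (inv_inj ginvK)). Qed.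
Lemma mem_flw x s : (x \in flw s) = (gflip x \in s).
Proof. by rewrite -{1}(gflipK x) (mem_map (inv_inj gflipK)). Qed.

Definition nocancel x y := y != ginv x.
Definition reduced s := sorted nocancel s.

Lemma nocancel_sym x y : nocancel x y = nocancel y x.
Proof. by rewrite /nocancel -(inj_eq (inv_inj ginvK)) ginvK eq_sym. Qed.

Lemma reduced_rev s : reduced (rev s) = reduced s.
Proof. by rewrite /reduced rev_sorted; apply: eq_sorted => x y; rewrite nocancel_sym. Qed.

Lemma reduced_flw s : reduced (flw s) = reduced s.
Proof.
rewrite /reduced sorted_map; apply: eq_sorted => x y /=.
by rewrite /nocancel -gflip_inv (inj_eq (inv_inj gflipK)).
Qed.

Lemma reduced_invw s : reduced (invw s) = reduced s.
Proof.
rewrite /reduced /invw -/(reduced _) reduced_rev /reduced sorted_map.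
by apply: eq_sorted => x y /=; rewrite /nocancel (inj_eq (inv_inj ginvK)).
Qed.

Lemma reduced_catW s t : reduced (s ++ t) -> reduced s /\ reduced t.
Proof. by move=> /cat_sorted2 []. Qed.

Lemma reduced_overlap s t x :
  reduced (rcons s x) -> reduced (x :: t) -> reduced (s ++ x :: t).
Proof.
rewrite -cat_rcons /reduced; case: s => [|h s] //=.
by rewrite rcons_path cat_path rcons_path last_rcons => -> ->.
Qed.

Lemma reduced_cons x s :
  reduced s -> (if s is y :: _ then nocancel x y else true) -> reduced (x :: s).
Proof. by case: s => //= y s -> ->. Qed.

(* Words are multiplied on the right, and stored with the last letter first. *)
Definition rstep w x : seq L :=
  if w is h :: w' then if h == ginv x then w' else x :: w else [:: x].
Definition act w s := foldl rstep w s.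
Definition red s := act [::] s.

Lemma act_cat w s t : act w (s ++ t) = act (act w s) t.
Proof. exact: foldl_cat. Qed.

Lemma rstep_reduced w x : reduced w -> reduced (rstep w x).
Proof.
case: w => [|h w] //= hw; case: eqP => [_|/eqP hx]; first exact: path_sorted hw.
by rewrite /= hw andbT /nocancel.
Qed.

Lemma act_reduced w s : reduced w -> reduced (act w s).
Proof. by elim: s w => //= x s IH w hw; apply/IH/rstep_reduced. Qed.

Lemma red_reduced s : reduced (red s). Proof. exact: act_reduced. Qed.

(** This fails for unreduced words: once the top letter [ginv x] is popped, it can be pushed back
    only if the letter below it is not [x]. *)
Lemma rstepK w x : reduced w -> rstep (rstep w x) (ginv x) = w.
Proof.
case: w => [|h w] /= hw; first by rewrite ginvK eqxx.
have [E|_] := eqVneq h (ginv x); last by rewrite /= ginvK eqxx.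
case: w hw => [|k w] /= hw; first by rewrite E.
by move: hw; rewrite ginvK E /nocancel ginvK => /andP [/negPf -> _].
Qed.

Lemma act_invw w s : reduced w -> act (act w s) (invw s) = w.
Proof.
elim/last_ind: s w => // s x IH w hw.
rewrite -cats1 invw_cat !act_cat -[act (act _ [:: x]) _]/(rstep (rstep _ x) (ginv x)).
by rewrite rstepK ?IH //; apply: act_reduced.
Qed.

Lemma act_id w s : reduced (rev w ++ s) -> act w s = rev s ++ w.
Proof.
elim: s w => [|x s IH] w //= hw.
have -> : rstep w x = x :: w.
  case: w hw => //= h w; rewrite rev_cons cat_rcons => /reduced_catW [_] /=.
  by rewrite nocancel_sym /nocancel => /andP [/negPf -> _].
by rewrite IH ?rev_cons ?cat_rcons // rev_cons cat_rcons.
Qed.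

Lemma red_id s : reduced s -> red s = rev s.
Proof. by move=> hs; rewrite /red act_id // cats0. Qed.

(** The intermediate words stay reduced, and on reduced words the steps by a letter and by its
    inverse undo each other; so cancelling inside [s] beforehand changes nothing. *)
Lemma act_red w s : reduced w -> act w s = act w (rev (red s)).
Proof.
move=> hw; elim/last_ind: s => // s x IH.
rewrite -cats1 act_cat IH /red act_cat -/(red s) /=.
move: (red_reduced s); case: (red s) => [_|h u hu]; first by [].
rewrite {2}/rstep; case: eqP => [->|_]; last by rewrite (rev_cons x) -cats1 act_cat.
by rewrite rev_cons -cats1 act_cat /= -{2}(ginvK x) rstepK //; apply: act_reduced.
Qed.

Lemma mem_rstep w x y : y \in rstep w x -> (y == x) || (y \in w).
Proof.
case: w => [|h w] /=; first by rewrite in_cons in_nil orbF => ->.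
by case: eqP => _; rewrite !in_cons => // ->; rewrite !orbT.
Qed.

Lemma mem_act w s y : y \in act w s -> (y \in w) || (y \in s).
Proof.
elim: s w => [|x s IH] w /=; first by move=> ->.
by move/IH; rewrite in_cons => /orP [/mem_rstep /orP [] | ] ->; rewrite ?orbT.
Qed.

Lemma mem_red s y : y \in red s -> y \in s.
Proof. by move/mem_act. Qed.

Definition geq s t := red s = red t.

Lemma geq_act w s t : reduced w -> geq s t -> act w s = act w t.
Proof. by move=> hw st; rewrite act_red // st -act_red. Qed.

Lemma geq_cat s s' t t' : geq s s' -> geq t t' -> geq (s ++ t) (s' ++ t').
Proof.
move=> hs ht; rewrite /geq /red !act_cat -/(red s) hs.
by apply: geq_act => //; apply: red_reduced.
Qed.

Lemma geq_red s : geq s (rev (red s)).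
Proof. by rewrite /geq (@red_id (rev _)) ?revK // reduced_rev red_reduced. Qed.

Lemma geq_cancel s t : geq (s ++ invw s ++ t) t.
Proof. by rewrite /geq /red !act_cat act_invw. Qed.

Lemma geq_cancelV s t : geq (invw s ++ s ++ t) t.
Proof. by rewrite -{2}(invwK s); apply: geq_cancel. Qed.

Lemma geqM s : geq (s ++ invw s) [::].
Proof. by rewrite -[invw s]cats0; apply: geq_cancel. Qed.

Lemma geqV s : geq (invw s ++ s) [::].
Proof. by rewrite -{2}(invwK s); apply: geqM. Qed.

Lemma geq_eqinv s t : geq (s ++ t) [::] -> geq t (invw s).
Proof.
move=> h; have: geq (invw s ++ (s ++ t)) (invw s ++ [::]) by apply: geq_cat.
by rewrite cats0 /geq geq_cancelV.
Qed.

Lemma geq_rot s t : geq (s ++ t) [::] -> geq (t ++ s) [::].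
Proof.
move/geq_eqinv => h; have: geq (t ++ s) (invw s ++ s) by apply: geq_cat.
by rewrite /geq geqV.
Qed.

Lemma geq_conj s t : geq (s ++ t ++ invw s) [::] -> geq t [::].
Proof.
move/geq_eqinv => h.
have : geq ((t ++ invw s) ++ s) (invw s ++ s) by apply: geq_cat.
rewrite -catA => h'; apply: etrans (geqV s); apply: etrans h'.
by rewrite -{1}[t]cats0; apply: geq_cat => //; apply/esym/geqV.
Qed.

Lemma geq_nil_reduced s : reduced s -> geq s [::] -> s = [::].
Proof. by move=> hs; rewrite /geq (red_id hs) => /(congr1 rev); rewrite revK. Qed.

Lemma geq_reduced_eq s t : reduced s -> reduced t -> geq s t -> s = t.
Proof. by move=> hs ht; rewrite /geq !red_id // => /(inv_inj revK). Qed.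

(* Innermost cancellation: nothing between x and its inverse can disappear. *)
Lemma innermost_cancel x s t u :
  ginv x \notin s -> x \notin u -> x \notin t -> ginv x \notin t ->
  geq (s ++ x :: t ++ ginv x :: u) [::] -> geq t [::].
Proof.
move=> hs hu ht ht' E; apply/eqP; apply: contraT => tN.
(* Passing to reduced forms introduces no new letters, so the hypotheses survive; with a nonempty
   middle segment the whole word would then be reduced. *)
pose r s := rev (red s).
have rr s' : reduced (r s') by rewrite reduced_rev red_reduced.
have mr s' y : y \notin s' -> y \notin r s'.
  by apply: contraNN; rewrite mem_rev; apply: mem_red.
have {}E: geq (r s ++ x :: r t ++ ginv x :: r u) [::].
  apply: etrans E; rewrite -!(cat1s _ (_ ++ _)) -!(cat1s _ (r u)) -!(cat1s _ u).
  by do !apply: geq_cat => //; apply/esym/geq_red.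
suff h : reduced (r s ++ x :: r t ++ ginv x :: r u).
  by move/(geq_nil_reduced h): E; case: (r s).
have : r t != [::].
  by apply: contraNneq tN => /(congr1 rev); rewrite revK => ->.
move: (rr s) (rr t) (rr u) (mr _ _ hs) (mr _ _ hu) (mr _ _ ht) (mr _ _ ht').
move: (r s) (r t) (r u) => s' t' u' {hs hu ht ht' E tN mr} rs rt ru hs hu ht ht' tN.
have noc a v w : reduced v -> ginv a \notin v -> reduced (rcons v a).
  case: v => //= b v hv hb; rewrite rcons_path hv /= nocancel_sym /nocancel.
  by apply: contraNneq hb => <-; apply: mem_last.
apply: reduced_overlap; first exact: noc.
rewrite -cat_cons; apply: reduced_overlap.
  rewrite /reduced /= rcons_path -/(reduced _).
  case: t' tN rt ht ht' => //= b t' _ hb; rewrite !inE !negb_or.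
  move=> /andP [xb hx] /andP [xb' _].
  rewrite /nocancel eq_sym xb' hb (inj_eq (inv_inj ginvK)) /=.
  by apply: contraNneq (_ : x \notin b :: t'); rewrite ?inE ?negb_or ?xb // => ->; apply: mem_last.
apply: reduced_cons => //; case: u' hu {ru} => //= b u'.
by rewrite inE negb_or /nocancel ginvK eq_sym => /andP [].
Qed.

(** Read from another side of the same polygon, a word is rotated and all its colors are shifted by
    a constant; this is the shift. *)
Definition flb (b : bool) s := if b then flw s else s.

Lemma flbE b s : flb b s = map (fun l : L => let: (i, c, f) := l in (i, c (+) b, f)) s.
Proof.
case: b; last by rewrite /flb map_id_in // => [[[i c] f]] _; rewrite addbF.
by apply: eq_map => [[[i c] f]]; rewrite addbT.
Qed.

Lemma flb_cat b s t : flb b (s ++ t) = flb b s ++ flb b t.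
Proof. by rewrite !flbE map_cat. Qed.

Lemma flw_flb b s : flw (flb b s) = flb b (flw s).
Proof. by case: b. Qed.

Lemma size_flb b s : size (flb b s) = size s.
Proof. by rewrite flbE size_map. Qed.

Lemma reduced_flb b s : reduced (flb b s) = reduced s.
Proof. by case: b; rewrite /= ?reduced_flw. Qed.

End FreeGroup.

(** * Eliminating a generator *)

Lemma split_first (T : eqType) (p : pred T) s : has p s ->
  exists s1 x s2, [/\ s = s1 ++ x :: s2, p x & ~~ has p s1].
Proof.
elim: s => //= x s IH; case px: (p x) => /=.
  by move=> _; exists [::], x, s.
by case/IH=> s1 [z [s2 [-> pz h]]]; exists (x :: s1), z, s2; rewrite /= px.
Qed.

Lemma split_last (T : eqType) (p : pred T) s : has p s ->
  exists s1 x s2, [/\ s = s1 ++ x :: s2, p x & ~~ has p s2].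
Proof.
rewrite -has_rev => /split_first [s1 [x [s2 [E px h]]]].
exists (rev s2), x, (rev s1); rewrite has_rev; split=> //.
by rewrite -(revK s) E rev_cat rev_cons cat_rcons.
Qed.

Section Elimination.
Variables (T : eqType) (i : T) (y f : bool) (U V : seq (T * bool * bool)).
Notation L := (T * bool * bool)%type.
Implicit Types (l : L) (s t w : seq L).

Notation onI := (fun l : L => gnode l == i).
Notation xi := ((i, y, f) : L).
(** [gflip xi] is the inverse of [(i, y, ~~ f)]. Solving [U xi V (flw U) (gflip xi) (flw V) = 1] for
    the latter gives [alpha xi beta]. *)
Definition alpha := flw V ++ U.
Definition beta := V ++ flw U.

Hypotheses (hU : ~~ has onI U) (hV : ~~ has onI V).

Lemma has_flw s : has onI (flw s) = has onI s.
Proof. by rewrite has_map; apply: eq_has => l /=; rewrite gnode_flip. Qed.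

Lemma has_invw s : has onI (invw s) = has onI s.
Proof. by rewrite has_rev has_map; apply: eq_has => l /=; rewrite gnode_inv. Qed.

Lemma alpha_noi : ~~ has onI alpha.
Proof. by rewrite has_cat has_flw negb_or hV hU. Qed.
Lemma beta_noi : ~~ has onI beta.
Proof. by rewrite has_cat has_flw negb_or hV hU. Qed.

(* The relation w (flw w) = 1 for w = U xi V expresses (i, y, ~~ f) through the
   other generators; substituting this value eliminates it. *)
Definition theta_base (b : bool) : seq L := if b then [:: xi] else alpha ++ xi :: beta.
(** The test [(f' == f) == (y' == y)] singles out [xi] and [ginv xi]; the other two letters at [i]
    are the eliminated one and its inverse. *)
Definition theta l : seq L :=
  let: (k, y', f') := l in
  if k != i then [:: l] else
  let b := theta_base ((f' == f) == (y' == y)) in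
  if y' == y then b else invw b.
Definition thetaw s := flatten (map theta s).

Lemma thetaw_cat s t : thetaw (s ++ t) = thetaw s ++ thetaw t.
Proof. by rewrite /thetaw map_cat flatten_cat. Qed.

Lemma theta_inv l : theta (ginv l) = invw (theta l).
Proof.
case: l => [[k y'] f'] /=; case: eqP => //= _.
have E b c : (~~ b == c) = ~~ (b == c) by case: b c => [] [].
have -> : (~~ f' == f) == (~~ y' == y) = ((f' == f) == (y' == y)).
  by rewrite !E; case: (_ == f) (_ == y) => [] [].
by rewrite E; case: (y' == y); rewrite ?invwK.
Qed.

Lemma thetaw_inv s : thetaw (invw s) = invw (thetaw s).
Proof.
elim: s => // l s IH; rewrite -cat1s invw_cat !thetaw_cat invw_cat IH.
by congr (_ ++ _); rewrite /thetaw /= !cats0 theta_inv.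
Qed.

Lemma thetaw_id s : ~~ has onI s -> thetaw s = s.
Proof.
elim: s => //= [[[k y'] f'] s] IH; rewrite negb_or => /andP [hk /IH E].
by rewrite /thetaw /= hk /= -/(thetaw s) E.
Qed.

Lemma thetaw_rel : geq (thetaw (U ++ xi :: V ++ flw U ++ gflip xi :: flw V)) [::].
Proof.
rewrite -cat1s -(cat1s (gflip xi)) !thetaw_cat (thetaw_id hU) (thetaw_id hV).
rewrite (@thetaw_id (flw U)) ?has_flw // (@thetaw_id (flw V)) ?has_flw //.
rewrite {1 2}/thetaw /= eqxx /= !eqxx /=.
have -> : (~~ y == y) = false by case: y.
have E : alpha ++ xi :: beta = (alpha ++ [:: xi]) ++ beta by rewrite -catA.
rewrite /= E (invw_cat (alpha ++ _)) (invw_cat alpha) -[invw [:: xi]]/[:: ginv xi] cats0 {E}.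
set c := (X in geq (U ++ X) _).
have -> : c = [:: xi] ++ (beta ++ invw beta ++ ([:: ginv xi] ++ (invw alpha ++ flw V))).
  by rewrite /c /beta -!catA.
have h : geq (U ++ ([:: xi] ++ (beta ++ invw beta ++ ([:: ginv xi] ++ (invw alpha ++ flw V)))))
          (U ++ ([:: xi] ++ ([:: ginv xi] ++ (invw alpha ++ flw V)))).
  by do 2!apply: geq_cat => //; apply: geq_cancel.
apply: (etrans h) => {c h}.
have h : geq (U ++ ([:: xi] ++ ([:: ginv xi] ++ (invw alpha ++ flw V))))
          (U ++ (invw alpha ++ flw V)).
  by apply: geq_cat => //; apply: (@geq_cancel _ [:: xi]).
apply: (etrans h); rewrite /alpha invw_cat -catA {h}.
have h : geq (U ++ invw U ++ invw (flw V) ++ flw V) (invw (flw V) ++ flw V).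
  exact: geq_cancel.
by apply: (etrans h); apply: geqV.
Qed.

(** Either value of [theta_base] contains a single letter at [i], namely [xi]; so the type of a
    letter at [i] decides the sign of the exponent of [xi] in its image. *)
Lemma mem_thetaw s z l :
  all (fun l => onI l ==> (l.1.2 == z)) s -> l \in thetaw s -> onI l ->
  l = if z == y then xi else ginv xi.
Proof.
move=> hs /flattenP [u /mapP [[[k y'] f'] hk ->]] /=.
have := allP hs _ hk; rewrite /gnode /=.
have nb m b : m \in theta_base b -> onI m -> m = xi.
  case: b; rewrite ?inE; first by move/eqP.
  rewrite mem_cat inE => /or3P [h1|/eqP //|h1] h2.
    by case/hasP: alpha_noi; exists m.
  by case/hasP: beta_noi; exists m.
case: (k =P i) => [_ /eqP -> | hk' _] /=; last by rewrite inE => /eqP -> /eqP.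
case: (z == y); first exact: nb.
rewrite mem_invw => h1 h2; rewrite -[l]ginvK (nb _ _ h1) //.
by rewrite gnode_inv.
Qed.

Lemma theta_y b : theta (i, y, b) =
  (if b == f then [::] else alpha) ++ xi :: (if b == f then [::] else beta).
Proof. by rewrite /theta !eqxx /= /theta_base; case: (b == f). Qed.

Lemma theta_ny b : theta (i, ~~ y, b) =
  invw (if b == f then beta else [::]) ++ ginv xi :: invw (if b == f then alpha else [::]).
Proof.
rewrite /theta eqxx /= /theta_base.
have -> : (~~ y == y) = false by case: y.
by case: (b == f) => //=; rewrite -cat1s !invw_cat -catA.
Qed.

(* In the image of w (flw w), where w only contains i-letters of the type y,
   the powers of xi are first positive, then negative; so the segment between
   the last i-letter of w and the first one of flw w must cancel.  If these two
   letters are xi, this says s2 (flw s0) = beta; the other cases are excluded by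
   the position and the sides of the j-letters. *)
Lemma innermost_match w j g :
  reduced beta -> reduced (w ++ flw w) ->
  xi \in w -> all (fun l => onI l ==> (l.1.2 == y)) w ->
  (forall l, l \in w -> gnode l = j -> l.2 = g) ->
  (exists2 l, l \in U ++ V & gnode l = j /\ l.2 = g) ->
  (gnode (head xi w) != i) || (gnode (last xi w) != i) ->
  geq (thetaw (w ++ flw w)) [::] ->
  exists s0 m s2, [/\ w = s0 ++ m ++ s2, s2 ++ flw s0 = beta, 0 < size m
                    & size m = 1 -> m = [:: xi]].
Proof.
move=> rbeta rw xw hw hj [lj lj1 [lj2 lj3]] hends.
have hI : has onI w by apply/hasP; exists xi; rewrite //= eqxx.
have [s0 [a [R [Ea ai h0]]]] := split_first hI.
have [A0 [b [s2 [Eb bi h2]]]] := split_last hI.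
have aw : a \in w by rewrite Ea mem_cat inE eqxx orbT.
have bw : b \in w by rewrite Eb mem_cat inE eqxx orbT.
have {}ai : exists fa, a = (i, y, fa).
  move: (allP hw _ aw) ai; case: a {Ea aw} => [[k y'] fa]; rewrite /gnode /=.
  by move=> /implyP h hk; exists fa; rewrite (eqP hk) (eqP (h hk)).
have {}bi : exists fb, b = (i, y, fb).
  move: (allP hw _ bw) bi; case: b {Eb bw} => [[k y'] fb]; rewrite /gnode /=.
  by move=> /implyP h hk; exists fb; rewrite (eqP hk) (eqP (h hk)).
case: ai => fa ai; case: bi => fb bi; subst a b.
have noi2 : ~~ has onI (s2 ++ flw s0) by rewrite has_cat has_flw negb_or h0 h2.
have rD : reduced (s2 ++ flw s0).
  move: rw; rewrite {1}Eb {1}Ea flw_cat -cat1s -(cat1s (i, y, fa)) flw_cat -!catA.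
  by rewrite catA => /reduced_catW [_]; rewrite catA => /reduced_catW [].
have nI s l : ~~ has onI s -> gnode l = i -> l \notin s.
  by move=> /hasPn h hl; apply/negP=> /h; rewrite /= hl eqxx.
have nIif b s : ~~ has onI s -> ~~ has onI (if b then [::] else s) by case: b.
have nIif' b s : ~~ has onI s -> ~~ has onI (if b then s else [::]) by case: b.
have hA0 : all (fun l => onI l ==> (l.1.2 == y)) A0.
  by move: hw; rewrite Eb all_cat => /andP [].
have hR : all (fun l => onI l ==> (l.1.2 == ~~ y)) (flw R).
  move: hw; rewrite Ea all_cat /= => /and3P [_ _] /allP h.
  apply/allP=> l; rewrite mem_flw => /h; rewrite gnode_flip.
  by case: l => [[k y'] f'] /=; case: (k == i) => //=; case: y' (y) => [] [].
have ny : (~~ y == y) = false by case: y.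
have nx : xi <> ginv xi by case: y => [] [].
have ix : gnode (ginv xi) = i by rewrite gnode_inv.
move=> hg.
(* Between the last [xi] coming from [w] and the first [ginv xi] coming from [flw w] lies
   [s2 ++ flw s0], preceded by [beta] if [b] is the eliminated letter and followed by the inverse of
   [beta] if [gflip a] is its inverse. *)
have {hg} : geq ((if fb == f then [::] else beta) ++ (s2 ++ flw s0) ++
            invw (if fa == f then beta else [::])) [::].
  apply: (@innermost_cancel _ xi
    (thetaw A0 ++ (if fb == f then [::] else alpha)) _
    (invw (if fa == f then alpha else [::]) ++ thetaw (flw R))).
  - rewrite mem_cat negb_or [X in _ && X]nI ?nIif ?alpha_noi // andbT.
    apply/negP=> /(mem_thetaw hA0); rewrite /= eqxx eqxx => /(_ isT) h.
    exact: nx (esym h).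
  - rewrite mem_cat negb_or nI ?has_invw ?nIif' ?alpha_noi //=.
    apply/negP=> /(mem_thetaw hR); rewrite /= eqxx ny => /(_ isT) h.
    exact: nx h.
  - apply: nI => //; rewrite has_cat negb_or nIif ?beta_noi //.
    by rewrite has_cat negb_or noi2 has_invw nIif' ?beta_noi.
  - apply: nI => //; rewrite has_cat negb_or nIif ?beta_noi //.
    by rewrite has_cat negb_or noi2 has_invw nIif' ?beta_noi.
  - apply: etrans hg; congr (red _).
    rewrite {1}Eb {1}Ea flw_cat -(cat1s (i, y, fa)) flw_cat -(cat1s (i, y, fb)) -!catA !thetaw_cat.
    have E1 : thetaw [:: (i, y, fb)] = theta (i, y, fb) by rewrite /thetaw /= cats0.
    have E2 : thetaw (flw [:: (i, y, fa)]) = theta (i, ~~ y, fa).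
      by rewrite /thetaw /= cats0.
    rewrite E1 E2 theta_y theta_ny (thetaw_id h2) (@thetaw_id (flw s0)) ?has_flw //.
    by rewrite -!catA.
case: eqP => [efb|nfb]; case: eqP => [efa|nfa].
- rewrite /= => hD.
  have ED : s2 ++ flw s0 = beta.
    apply: geq_reduced_eq => //.
    by have := geq_eqinv (geq_rot hD); rewrite invwK.
  have hs : size s0 <= size A0.
    rewrite leqNgt; apply/negP=> lt; case/hasP: h0; exists (i, y, fb) => //=.
    have := congr1 (nth xi ^~ (size A0)) (etrans (esym Ea) Eb).
    rewrite !nth_cat lt ltnn subnn /= => <-; exact: mem_nth.
  have E0 : s0 = take (size s0) A0.
    have := congr1 (take (size s0)) (etrans (esym Ea) Eb).
    rewrite take_size_cat // take_cat; case: ltnP => // h.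
    have -> : size s0 - size A0 = 0 by apply/eqP; rewrite subn_eq0.
    by rewrite take0 cats0 => {1}->; rewrite take_oversize.
  exists s0, (rcons (drop (size s0) A0) (i, y, fb)), s2; split=> //.
  + by rewrite Eb cat_rcons catA {1}E0 cat_take_drop.
  + by rewrite size_rcons.
  + rewrite size_rcons => [[h]]; rewrite efb.
    by rewrite (size0nil h).
(* The segment is trivial, hence empty by reducedness; then [w] would begin and end with letters at
   [i], against [hends]. *)
- move=> /= hD.
  have /(congr1 size)/eqP : s2 ++ flw s0 = [::].
    by apply: geq_nil_reduced => //; rewrite cats0 in hD.
  rewrite size_cat size_map addn_eq0 => /andP [/nilP e2 /nilP e0].
  move: hends; rewrite {1}Ea Eb e0 e2 /= last_cat /= /gnode /=.
  by rewrite eqxx.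
- move=> /= /geq_conj hD.
  have /(congr1 size)/eqP : s2 ++ flw s0 = [::] by apply: geq_nil_reduced.
  rewrite size_cat size_map addn_eq0 => /andP [/nilP e2 /nilP e0].
  by move: hends; rewrite {1}Ea Eb e0 e2 /= last_cat /= /gnode /= eqxx.
(* Now the segment is the inverse of [beta]. Inversion changes the side of the letter at [j] in
   [beta], while all letters of [w] at [j] are on side [g]. *)
- rewrite /= cats0 => /geq_eqinv /geq_reduced_eq; rewrite reduced_invw => /(_ rD rbeta) ED.
  have: exists2 l, l \in beta & gnode l = j /\ l.2 = g.
    move: lj1; rewrite mem_cat orbC => /orP [h|h].
      by exists lj; rewrite // mem_cat h.
    exists (gflip lj); first by rewrite mem_cat mem_flw gflipK h orbT.
    by rewrite gnode_flip; split=> //; case: lj lj3 {lj2 h} => [[]].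
  case=> l lbe [ln lg].
  have : ginv l \in s2 ++ flw s0 by rewrite ED mem_invw ginvK.
  rewrite mem_cat mem_flw => /orP h.
  have : (ginv l).2 = g.
    case: h => h.
      by apply: hj; rewrite ?gnode_inv // Eb mem_cat inE h !orbT.
    have := hj (gflip (ginv l)); rewrite Ea mem_cat h gnode_flip gnode_inv => /(_ isT ln).
    by case: (l) => [[]].
  by rewrite -lg; case: (l) => [[k y'] []].
Qed.

End Elimination.

(** * Angle words *)

Section QuiverWords.
Variable Q : quiver_data.

(* [src_side] and [tgt_side], for quivers not yet known to be ordered. *)
Definition srcside (a : arrow Q) : bool := a \in out true (src a).
Definition tgtside (a : arrow Q) : bool := a \in inc true (tgt a).
(** An arrow of color t contributes the (t+1)-st iterate of sigma tau, which exchanges X and Y;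
    hence the negated color. *)
Definition in_letter (a : arrow Q) := (src a, ~~ col a, srcside a).
Definition out_letter (a : arrow Q) := (tgt a, ~~ col a, tgtside a).
Definition inw (f : bool) (k : node Q) := map in_letter (inc f k).
Definition outw (f : bool) (k : node Q) := map out_letter (out f k).
Definition angle_word (f : bool) (k : node Q) :=
  inw f k ++ (k, false, f) :: outw f k.

Hypothesis splitP : is_splitting Q.

Lemma uniq_inc k : uniq (inc false k ++ inc true k : seq (arrow Q)).
Proof. by rewrite (perm_uniq (splitP k).1) enum_uniq. Qed.
Lemma uniq_out k : uniq (out false k ++ out true k : seq (arrow Q)).
Proof. by rewrite (perm_uniq (splitP k).2) enum_uniq. Qed.

Lemma mem_inc f k (a : arrow Q) :
  (a \in inc f k) = [&& a \in pruned Q, tgt a == k & tgtside a == f].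
Proof.
have := perm_mem (splitP k).1 a; rewrite mem_cat mem_enum inE => h.
have := uniq_inc k; rewrite cat_uniq => /and3P [_ /hasPn u _].
rewrite andbA; case: eqP h => [E|_]; rewrite ?andbT ?andbF; last first.
  by move/negbT; rewrite negb_or => /andP [h1 h2]; case: f; apply/negbTE.
move=> <-; rewrite /tgtside E; move: (u a).
by case: f; case: (a \in inc true k); case: (a \in inc false k) => //= /(_ isT).
Qed.

Lemma mem_out f k (a : arrow Q) :
  (a \in out f k) = [&& a \in pruned Q, src a == k & srcside a == f].
Proof.
have := perm_mem (splitP k).2 a; rewrite mem_cat mem_enum inE => h.
have := uniq_out k; rewrite cat_uniq => /and3P [_ /hasPn u _].
rewrite andbA; case: eqP h => [E|_]; rewrite ?andbT ?andbF; last first.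
  by move/negbT; rewrite negb_or => /andP [h1 h2]; case: f; apply/negbTE.
move=> <-; rewrite /srcside E; move: (u a).
by case: f; case: (a \in out true k); case: (a \in out false k) => //= /(_ isT).
Qed.

Lemma mem_inwP l f k : reflect
  (exists2 a : arrow Q, a \in inc f k & l = in_letter a) (l \in inw f k).
Proof. exact: mapP. Qed.

Lemma mem_outwP l f k : reflect
  (exists2 a : arrow Q, a \in out f k & l = out_letter a) (l \in outw f k).
Proof. exact: mapP. Qed.

Hypotheses (loopQ : loopless Q) (cycQ : no_2cycle Q) (pruneQ : is_pruning Q).

(** An arrow survives the pruning only if its color is in the strict majority among the arrows with
    the same ends. *)
Lemma pruned_col (a b : arrow Q) : a \in pruned Q -> b \in pruned Q ->
  src a = src b -> tgt a = tgt b -> col a = col b.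
Proof.
move=> pa pb sab tab.
have pos c : c \in pruned Q -> src c = src a -> tgt c = tgt a ->
    (#|arrows_between (~~ col c) (src a) (tgt a)| <
     #|arrows_between (col c) (src a) (tgt a)|)%N.
  move=> pc sc tc; rewrite -subn_gt0 -pruneQ card_gt0; apply/set0Pn; exists c.
  by rewrite !inE pc sc tc !eqxx.
have := pos a pa erefl erefl; have := pos b pb (esym sab) (esym tab).
by case: (col a); case: (col b) => //= h1 h2; have := ltn_trans h1 h2; rewrite ltnn.
Qed.

Lemma inw_col l m f k : l \in inw f k -> m \in inw f k -> gnode l = gnode m -> l.1.2 = m.1.2.
Proof.
move=> /mem_inwP [a + ->] /mem_inwP [b + ->] /= sab.
rewrite !mem_inc => /and3P [pa /eqP ta _] /and3P [pb /eqP tb _].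
by rewrite (pruned_col pa pb) // ta tb.
Qed.

Lemma outw_col l m f k : l \in outw f k -> m \in outw f k -> gnode l = gnode m -> l.1.2 = m.1.2.
Proof.
move=> /mem_outwP [a + ->] /mem_outwP [b + ->] /= sab.
rewrite !mem_out => /and3P [pa /eqP ta _] /and3P [pb /eqP tb _].
by rewrite (pruned_col pa pb) // ta tb.
Qed.

Lemma inw_node l f k : l \in inw f k -> gnode l != k.
Proof.
move=> /mem_inwP [a + ->]; rewrite mem_inc => /and3P [_ /eqP <- _].
exact: loopQ.
Qed.

Lemma outw_node l f k : l \in outw f k -> gnode l != k.
Proof.
move=> /mem_outwP [a + ->]; rewrite mem_out => /and3P [_ /eqP <- _].
by rewrite eq_sym; apply: loopQ.
Qed.

Lemma inw_outw l m f f' k : l \in inw f k -> m \in outw f' k -> gnode l != gnode m.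
Proof.
move=> /mem_inwP [a + ->] /mem_outwP [b + ->].
rewrite mem_inc mem_out => /and3P [_ /eqP ta _] /and3P [_ /eqP sb _].
apply/eqP => E; have := cycQ a b.
by rewrite ta sb eqxx andbT [src a]E eqxx.
Qed.

(** Inverse letters have the same node but differ in color and in side. The word is covered by three
    windows overlapping in the letter of [k] and its flip. In each window, letters at a common node
    agree in color or in side: by pruning within incoming or outgoing letters, while an incoming and
    an outgoing letter never share a node. *)
Lemma reduced_angle_word f k : reduced (angle_word f k ++ flw (angle_word f k)).
Proof.
pose self : node Q * bool * bool := (k, false, f).
have nc (s : seq (node Q * bool * bool)) :
    (forall l m, l \in s -> m \in s -> gnode l = gnode m -> l.1.2 = m.1.2 \/ l.2 = m.2) ->
    reduced s.
  move=> h; apply: (@pairwise_sorted _ (@nocancel _)); apply/(pairwiseP self).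
  move=> i j; rewrite !inE => hi hj _; apply/eqP=> E.
  have [] := h _ _ (mem_nth self hi) (mem_nth self hj).
  - by rewrite E gnode_inv.
  - by rewrite E; case: (nth _ _ _) => [[x []] y].
  - by rewrite E; case: (nth _ _ _) => [[x y] []].
have colf (s : seq (node Q * bool * bool)) :
   (forall l m, l \in s -> m \in s -> gnode l = gnode m -> l.1.2 = m.1.2) ->
   (forall l m, l \in flw s -> m \in flw s -> gnode l = gnode m -> l.1.2 = m.1.2).
  move=> h l m; rewrite !mem_flw => hl hm E.
  have := h _ _ hl hm; rewrite !gnode_flip => /(_ E).
  by case: l m {hl hm E} => [[? ?] ?] [[? ?] ?] /= /(inv_inj negbK).
have r2 : reduced (self :: outw f k ++ flw (inw f k) ++ [:: gflip self]).
  apply: nc => l m; rewrite !in_cons !mem_cat !mem_seq1.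
  have oN x : x \in outw f k -> gnode x <> k by move=> /outw_node /eqP.
  have iN x : x \in flw (inw f k) -> gnode x <> k.
    by rewrite mem_flw => /inw_node; rewrite gnode_flip => /eqP.
  have oi x y : x \in outw f k -> y \in flw (inw f k) -> gnode x <> gnode y.
    by move=> hx; rewrite mem_flw => /inw_outw /(_ hx); rewrite gnode_flip eq_sym => /eqP.
  case/or4P=> [/eqP ->|hl|hl|/eqP ->]; case/or4P=> [/eqP ->|hm|hm|/eqP ->] // E;
    try by [right | case: (oN _ hl) | case: (oN _ hm) | case: (iN _ hl) | case: (iN _ hm)].
  - by left; apply: outw_col hl hm E.
  - by case: (oi _ _ hl hm).
  - by case: (oi _ _ hm hl).
  - by left; apply: (colf _ (fun x y => @inw_col x y f k) l m).
have r1 : reduced (rcons (inw f k) self).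
  apply: nc => l m; rewrite !mem_rcons !inE.
  case/orP=> [/eqP ->|hl]; case/orP=> [/eqP ->|hm] // E; first by left.
  - by case/eqP: (inw_node hm).
  - by case/eqP: (inw_node hl).
  - by left; apply: inw_col hl hm E.
have r3 : reduced (gflip self :: flw (outw f k)).
  rewrite -[_ :: _]/(flw (self :: outw f k)) reduced_flw.
  by move: r2; rewrite -cat_cons => /reduced_catW [].
rewrite /angle_word flw_cat -/self.
have -> : flw (self :: outw f k) = gflip self :: flw (outw f k) by [].
rewrite catA; apply: reduced_overlap => //.
rewrite -cats1 -!catA /=; apply: reduced_overlap => //.
Qed.

End QuiverWords.

(** * Isomorphisms of quivers from their angle words *)

(** Elements with the same key are paired by their positions in the enumerations of the two fibers.
    This turns equalities of numbers of arrows into maps of arrows. *)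
Lemma fiber_injection (A B : finType) (K : eqType) (k : A -> K) (h : B -> K) :
  (forall x, #|[set a | k a == x]| = #|[set b | h b == x]|) ->
  exists2 f : A -> B, injective f & forall a, h (f a) = k a.
Proof.
move=> E; pose SA x := [set a | k a == x]; pose SB x := [set b | h b == x].
have idx (a : A) : index a (enum (SA (k a))) < size (enum (SB (k a))).
  by rewrite -cardE -E cardE index_mem mem_enum inE.
have [f fP] : exists f : A -> B, forall a, h (f a) = k a /\
    index (f a) (enum (SB (k a))) = index a (enum (SA (k a))).
  suff F (a : A) : {b : B | h b = k a /\
      index b (enum (SB (k a))) = index a (enum (SA (k a)))}.
    by exists (fun a => sval (F a)) => a; case: (F a).
  have := idx a; case Es : (enum (SB (k a))) => [//|b0 s]; rewrite -{}Es => lt.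
  exists (nth b0 (enum (SB (k a))) (index a (enum (SA (k a))))).
  rewrite index_uniq ?enum_uniq //; split=> //.
  by have := mem_nth b0 lt; rewrite mem_enum inE => /eqP.
exists f => [a a' ff|a]; last by case: (fP a).
have [h1 i1] := fP a; have [h2 i2] := fP a'.
have kk : k a = k a' by rewrite -h1 -h2 ff.
rewrite ff in i1; rewrite -kk i1 in i2.
have aS : a \in enum (SA (k a)) by rewrite mem_enum inE.
have aS' : a' \in enum (SA (k a)) by rewrite mem_enum inE kk.
by rewrite -(nth_index a aS) -(nth_index a aS') i2.
Qed.

Lemma fiber_bijection (A B : finType) (K : eqType) (k : A -> K) (h : B -> K) :
  (forall x, #|[set a | k a == x]| = #|[set b | h b == x]|) ->
  exists2 f : A -> B, bijective f & forall a, h (f a) = k a.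
Proof.
move=> E; have [f fi fk] := fiber_injection E; exists f => //.
have [g gi _] := fiber_injection (fun x => esym (E x)).
by apply: inj_card_bij => //; apply: leq_card gi.
Qed.

Lemma eq_from_uniq_map (A B : eqType) (h : A -> B) (s t : seq A) :
  uniq (map h s) -> {subset t <= s} -> map h s = map h t -> s = t.
Proof.
move=> us ts E; have sz : size s = size t by rewrite -(size_map h) E size_map.
case: s us ts E sz => [|x0 s]; first by case: t.
move: (x0 :: s) => {}s us ts E sz; apply: (@eq_from_nth _ x0) => // i lt.
have ti : nth x0 t i \in s by apply: ts; rewrite mem_nth // -sz.
rewrite -(nth_index x0 ti); congr nth; apply/eqP.
rewrite -(@nth_uniq _ (h x0) (map h s)) ?size_map ?index_mem //; apply/eqP.
by rewrite [RHS](nth_map x0) ?index_mem // nth_index // {1}E (nth_map x0) // -sz.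
Qed.

Definition slot_map (N N' : Type) (fn : N -> N') (l : N * bool * bool) : N' * bool * bool :=
  let: (i, y, f) := l in (fn i, y, f).

Section IsoFromWords.
Variables (Q Q' : quiver_data) (fn : node Q -> node Q').
Hypotheses (splitQ : is_splitting Q) (splitQ' : is_splitting Q').
Hypothesis fn_bij : bijective fn.
Hypothesis inw_eq : forall f k, inw f (fn k) = map (slot_map fn) (inw f k).
Hypothesis outw_eq : forall f k, outw f (fn k) = map (slot_map fn) (outw f k).
Definition gslot (T : Type) (l : T * bool * bool) : T * bool := (l.1.1, l.2).
Hypothesis uniq_inw : forall f k, uniq (map (@gslot _) (inw f k : seq (node Q * bool * bool))).
Hypothesis uniq_outw : forall f k, uniq (map (@gslot _) (outw f k : seq (node Q * bool * bool))).
Hypothesis unpruned_eq : forall t i j,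
  #|arrows_between t i j :\: pruned Q| = #|arrows_between t (fn i) (fn j) :\: pruned Q'|.

Let fn_inj : injective fn. Proof. exact: bij_inj. Qed.
Let slot_map_inj : injective (slot_map fn).
Proof. by move=> [[i y] f] [[i' y'] f'] [/fn_inj -> -> ->]. Qed.

(** All that an isomorphism has to preserve, except for the order in the tuples; sides are recorded
    for pruned arrows only. The map [h] carries the nodes of both quivers into one type, so that
    their keys can be compared. *)
Definition arrow_key (R : quiver_data) (N : Type) (h : node R -> N) (a : arrow R) :=
  (a \in pruned R, (h (src a), (a \in pruned R) && srcside a),
   (h (tgt a), (a \in pruned R) && tgtside a), ~~ col a).

Lemma card_key (R : quiver_data) (N : eqType) (h : node R -> N) (p : bool) i f j g y :
    is_splitting R -> injective h ->
  #|[set a | arrow_key h a == (p, (h i, f), (h j, g), y)]| =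
  if p then count_mem (j, y, g) (outw f i) else
  if f || g then 0 else #|arrows_between (~~ y) i j :\: pruned R|.
Proof.
move=> spl hi; have keyE a : (arrow_key h a == (p, (h i, f), (h j, g), y)) =
   [&& (a \in pruned R) == p, src a == i, (a \in pruned R) && srcside a == f,
     tgt a == j, (a \in pruned R) && tgtside a == g & col a == ~~ y].
  rewrite /arrow_key !xpair_eqE !(inj_eq hi) -!andbA.
  by congr [&& _, _, _, _, _ & _]; case: (col a) y => [] [].
case: p keyE => keyE.
  rewrite count_map -size_filter.
  have u : uniq (out f i : seq (arrow R)).
    have := uniq_out spl i; rewrite cat_uniq => /and3P [h1 _ h2].
    by case: f {keyE}.
  rewrite -(card_uniqP (filter_uniq _ u)); apply: eq_card => a.
  rewrite inE keyE mem_filter mem_out //= /out_letter !xpair_eqE.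
  case: (a \in pruned R) => /=; last by rewrite andbF.
  case: (src a == i) => /=; last by rewrite !andbF.
  case: (srcside a == f) => /=; last by rewrite !andbF.
  rewrite andbT -!andbA; congr (_ && _); rewrite andbC; congr (_ && _).
  by case: (col a); case: (y).
case: ifP => [fg|/norP [/negPf f0 /negPf g0]].
  apply/eqP; rewrite cards_eq0; apply/eqP/setP=> a; rewrite !inE keyE.
  by case: (a \in pruned R) => //=; case/orP: fg => ->; rewrite ?andbF.
apply: eq_card => a; rewrite !inE keyE f0 g0.
by case: (a \in pruned R); rewrite ?andbF.
Qed.

(** Arrows are matched by their keys alone. The order in the tuples is then respected, since the
    slots occurring in a tuple are distinct and an arrow of it is determined by its letter. *)
Lemma quiver_iso_words : quiver_iso Q Q'.
Proof.
have [fn' fnK fnK'] := fn_bij.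
have [x|fa fa_bij faP] := fiber_bijection (k := arrow_key fn) (h := arrow_key (@id (node Q'))).
  case: x => [[[p [i' f]] [j' g]] y]; rewrite -(fnK' i') -(fnK' j').
  rewrite card_key // (@card_key Q' _ (@id (node Q'))) //; case: p.
    rewrite outw_eq [RHS]count_map; apply: eq_count => l /=.
    by rewrite -(inj_eq slot_map_inj).
  by case: ifP => // _; apply: unpruned_eq.
have keyP a : [/\ (fa a \in pruned Q') = (a \in pruned Q), src (fa a) = fn (src a),
    tgt (fa a) = fn (tgt a), col (fa a) = col a &
    a \in pruned Q -> srcside (fa a) = srcside a /\ tgtside (fa a) = tgtside a].
  have := faP a; rewrite /arrow_key => -[E1 -> E2 -> E3 /(inv_inj negbK) ->].
  by split=> // pa; move: E2 E3; rewrite E1 pa.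
exists fn, fa; split=> // [a|f k]; first by have [] := keyP a.
split.
  apply: (@eq_from_uniq_map _ _ (@in_letter Q')).
  - have := uniq_inw f k; rewrite -(map_inj_uniq (_ : injective (fun s => (fn s.1, s.2)))).
      rewrite -map_comp => u; apply: (@map_uniq _ _ (@gslot _)).
      rewrite -[map (@in_letter Q') _]/(inw f (fn k)) inw_eq -map_comp.
      by apply: etrans u; congr (uniq _); apply: eq_map => [[[? ?] ?]].
    by move=> [? ?] [? ?] [/fn_inj -> ->].
  - move=> b /mapP [a + ->]; rewrite !mem_inc // => /and3P [pa /eqP ta /eqP sa].
    have [-> _ -> _ h] := keyP a; have [_ ->] := h pa.
    by rewrite pa ta sa !eqxx.
  - rewrite -[LHS]/(inw f (fn k)) inw_eq -!map_comp; apply/eq_in_map => a.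
    rewrite mem_inc // => /and3P [pa _ _] /=.
    by rewrite /in_letter; have [_ -> _ -> h] := keyP a; have [-> _] := h pa.
apply: (@eq_from_uniq_map _ _ (@out_letter Q')).
- have := uniq_outw f k; rewrite -(map_inj_uniq (_ : injective (fun s => (fn s.1, s.2)))).
    rewrite -map_comp => u; apply: (@map_uniq _ _ (@gslot _)).
    rewrite -[map (@out_letter Q') _]/(outw f (fn k)) outw_eq -map_comp.
    by apply: etrans u; congr (uniq _); apply: eq_map => [[[? ?] ?]].
  by move=> [? ?] [? ?] [/fn_inj -> ->].
- move=> b /mapP [a + ->]; rewrite !mem_out // => /and3P [pa /eqP ta /eqP sa].
  have [-> -> _ _ h] := keyP a; have [-> _] := h pa.
  by rewrite pa ta sa !eqxx.
- rewrite -[LHS]/(outw f (fn k)) outw_eq -!map_comp; apply/eq_in_map => a.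
  rewrite mem_out // => /and3P [pa _ _] /=.
  by rewrite /out_letter; have [_ _ -> -> h] := keyP a; have [_ ->] := h pa.
Qed.

End IsoFromWords.

(** * Cyclic order on the sides of a polygon *)

Section CyclicShift.
Variable n : nat.
Implicit Types A B u v : 'I_n.

Lemma ord_gt0 A : 0 < n. Proof. exact: leq_ltn_trans (ltn_ord A). Qed.

Definition oshift A (j : nat) : 'I_n := Ordinal (ltn_pmod (A + j) (ord_gt0 A)).

Lemma cwdist_lt A B : cwdist A B < n.
Proof. by rewrite ltn_pmod // (ord_gt0 A). Qed.

Lemma oshiftD A i j : oshift (oshift A i) j = oshift A (i + j).
Proof. by apply: val_inj; rewrite /= modnDml addnA. Qed.

Lemma oshift0 A : oshift A 0 = A.
Proof. by apply: val_inj; rewrite /= addn0 modn_small. Qed.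

Lemma oshiftn A : oshift A n = A.
Proof. by apply: val_inj; rewrite /= modnDr modn_small. Qed.

Lemma oshift_mod A j : oshift A (j %% n) = oshift A j.
Proof. by apply: val_inj; rewrite /= modnDmr. Qed.

Lemma cwdist_oshift A j : cwdist A (oshift A j) = j %% n.
Proof.
rewrite /cwdist /= -addnBA ?(ltnW (ltn_ord A)) // modnDml.
rewrite [X in X %% n](_ : _ = j + n) ?modnDr //.
by have := ltn_ord A; lia.
Qed.

Lemma oshift_cwdist A B : oshift A (cwdist A B) = B.
Proof.
apply: val_inj; rewrite /= /cwdist modnDmr -addnBA ?(ltnW (ltn_ord A)) //.
rewrite addnCA subnKC ?(ltnW (ltn_ord A)) // modnDr modn_small //.
Qed.

Lemma cwdist_eq0 A B : (cwdist A B == 0) = (A == B).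
Proof.
apply/eqP/eqP=> [h|->]; first by rewrite -(oshift_cwdist A B) h oshift0.
by rewrite -{2}(oshift0 B) cwdist_oshift mod0n.
Qed.

Lemma cwdistC A B : A != B -> cwdist B A = n - cwdist A B.
Proof.
move=> AB; have d0 : 0 < cwdist A B by rewrite lt0n cwdist_eq0.
have dn := cwdist_lt A B.
have E : A = oshift B (n - cwdist A B).
  by rewrite -[X in oshift X _](oshift_cwdist A B) oshiftD subnKC ?oshiftn // ltnW.
by rewrite {1}E cwdist_oshift modn_small // ltn_subrL d0 (ord_gt0 A).
Qed.

Lemma cwdistD A B C : cwdist A C = (cwdist A B + cwdist B C) %% n.
Proof. by rewrite -(cwdist_oshift A) -oshiftD !oshift_cwdist. Qed.

Lemma oshift_inj A i j : i < n -> j < n -> oshift A i = oshift A j -> i = j.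
Proof.
by move=> hi hj /(congr1 (cwdist A)); rewrite !cwdist_oshift !modn_small.
Qed.

Lemma ordS_oshift A : ordS A = oshift A 1.
Proof. by apply: val_inj; rewrite /= addn1. Qed.

Lemma sum_cwpart (F : 'I_n -> nat) A B :
  \sum_(u in cwpart A B) F u = \sum_(i < cwdist A B) F (oshift A i).
Proof.
have dn := cwdist_lt A B.
have n0 := ord_gt0 A; rewrite (reindex_onto (fun i : 'I_n => oshift A i)
  (fun u => Ordinal (cwdist_lt A u))) /=; last first.
  by move=> u _; rewrite oshift_cwdist.
rewrite (big_ord_widen _ (fun i => F (oshift A i)) (ltnW dn)).
by apply: eq_bigl => i; rewrite inE -val_eqE /= cwdist_oshift modn_small // eqxx andbT.
Qed.

Lemma sum_oshift (F : 'I_n -> nat) A : \sum_(i < n) F (oshift A i) = \sum_u F u.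
Proof.
rewrite [RHS](reindex_onto (fun i : 'I_n => oshift A i)
  (fun u => Ordinal (cwdist_lt A u))) /=; last first.
  by move=> u _; rewrite oshift_cwdist.
by apply: eq_bigl => i; rewrite -val_eqE /= cwdist_oshift modn_small // eqxx.
Qed.

(* "B is to the left of the chord of A" is the negation of "A is to the left of
   the chord of B". *)
Lemma chords_meetE A B v w : A != B ->
  chords_meet A v B w ->
  (cwdist B A <= cwdist B w) = (cwdist A v < cwdist A B).
Proof.
move=> AB; have d0 : 0 < cwdist A B by rewrite lt0n cwdist_eq0.
have ba := cwdistC AB; have dn := cwdist_lt A B.
have := cwdistD A B w; have := cwdist_lt A v; have := cwdist_lt B w.
rewrite /chords_meet /side_left /side_right /vertex_left /vertex_right ba d0 /=.
move=> bn an aw.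
have -> : (v == w) = (cwdist A v == cwdist A w).
  by apply/eqP/eqP => [-> //|h]; rewrite -(oshift_cwdist A v) h oshift_cwdist.
move: aw; case: (leqP (n - cwdist A B) (cwdist B w)) => h.
  rewrite -(subnK (_ : n <= cwdist A B + cwdist B w)); last by lia.
  rewrite modnDr modn_small; last by lia.
  move=> ->; lia.
rewrite modn_small; last by lia.
move=> ->; lia.
Qed.

(* If the chord of A stays on the left of that of B, the side C just before its
   end lies to the left of A and to the right of B, which is only possible for
   chords that cross. *)
Lemma tournament_chords (D : 'I_n -> nat) :
  (forall A, D A < n) ->
  (forall A B, A != B -> (cwdist A B <= D A) = (D B < cwdist B A)) ->
  forall A B, A != B -> chords_meet A (oshift A (D A)) B (oshift B (D B)).
Proof.
move=> Dn tour A B AB; have d0 : 0 < cwdist A B by rewrite lt0n cwdist_eq0.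
have ba := cwdistC AB; have dn := cwdist_lt A B; have := tour A B AB.
have EB : B = oshift A (cwdist A B) by rewrite oshift_cwdist.
have Da := Dn A; have Db := Dn B; rewrite ba => tAB.
have wE : cwdist A (oshift B (D B)) = (cwdist A B + D B) %% n.
  by rewrite {1}EB oshiftD cwdist_oshift.
have vE : cwdist A (oshift A (D A)) = D A by rewrite cwdist_oshift modn_small.
have neq (E F : 'I_n) : 0 < cwdist E F -> E != F by rewrite lt0n cwdist_eq0.
have -> : chords_meet A (oshift A (D A)) B (oshift B (D B)) =
   let x := (cwdist A B + D B) %% n in
   [|| D A == x, (cwdist A B <= D A) && (D A < x) | (D A < cwdist A B) && (x < D A)].
  rewrite /chords_meet /side_left /side_right /vertex_left /vertex_right d0 wE vE /=.
  congr (_ || _); apply/eqP/eqP => [E|E]; first by rewrite -vE E wE.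
  by rewrite -(oshift_cwdist A (oshift B _)) wE -E.
rewrite /=; case: (leqP (cwdist A B) (D A)) tAB => h /esym h' /=.
  rewrite modn_small; last by lia.
  rewrite orbF -leq_eqVlt leqNgt; apply/negP => gt.
  (* The vertex ending the chord of [A] and the side just before it have the same number
     [oshift A (D A)]; this side is the [C] of the argument. *)
  have bC : cwdist B (oshift A (D A)) = D A - cwdist A B.
    rewrite (cwdistD B A) ba vE (_ : _ + _ = D A - cwdist A B + n); last by lia.
    by rewrite modnDr modn_small //; lia.
  have AC : A != oshift A (D A) by apply: neq; rewrite vE; lia.
  have BC : B != oshift A (D A) by apply: neq; rewrite bC; lia.
  have := tour _ _ AC; have := tour _ _ BC.
  by rewrite (cwdistC AC) (cwdistC BC) vE bC; lia.
(* Here the chord of [B] reaches clockwise past [A]; the argument is repeated with the side at the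
   end of the chord of [B]. *)
have xE : (cwdist A B + D B) %% n = cwdist A B + D B - n.
  by rewrite -(subnK (_ : n <= cwdist A B + D B)) ?modnDr ?modn_small ?addnK; lia.
rewrite [D A == _]eq_sym -leq_eqVlt xE leqNgt; apply/negP => gt.
have vB : cwdist B (oshift B (D B)) = D B by rewrite cwdist_oshift modn_small.
rewrite xE in wE.
have AC : A != oshift B (D B) by apply: neq; rewrite wE; lia.
have BC : B != oshift B (D B) by apply: neq; rewrite vB; lia.
have := tour _ _ AC; have := tour _ _ BC.
by rewrite (cwdistC AC) (cwdistC BC) wE vB; lia.
Qed.

End CyclicShift.

Section PolygonArrows.
Variable P : decorated_polygon.
Notation n := (nsides P).
Implicit Types A B : 'I_n.

Definition reach A := cwdist A (chosen A).

(* The sum of the 1 + c(alpha) over the angles alpha met from A to A + j, as an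
   element of Z/2Z. *)
Definition parity A j : bool := odd (\sum_(i < j) (1 + angle (oshift A i))).

Lemma parityD A i j : parity A (i + j) = parity A i (+) parity (oshift A i) j.
Proof.
rewrite /parity big_split_ord oddD; congr (_ (+) odd _).
by apply: eq_bigr => k _; rewrite oshiftD.
Qed.

(** The odd number of parallel angles enters here: one full turn exchanges the colors, so that
    reading the sides twice around gives a word of the form w (flw w). *)
Lemma parity_full A : parity A n.
Proof.
rewrite /parity (sum_oshift (fun u => 1 + angle u)).
have := admissible P; rewrite -sum1_card.
rewrite (eq_bigl (fun u => ~~ angle u)) => [|u]; last by rewrite inE.
rewrite big_mkcond !(big_morph odd oddD (erefl _)).
by congr is_true; apply: eq_bigr => u _; case: (angle u).
Qed.

Lemma left_reach A B : side_left A (chosen A) B = (0 < cwdist A B <= reach A).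
Proof. by []. Qed.

Lemma left_reachC A B : A != B -> side_left B (chosen B) A = (reach A < cwdist A B).
Proof.
move=> AB; rewrite /side_left lt0n cwdist_eq0 eq_sym AB /=.
by apply: chords_meetE => //; apply: indicators_meet.
Qed.

Lemma parrow_left (a : parrow P) : 0 < cwdist (psrc a) (ptgt a) <= reach (psrc a).
Proof. exact: (valP a). Qed.

Lemma parrow_neq (a : parrow P) : psrc a != ptgt a.
Proof. by case/andP: (parrow_left a); rewrite lt0n cwdist_eq0. Qed.

Lemma parrow_right (a : parrow P) : reach (ptgt a) < cwdist (ptgt a) (psrc a).
Proof. by rewrite -left_reachC ?(valP a) // eq_sym parrow_neq. Qed.

Lemma parrow_inj (a b : parrow P) : psrc a = psrc b -> ptgt a = ptgt b -> a = b.
Proof.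
move=> h1 h2; apply: val_inj; move: h1 h2; rewrite /psrc /ptgt.
by case: (val a) (val b) => [? ?] [? ?] /= -> ->.
Qed.

(** The sorted distances are duplicate-free and fill an interval, so they form an [iota]; the ends
    are recovered from them by [oshift]. *)
Lemma sort_dist A (S : {set parrow P}) (end_ : parrow P -> 'I_n) m k :
  (forall a b, a \in S -> b \in S -> end_ a = end_ b -> a = b) ->
  (forall a, a \in S -> m <= cwdist A (end_ a) < m + k) ->
  (forall j, m <= j < m + k -> exists2 a, a \in S & cwdist A (end_ a) = j) ->
  map end_ (sort (relpre (fun a => cwdist A (end_ a)) leq) (enum S)) =
  [seq oshift A j | j <- iota m k].
Proof.
move=> inj rng surj; set s := sort _ _.
have ps : perm_eq s (enum S) by apply/permPl/perm_sort.
have ms a : (a \in s) = (a \in S) by rewrite (perm_mem ps) mem_enum.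
suff E : [seq cwdist A (end_ a) | a <- s] = iota m k.
  by rewrite -E -map_comp; apply: eq_map => a /=; rewrite oshift_cwdist.
apply: (@sorted_eq _ leq leq_trans anti_leq).
- rewrite sorted_map; apply: sort_sorted => a b; exact: leq_total.
- exact: iota_sorted.
apply: uniq_perm; last 1 first.
- move=> j; rewrite mem_iota; apply/mapP/idP => [[a + ->]|/surj [a aS <-]].
    by rewrite ms => /rng.
  by exists a; rewrite ?ms.
- rewrite map_inj_in_uniq ?(perm_uniq ps) ?enum_uniq // => a b.
  rewrite !ms => aS bS E; apply: inj => //.
  by rewrite -(oshift_cwdist A (end_ a)) E oshift_cwdist.
- exact: iota_uniq.
Qed.

Lemma reach_lt A : reach A < n. Proof. exact: cwdist_lt. Qed.

Lemma pout_targets A : map (@ptgt P) (pout A) = [seq oshift A j | j <- iota 1 (reach A)].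
Proof.
apply: sort_dist => [a b|a|j].
- by rewrite !inE => /eqP ha /eqP hb; apply: parrow_inj; rewrite ha hb.
- by rewrite inE add1n ltnS => /eqP <-; apply: parrow_left.
rewrite add1n ltnS => hj; have jn := leq_ltn_trans (proj2 (andP hj)) (reach_lt A).
have dj : cwdist A (oshift A j) = j by rewrite cwdist_oshift modn_small.
have hl : side_left (A, oshift A j).1 (chosen (A, oshift A j).1) (A, oshift A j).2.
  by rewrite left_reach /= dj.
exists (exist (fun e : 'I_n * 'I_n => side_left e.1 (chosen e.1) e.2) _ hl) => //.
by rewrite inE.
Qed.

Lemma pin_sources A :
  map (@psrc P) (pin A) = [seq oshift A j | j <- iota (reach A).+1 (n - (reach A).+1)].
Proof.
have E : (reach A).+1 + (n - (reach A).+1) = n by rewrite subnKC // reach_lt.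
apply: sort_dist => [a b|a|j].
- by rewrite !inE => /eqP ha /eqP hb h; apply: parrow_inj; rewrite // ha hb.
- by rewrite E inE => /eqP <-; rewrite parrow_right cwdist_lt.
rewrite E => /andP [h jn].
have dj : cwdist A (oshift A j) = j by rewrite cwdist_oshift modn_small.
have hl : side_left (oshift A j, A).1 (chosen (oshift A j, A).1) (oshift A j, A).2.
  rewrite /= left_reachC ?dj // -cwdist_eq0 dj -lt0n; exact: leq_ltn_trans h.
exists (exist (fun e : 'I_n * 'I_n => side_left e.1 (chosen e.1) e.2) _ hl) => //.
by rewrite inE.
Qed.

(** For an arrow from [A] to [B], neither indicator ends on the clockwise part from [A] to [B], so
    this part is the free one. *)
Lemma pcol_parity (a : parrow P) :
  pcol a = ~~ parity (psrc a) (cwdist (psrc a) (ptgt a)).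
Proof.
have /andP [d0 da] := parrow_left a; have AB := parrow_neq a.
have := parrow_right a; move: d0 da AB; rewrite /pcol.
move: (psrc a) (ptgt a) => A B d0 da AB db.
rewrite addn1 /free_part !inE ltnNge da /=.
have -> : cwdist A (chosen B) < cwdist A B = false.
  apply: negbTE; rewrite -leqNgt (cwdistD A B (chosen B)) modn_small ?leq_addr //.
  by move: db; rewrite (cwdistC AB) /reach; have := cwdist_lt A B; lia.
by rewrite sum_cwpart.
Qed.

(** By [parity_full] the two parts of the boundary between the sides have opposite parities. *)
Lemma pcol_parity_in (a : parrow P) :
  pcol a = parity (ptgt a) (cwdist (ptgt a) (psrc a)).
Proof.
rewrite pcol_parity; have AB := parrow_neq a; move: AB.
move: (psrc a) (ptgt a) => A B AB.
have := parity_full A; rewrite -{1}(subnKC (ltnW (cwdist_lt A B))) parityD.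
by rewrite oshift_cwdist -cwdistC //; case: (parity A _); case: (parity B _).
Qed.

End PolygonArrows.

(** * The quiver of a tiling *)

(* The half of the cyclic word of w (flw w), w the angle word at side f of k,
   that starts with the letter of k itself. *)
Definition twisted_word (Q : quiver_data) f (k : node Q) :=
  (k, false, f) :: outw f k ++ flw (inw f k).

Section TilingWords.
Variable T : tiling_data.
Implicit Types (s : side T).
Notation TQ := (tiling_quiver T).

Definition perimeter s := nsides (polygon (tag s)).
Definition turn s (j : nat) : side T := side_of (oshift (tagged s) j).
Definition side_reach s := reach (tagged s).
Definition side_parity s j := parity (tagged s) j.
Definition slot s : arc T * bool := (glue s, side_of_arc s).
Definition asrc (a : tarrow T) : side T := side_of (psrc (tagged a)).
Definition atgt (a : tarrow T) : side T := side_of (ptgt (tagged a)).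

Lemma side_of_tagged s : side_of (tagged s) = s.
Proof. by case: s. Qed.

Lemma mem_tout x f k : (x \in tout f k) =
  if x is inl a then (glue (asrc a) == k) && (side_of_arc (asrc a) == f) else false.
Proof.
apply/flatten_mapP/idP.
  case=> s; rewrite mem_enum inE => /andP [sk sf] /mapP [a + ->] /=.
  rewrite mem_sort mem_enum inE => /eqP E.
  by rewrite /asrc /= E side_of_tagged sk.
case: x => [[p a]|//] /= h; exists (side_of (psrc a)); first by rewrite mem_enum inE.
by apply/mapP; exists a => //; rewrite mem_sort mem_enum inE.
Qed.

Lemma mem_tin x f k : (x \in tin f k) =
  if x is inl a then (glue (atgt a) == k) && (side_of_arc (atgt a) == f) else false.
Proof.
apply/flatten_mapP/idP.
  case=> s; rewrite mem_enum inE => /andP [sk sf] /mapP [a + ->] /=.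
  rewrite mem_sort mem_enum inE => /eqP E.
  by rewrite /atgt /= E side_of_tagged sk.
case: x => [[p a]|//] /= h; exists (side_of (ptgt a)); first by rewrite mem_enum inE.
by apply/mapP; exists a => //; rewrite mem_sort mem_enum inE.
Qed.

Lemma srcside_inl (a : tarrow T) :
  srcside (inl a : arrow TQ) = side_of_arc (asrc a).
Proof. by rewrite /srcside /= mem_tout eqxx /= eqb_id. Qed.

Lemma tgtside_inl (a : tarrow T) :
  tgtside (inl a : arrow TQ) = side_of_arc (atgt a).
Proof. by rewrite /tgtside /= mem_tin eqxx /= eqb_id. Qed.

Lemma uniq_flatten_tagged (F : forall s, seq (parrow (polygon (tag s))))
    (e : tarrow T -> side T) r :
  uniq r -> (forall s, uniq (F s)) -> (forall s a, a \in F s -> e (tarrow_of a) = s) ->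
  uniq (flatten [seq [seq (inl (tarrow_of a) : arrow TQ) | a <- F s] | s <- r]).
Proof.
move=> ur uF eF; elim: r ur => //= s r IH /andP [sr ur].
rewrite cat_uniq IH // andbT map_inj_uniq ?uF; last first.
  by move=> a b [] /eqP; rewrite -tag_eqE /tag_eq /= eqxx tagged_asE => /eqP.
apply/hasPn => x /flatten_mapP [s' s'r /mapP [a ha ->]].
apply/negP => /mapP [b hb].
move/(congr1 (fun x => if x is inl c then e c else s)); rewrite (eF _ _ ha) (eF _ _ hb).
by move=> ss; case/negP: sr; rewrite -ss.
Qed.

Lemma tiling_splitting : is_splitting TQ.
Proof.
have u f k : uniq (tin f k : seq (arrow TQ)).
  apply: (@uniq_flatten_tagged _ atgt) => [|s|s a]; first exact: enum_uniq.
    by rewrite sort_uniq enum_uniq.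
  by rewrite mem_sort mem_enum inE /atgt /= => /eqP ->; apply: side_of_tagged.
have v f k : uniq (tout f k : seq (arrow TQ)).
  apply: (@uniq_flatten_tagged _ asrc) => [|s|s a]; first exact: enum_uniq.
    by rewrite sort_uniq enum_uniq.
  by rewrite mem_sort mem_enum inE /asrc /= => /eqP ->; apply: side_of_tagged.
move=> k; split; apply: uniq_perm; rewrite ?enum_uniq //.
- rewrite cat_uniq !u andbT; apply/hasPn=> x; rewrite /= !mem_tin.
  by case: x => // a /andP [_ /eqP ->]; rewrite andbF.
- move=> x; rewrite mem_cat mem_enum !inE /= !mem_tin; case: x => //= a.
  by rewrite /atgt; case: side_of_arc; rewrite /= ?andbF ?orbF ?andbT.
- rewrite cat_uniq !v andbT; apply/hasPn=> x; rewrite /= !mem_tout.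
  by case: x => // a /andP [_ /eqP ->]; rewrite andbF.
- move=> x; rewrite mem_cat mem_enum !inE /= !mem_tout; case: x => //= a.
  by rewrite /asrc; case: side_of_arc; rewrite /= ?andbF ?orbF ?andbT.
Qed.

Definition turn_letter s j := (glue (turn s j), side_parity s j, side_of_arc (turn s j)).

Hypothesis gluing : gluing_axiom T.

Lemma slot_inj : injective slot.
Proof. by move=> s s' [h1 h2]; apply: gluing. Qed.

Lemma sides_atE s : sides_at (side_of_arc s) (glue s) = [:: s].
Proof.
rewrite /sides_at (_ : [set _ | _] = [set s]) ?enum_set1 //.
apply/setP=> s'; rewrite !inE -xpair_eqE -[RHS](inj_eq slot_inj).
by rewrite /slot !xpair_eqE.
Qed.

Lemma inw_side s : inw (side_of_arc s) (glue s : node TQ) =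
  [seq (glue (turn s j), ~~ side_parity s j, side_of_arc (turn s j))
     | j <- iota (side_reach s).+1 (perimeter s - (side_reach s).+1)].
Proof.
rewrite /inw /= /tin sides_atE /= cats0.
pose F (B : 'I_(nsides (polygon (tag s)))) :=
  (glue (side_of B), ~~ parity (tagged s) (cwdist (tagged s) B), side_of_arc (side_of B)).
transitivity (map F (map (@psrc _) (pin (tagged s)))).
  rewrite -!map_comp; apply/eq_in_map => a.
  rewrite mem_sort mem_enum inE => /eqP E.
  by rewrite /= /in_letter /F srcside_inl /asrc /= pcol_parity_in E.
rewrite pin_sources -map_comp; apply/eq_in_map => j.
rewrite mem_iota subnKC ?reach_lt // => /andP [_ lt].
by rewrite /= /F cwdist_oshift modn_small.
Qed.

Lemma outw_side s : outw (side_of_arc s) (glue s : node TQ) =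
  [seq turn_letter s j | j <- iota 1 (side_reach s)].
Proof.
rewrite /outw /= /tout sides_atE /= cats0.
pose F (B : 'I_(nsides (polygon (tag s)))) :=
  (glue (side_of B), parity (tagged s) (cwdist (tagged s) B), side_of_arc (side_of B)).
transitivity (map F (map (@ptgt _) (pout (tagged s)))).
  rewrite -!map_comp; apply/eq_in_map => a.
  rewrite mem_sort mem_enum inE => /eqP E.
  by rewrite /= /out_letter /F tgtside_inl /atgt /= pcol_parity E negbK.
rewrite pout_targets -map_comp; apply/eq_in_map => j.
rewrite mem_iota add1n ltnS => /andP [_ lt].
by rewrite /= /F cwdist_oshift modn_small // (leq_ltn_trans lt) // reach_lt.
Qed.

Lemma turn0 s : turn s 0 = s.
Proof. by rewrite /turn oshift0; case: s. Qed.

Lemma side_reach_lt s : side_reach s < perimeter s.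
Proof. exact: reach_lt. Qed.

(** Outgoing letters carry the parity, incoming ones its negation, which [flw] undoes; the two lists
    thus join to one clockwise reading of the polygon. *)
Lemma twisted_word_side s :
  twisted_word (side_of_arc s) (glue s : node TQ) =
  [seq turn_letter s j | j <- iota 0 (perimeter s)].
Proof.
rewrite /twisted_word outw_side inw_side.
set m := perimeter s - (side_reach s).+1.
have -> : perimeter s = 1 + (side_reach s + m).
  by rewrite addnA add1n subnKC // side_reach_lt.
rewrite !iotaD !map_cat /=.
congr (_ :: _ ++ _); first by rewrite /turn_letter turn0 /side_parity /parity big_ord0.
rewrite /flw -map_comp /= add0n add1n.
by apply: eq_map => j; rewrite /= negbK.
Qed.

Lemma turnD s i j : turn (turn s i) j = turn s (i + j).
Proof. by rewrite /turn /= oshiftD. Qed.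

Lemma turn_perimeter s : turn s (perimeter s) = s.
Proof. by rewrite /turn oshiftn; case: s. Qed.

Lemma side_parity_turn s i j :
  side_parity (turn s i) j = side_parity s i (+) side_parity s (i + j).
Proof. by rewrite /side_parity parityD addbA addbb. Qed.

Lemma turn_letter_perimeter s j :
  turn_letter s (perimeter s + j) = gflip (turn_letter s j).
Proof.
rewrite /turn_letter -turnD turn_perimeter /side_parity parityD parity_full.
by rewrite oshiftn.
Qed.

Lemma turn_letter_turn s i j : turn_letter (turn s i) j =
  let: (k, y, f) := turn_letter s (i + j) in (k, y (+) side_parity s i, f).
Proof. by rewrite /turn_letter turnD side_parity_turn addbC. Qed.

Lemma iota_turn (X : Type) (F : nat -> X) m i : i <= m ->
  map F (iota i m) = map F (iota i (m - i)) ++ map (fun j => F (m + j)) (iota 0 i).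
Proof.
move=> im; rewrite -{1}(subnK im) iotaD map_cat subnKC //; congr (_ ++ _).
by rewrite -{1}[m]addn0 iotaDl -map_comp.
Qed.

Lemma same_tile s s' : tag s = tag s' -> exists2 i, i < perimeter s & s' = turn s i.
Proof.
case: s s' => p A [p' B] /= E; case: _ / E B => B.
by exists (cwdist A B); [exact: cwdist_lt | rewrite /turn /= oshift_cwdist].
Qed.

(** Starting [i] sides later moves the first [i] letters behind a full turn, where they are flipped,
    and shifts all colors by the parity of the angles passed. *)
Lemma twisted_word_turn s i : (i <= perimeter s) ->
  let w := twisted_word (side_of_arc s) (glue s : node TQ) in
  twisted_word (side_of_arc (turn s i)) (glue (turn s i) : node TQ) =
  flb (side_parity s i) (drop i w ++ flw (take i w)).
Proof.
move=> im.
rewrite /= !twisted_word_side // -[perimeter (turn s i)]/(perimeter s).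
rewrite flbE -map_drop -map_take drop_iota take_iota add0n minnC (minn_idPr im).
rewrite (eq_map (turn_letter_turn s i)).
rewrite (map_comp (fun l : arc T * bool * bool =>
    let: (k, y, f) := l in (k, y (+) side_parity s i, f))
  (fun j => turn_letter s (i + j))).
congr (map _ _); rewrite (map_comp (turn_letter s) (addn i)) -iotaDl addn0.
rewrite iota_turn //; congr (_ ++ _).
by rewrite /flw -map_comp; apply: eq_map => j; rewrite turn_letter_perimeter.
Qed.

Lemma inw_noside f k : (forall s, slot s <> (k, f)) -> inw f (k : node TQ) = [::].
Proof.
move=> h; rewrite /inw; case E: (inc f (k : node TQ)) => [//|x r].
have : x \in tin f k by move: E => /= ->; rewrite mem_head.
rewrite mem_tin; case: {E} x => // a /andP [/eqP h1 /eqP h2].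
by case: (h (atgt a)); rewrite /slot h1 h2.
Qed.

Lemma outw_noside f k : (forall s, slot s <> (k, f)) -> outw f (k : node TQ) = [::].
Proof.
move=> h; rewrite /outw; case E: (out f (k : node TQ)) => [//|x r].
have : x \in tout f k by move: E => /= ->; rewrite mem_head.
rewrite mem_tout; case: {E} x => // a /andP [/eqP h1 /eqP h2].
by case: (h (asrc a)); rewrite /slot h1 h2.
Qed.

End TilingWords.

Section TilingFacts.
Variable T : tiling_data.
Implicit Types (s : side T).
Notation TQ := (tiling_quiver T).

Lemma next_side_turn s : next_side s = turn s 1.
Proof. by rewrite /next_side ordS_oshift. Qed.

Lemma chosen_side_turn s : chosen_side s = turn s (side_reach s).
Proof. by rewrite /turn oshift_cwdist. Qed.

Lemma perimeter_ge2 s : 2 <= perimeter s. Proof. exact: nsides_ge2. Qed.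

Lemma side_of_inj (p : tile T) : injective (@side_of T p).
Proof. by move=> A B /eqP; rewrite -tag_eqE /tag_eq /= eqxx tagged_asE => /eqP. Qed.

Lemma turn_inj s i j : i < perimeter s -> j < perimeter s -> turn s i = turn s j -> i = j.
Proof. by move=> hi hj /side_of_inj; apply: oshift_inj. Qed.

(** This characterizes [perimeter] through [turn], so that injective maps commuting with [turn]
    preserve it. *)
Lemma turn_fix s j : (turn s j == s) = (perimeter s %| j).
Proof.
rewrite -{2}(turn0 s); apply/eqP/idP => [|/dvdnP [k ->]].
  by move/side_of_inj/(congr1 (cwdist (tagged s))); rewrite !cwdist_oshift mod0n => /eqP.
by rewrite /turn -oshift_mod modnMl.
Qed.

Lemma side_parityE s j :
  side_parity s j = odd (\sum_(i < j) (1 + angle_after (turn s i))).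
Proof. by []. Qed.

Hypothesis gluing : gluing_axiom T.

Lemma uniq_turn_slots s (r : seq nat) : uniq r -> all (fun j => j < perimeter s) r ->
  uniq (map (fun j => slot (turn s j)) r).
Proof.
move=> ur /allP hr; rewrite map_inj_in_uniq // => i j hi hj /(slot_inj gluing).
by apply: turn_inj; apply: hr.
Qed.

Lemma slotP k f : (exists s, slot s = (k, f)) \/ forall s, slot s <> (k, f).
Proof.
case: (pickP (fun s => slot s == (k, f))) => [s /eqP h|h]; first by left; exists s.
by right=> s /eqP; rewrite h.
Qed.

Lemma uniq_tiling_outw f (k : node TQ) : uniq (map (@gslot _) (outw f k)).
Proof.
case: (slotP k f) => [[s [<- <-]]|h]; last by rewrite outw_noside.
rewrite outw_side // -map_comp; apply: uniq_turn_slots; first exact: iota_uniq.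
by apply/allP=> j; rewrite mem_iota add1n ltnS => /andP [_ h];
  apply: leq_ltn_trans h (side_reach_lt s).
Qed.

Lemma uniq_tiling_inw f (k : node TQ) : uniq (map (@gslot _) (inw f k)).
Proof.
case: (slotP k f) => [[s [<- <-]]|h]; last by rewrite inw_noside.
rewrite inw_side // -map_comp; apply: uniq_turn_slots; first exact: iota_uniq.
by apply/allP=> j; rewrite mem_iota subnKC ?side_reach_lt // => /andP [].
Qed.

Lemma card_unpruned t (i j : node TQ) :
  #|arrows_between t i j :\: pruned TQ| = #|[set c | (csrc c, ctgt c) == (i, j) :> arc T * arc T]|.
Proof.
have inj : injective (fun c => inr (c, t) : arrow TQ) by move=> c c' [].
rewrite -(card_imset _ inj); apply: eq_card => a; rewrite !inE.
apply/idP/imsetP => [|[c]]; last first.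
  by rewrite inE xpair_eqE => /andP [h1 h2] -> /=; rewrite h1 h2 eqxx.
case: a => [a|[c b]] //= /and3P [/eqP h1 /eqP h2 /eqP ->]; exists c => //.
by rewrite inE h1 h2.
Qed.

End TilingFacts.

(** * Isomorphic tilings have isomorphic quivers *)

Section TilingIsoToQuiver.
Variables T T' : decorated_tiling.

Let gl (R : decorated_tiling) : gluing_axiom R. Proof. by case: (dt_axioms R). Qed.

Lemma tiling_iso_quiver_iso : tiling_iso T T' -> quiver_iso (quiver_of T) (quiver_of T').
Proof.
case=> fk [fp [fs [fc [[fkb fpb fsb fcb] h1 h2 h3]]]].
have fs_inj := bij_inj fsb.
have fs_turn s j : fs (turn s j) = turn (fs s) j.
  elim: j => [|j IH]; first by rewrite !turn0.
  rewrite -addn1 -!turnD -!next_side_turn -IH; by have [] := h1 (turn s j).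
have fs_slot s : slot (fs s) = (fk (glue s), side_of_arc s).
  by rewrite /slot /side_of_arc /pside; have [_ _ ->] := h1 s; have [-> _ _] := h2 s.
have fs_perim s : perimeter (fs s) = perimeter s.
  apply/eqP; rewrite eqn_dvd -!turn_fix -{1}fs_turn turn_perimeter eqxx /=.
  by rewrite -(inj_eq fs_inj) fs_turn turn_perimeter.
have fs_reach s : side_reach (fs s) = side_reach s.
  apply: (@turn_inj _ (fs s)); rewrite ?side_reach_lt // ?fs_perim ?side_reach_lt //.
  by rewrite -chosen_side_turn -fs_turn -chosen_side_turn; have [_ _ ->] := h2 s.
have fs_parity s j : side_parity (fs s) j = side_parity s j.
  rewrite !side_parityE; congr odd; apply: eq_bigr => i _.
  by rewrite -fs_turn; have [_ -> _] := h2 (turn s i).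
have no_side k f : (forall s, slot s <> (k, f)) -> forall s : side T', slot s <> (fk k, f).
  move=> h s'; have [gs gsK gsK'] := fsb; rewrite -(gsK' s') fs_slot => -[/(bij_inj fkb) e1 e2].
  by apply: (h (gs s')); rewrite /slot e1 e2.
apply: (@quiver_iso_words (tiling_quiver T) (tiling_quiver T') fk) => //.
- exact: tiling_splitting.
- exact: tiling_splitting.
- move=> f k; case: (slotP k f) => [[s [<- <-]]|h]; last first.
    by rewrite (inw_noside h) (inw_noside (no_side _ _ h)).
  have [e1 e2] := fs_slot s; rewrite (inw_side (@gl T) s) -e1 -e2 (inw_side (@gl T')).
  rewrite fs_reach fs_perim -map_comp; apply: eq_map => j /=.
  by rewrite fs_parity -fs_turn; have [-> ->] := fs_slot (turn s j).
- move=> f k; case: (slotP k f) => [[s [<- <-]]|h]; last first.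
    by rewrite (outw_noside h) (outw_noside (no_side _ _ h)).
  have [e1 e2] := fs_slot s; rewrite (outw_side (@gl T) s) -e1 -e2 (outw_side (@gl T')).
  rewrite fs_reach -map_comp; apply: eq_map => j /=.
  by rewrite /turn_letter fs_parity -fs_turn; have [-> ->] := fs_slot (turn s j).
- exact: uniq_tiling_inw.
- exact: uniq_tiling_outw.
- move=> t i j; rewrite !card_unpruned; have fc_inj := bij_inj fcb.
  rewrite -(card_imset _ fc_inj); apply: eq_card => c'.
  have [gc gcK gcK'] := fcb; rewrite -(gcK' c') (mem_imset _ _ fc_inj) !inE.
  have [-> ->] := h3 (gc c'); rewrite !xpair_eqE.
  by rewrite !(inj_eq (bij_inj fkb)).
Qed.

End TilingIsoToQuiver.

Section QuiverIso.

Lemma quiver_iso_sym (Q Q' : quiver_data) : quiver_iso Q Q' -> quiver_iso Q' Q.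
Proof.
case=> fn [fa [[gn gnK gnK'] [ga gaK gaK'] h1 h2]]; exists gn, ga; split.
- by exists fn.
- by exists fa.
- move=> a; have [e1 e2 e3 e4] := h1 (ga a); rewrite gaK' in e1 e2 e3 e4.
  by rewrite e1 e2 e3 e4 !gnK.
- move=> f k; have [e1 e2] := h2 f (gn k); rewrite gnK' in e1 e2.
  by rewrite e1 e2 -!map_comp !map_id_in // => x _ /=; rewrite gaK.
Qed.

Variables (Q Q' : quiver_data) (fn : node Q -> node Q') (fa : arrow Q -> arrow Q').
Hypotheses (fa_inj : injective fa).
Hypothesis faP : forall a, [/\ src (fa a) = fn (src a), tgt (fa a) = fn (tgt a),
                      col (fa a) = col a & (fa a \in pruned Q') = (a \in pruned Q)].
Hypothesis listP : forall f k, inc f (fn k) = map fa (inc f k) /\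
                    out f (fn k) = map fa (out f k).

Lemma iso_inw f k : inw f (fn k) = map (slot_map fn) (inw f k).
Proof.
rewrite /inw (listP f k).1 -!map_comp; apply: eq_map => a /=.
by rewrite /in_letter /srcside; have [-> _ -> _] := faP a; rewrite (listP _ _).2 mem_map.
Qed.

Lemma iso_outw f k : outw f (fn k) = map (slot_map fn) (outw f k).
Proof.
rewrite /outw (listP f k).2 -!map_comp; apply: eq_map => a /=.
by rewrite /out_letter /tgtside; have [_ -> -> _] := faP a; rewrite (listP _ _).1 mem_map.
Qed.

End QuiverIso.

(** * Isomorphic quivers come from isomorphic tilings *)

Section QuiverIsoToTiling.

Let gl (R : decorated_tiling) : gluing_axiom R. Proof. by case: (dt_axioms R). Qed.

(** A side is sent to the side at the image of its slot. Such a side exists because a polygon has at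
    least two sides, so that the words at an occupied slot are not both empty; comparing the twisted
    words then gives everything else. *)
Lemma side_correspondence (T T' : decorated_tiling)
    (fn : node (quiver_of T) -> node (quiver_of T')) :
  injective fn ->
  (forall f k, inw f (fn k) = map (slot_map fn) (inw f k)) ->
  (forall f k, outw f (fn k) = map (slot_map fn) (outw f k)) ->
  exists fs : side T -> side T',
  [/\ injective fs, forall s, slot (fs s) = (fn (glue s), side_of_arc s),
      forall s j, j < perimeter s -> fs (turn s j) = turn (fs s) j
    & forall s, [/\ perimeter (fs s) = perimeter s, side_reach (fs s) = side_reach s
      & angle_after (fs s) = angle_after s]].
Proof.
move=> fn_inj hin hout.
have ex (s : side T) : exists s' : side T', slot s' == (fn (glue s), side_of_arc s).
  case: (slotP (T := T') (fn (glue s)) (side_of_arc s)) => [[s' h]|h].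
    by exists s'; rewrite h.
  have := congr1 size (hin (side_of_arc s) (glue s)).
  have := congr1 size (hout (side_of_arc s) (glue s)).
  rewrite (inw_noside h) (outw_noside h) (inw_side (@gl T) s) (outw_side (@gl T) s).
  rewrite !size_map !size_iota /= => r0; rewrite -r0.
  by have := perimeter_ge2 s; case: (perimeter s) => [|[|m]].
pose fs s := xchoose (ex s).
have fs_slot s : slot (fs s) = (fn (glue s), side_of_arc s).
  exact/eqP/(xchooseP (ex s)).
have tw s : [seq turn_letter (fs s) j | j <- iota 0 (perimeter (fs s))] =
    [seq slot_map fn (turn_letter s j) | j <- iota 0 (perimeter s)].
  rewrite -(twisted_word_side (@gl T')) (map_comp (slot_map fn)).
  rewrite -(twisted_word_side (@gl T)); have [-> ->] := fs_slot s.
  rewrite /twisted_word hin hout /= map_cat; congr (_ :: _ ++ _).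
  by rewrite /flw -!map_comp; apply: eq_map => a.
have fs_perim s : perimeter (fs s) = perimeter s.
  by have := congr1 size (tw s); rewrite !size_map !size_iota.
have tl s j : j < perimeter s -> turn_letter (fs s) j = slot_map fn (turn_letter s j).
  move=> lt; have := congr1 (fun r => nth (turn_letter (fs s) 0) r j) (tw s).
  by rewrite !(nth_map 0) ?size_iota ?fs_perim // !nth_iota ?fs_perim.
have fs_turn s j : j < perimeter s -> fs (turn s j) = turn (fs s) j.
  move=> /tl; rewrite /turn_letter => -[e1 _ e2]; apply: (slot_inj (@gl T')).
  by rewrite fs_slot /slot e1 e2.
exists fs; split=> // [s s' ss|s].
  apply: (slot_inj (@gl T)); have := fs_slot s; rewrite ss fs_slot => -[/fn_inj h1 h2].
  by rewrite /slot h1 h2.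
split=> //.
  have := congr1 size (hout (side_of_arc s) (glue s)).
  have [<- <-] := fs_slot s.
  rewrite (outw_side (@gl T') (fs s)) !size_map size_iota => ->.
  have [_ ->] := fs_slot s.
  by rewrite -[LHS](size_map (@out_letter _)) -/(outw _ _) (outw_side (@gl T) s) size_map size_iota.
(* The angle after a side is the color change on the way to the next side. *)
have := tl s 1 (perimeter_ge2 s); rewrite /turn_letter => -[_ + _].
rewrite !side_parityE !big_ord_recl !big_ord0 !turn0.
by case: (angle_after _); case: (angle_after _).
Qed.

Lemma quiver_iso_tiling_iso (T T' : decorated_tiling) :
  quiver_iso (quiver_of T) (quiver_of T') -> tiling_iso T T'.
Proof.
move=> iso; have iso' := quiver_iso_sym iso.
case: iso => fn [fa [fnb fab faP listP]].
case: iso' => gn [ga [gnb gab gaP glistP]].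
have [fs [fs_inj fs_slot fs_turn fs_data]] := side_correspondence (bij_inj fnb)
  (iso_inw (bij_inj fab) faP listP) (iso_outw (bij_inj fab) faP listP).
have [gs [gs_inj _ gs_turn gs_data]] := side_correspondence (bij_inj gnb)
  (iso_inw (bij_inj gab) gaP glistP) (iso_outw (bij_inj gab) gaP glistP).
(* The tile of a side is that of side 0 up to turning, so a map of sides compatible with turning
   induces a map of tiles. *)
have tile_map (R R' : decorated_tiling) (h : side R -> side R') :
    injective h -> (forall s j, j < perimeter s -> h (turn s j) = turn (h s) j) ->
    (forall s, perimeter (h s) = perimeter s) ->
    exists2 hp : tile R -> tile R', injective hp & forall s, tag (h s) = hp (tag s).
  move=> h_inj h_turn h_perim.
  pose s0 (p : tile R) : side R := side_of (Ordinal (ltnW (nsides_ge2 (polygon p)))).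
  have tag_h s : tag (h s) = tag (h (s0 (tag s))).
    have [i lt {1}->] := @same_tile _ (s0 (tag s)) s erefl.
    by rewrite h_turn.
  exists (fun p => tag (h (s0 p))) => [p q /same_tile [i lt e]|s]; last exact: tag_h.
  rewrite h_perim in lt; rewrite -h_turn // in e.
  by have /(congr1 tag) := h_inj _ _ e.
have [fp fp_inj fpP] := tile_map _ _ fs fs_inj fs_turn (fun s => let: And3 h _ _ := fs_data s in h).
have [gp gp_inj _] := tile_map _ _ gs gs_inj gs_turn (fun s => let: And3 h _ _ := gs_data s in h).
have [x|fc fcb fcP] := fiber_bijection
    (k := fun c : comm T => (fn (csrc c), fn (ctgt c)) : node (quiver_of T') * node (quiver_of T'))
    (h := fun c : comm T' => (csrc c, ctgt c) : node (quiver_of T') * node (quiver_of T')).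
  case: x => i' j'; have [hn hnK hnK'] := fnb; rewrite -(hnK' i') -(hnK' j').
  have := @card_unpruned T' false (fn (hn i')) (fn (hn j')) => <-.
  transitivity #|[set c : comm T | (csrc c, ctgt c) == (hn i', hn j') :> arc T * arc T]|.
    by apply: eq_card => c; rewrite !inE !xpair_eqE !(inj_eq (bij_inj fnb)).
  have := @card_unpruned T false (hn i') (hn j') => <-.
  rewrite -(card_imset _ (bij_inj fab)); apply: eq_card => a'.
  have [ha haK haK'] := fab; rewrite -(haK' a') (mem_imset _ _ (bij_inj fab)) !inE.
  by have [-> -> -> e] := faP (ha a'); move: e; rewrite !inE => ->; rewrite !(inj_eq (bij_inj fnb)).
exists fn, fp, fs, fc; split.
(* Bijectivity follows by counting, from the injections in the opposite direction that the inverse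
   isomorphism yields. *)
- split=> //; apply: inj_card_bij => //; [exact: leq_card gp_inj | exact: leq_card gs_inj].
- move=> s; split; first exact: fpP.
    by rewrite !next_side_turn fs_turn // perimeter_ge2.
  by have [] := fs_slot s.
- move=> s; have [_ e1 e2] := fs_data s; split=> //.
    have [_ /(congr1 negb)] := fs_slot s.
    by rewrite /side_of_arc /pside !negbK.
  by rewrite !chosen_side_turn fs_turn ?side_reach_lt // e1.
- by move=> c; have [] := fcP c.
Qed.

End QuiverIsoToTiling.

(** * Representations of the localized algebra *)

Local Open Scope ring_scope.

Section Endomorphisms.
Variables (W : Type) (K : fieldType).

(** Linearity over [K], and not just over the rationals, makes multiplication by an element of [K]
    central; the z_i will act in this way. *)
Definition klinear (h : (W -> K) -> W -> K) :=
  forall a u v w, h (fun w => a * u w + v w) w = a * h u w + h v w.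

(* The base point makes the ring nontrivial, and iota makes it a rat-algebra. *)
Record endo (w0 : W) (iota : {rmorphism rat -> K}) :=
  Endo { efun :> (W -> K) -> W -> K; efunP : klinear efun }.

Variables (w0 : W) (iota : {rmorphism rat -> K}).
Notation E := (endo w0 iota).
Implicit Types h k l : E.

Lemma endoP h k : (forall u w, h u w = k u w) -> h = k.
Proof.
case: h k => [h hP] [k kP] /= e.
have {}e : h = k by apply/funext=> u; apply/funext=> w; apply: e.
by case: _ / e kP => kP; congr Endo; apply: Prop_irrelevance.
Qed.

HB.instance Definition _ := gen_eqMixin E.
HB.instance Definition _ := gen_choiceMixin E.

Fact endo0_subproof : klinear (fun _ _ => 0).
Proof. by move=> a u v w; rewrite mulr0 addr0. Qed.
Fact endo1_subproof : klinear (fun u => u).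
Proof. by []. Qed.
Fact endo_opp_subproof h : klinear (fun u w => - h u w).
Proof. by move=> a u v w; rewrite efunP opprD mulrN. Qed.
Fact endo_add_subproof h k : klinear (fun u w => h u w + k u w).
Proof. by move=> a u v w; rewrite !efunP mulrDr addrACA. Qed.
Fact endo_mul_subproof h k : klinear (fun u => h (k u)).
Proof.
move=> a u v w; rewrite -efunP; congr (efun h _ w).
by apply/funext=> x; rewrite efunP.
Qed.
Fact endo_mulc_subproof c h : klinear (fun u w => c * h u w).
Proof. by move=> a u v w; rewrite efunP mulrDr mulrCA. Qed.

Definition endo0 : E := Endo _ _ endo0_subproof.
Definition endo1 : E := Endo _ _ endo1_subproof.
Definition endo_opp h : E := Endo _ _ (endo_opp_subproof h).
Definition endo_add h k : E := Endo _ _ (endo_add_subproof h k).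
Definition endo_mul h k : E := Endo _ _ (endo_mul_subproof h k).
Definition endo_mulc c h : E := Endo _ _ (endo_mulc_subproof c h).

Fact endo_addA : associative endo_add.
Proof. by move=> h k l; apply: endoP => u w; apply: addrA. Qed.
Fact endo_addC : commutative endo_add.
Proof. by move=> h k; apply: endoP => u w; apply: addrC. Qed.
Fact endo_add0 : left_id endo0 endo_add.
Proof. by move=> h; apply: endoP => u w; apply: add0r. Qed.
Fact endo_addN : left_inverse endo0 endo_opp endo_add.
Proof. by move=> h; apply: endoP => u w; apply: addNr. Qed.

HB.instance Definition _ :=
  GRing.isZmodule.Build E endo_addA endo_addC endo_add0 endo_addN.

Fact endo_mulA : associative endo_mul.
Proof. by move=> h k l; apply: endoP. Qed.
Fact endo_mul1 : left_id endo1 endo_mul.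
Proof. by move=> h; apply: endoP. Qed.
Fact endo_mulr1 : right_id endo1 endo_mul.
Proof. by move=> h; apply: endoP. Qed.
Fact endo_mulDl : left_distributive endo_mul endo_add.
Proof. by move=> h k l; apply: endoP. Qed.
Fact endo_mulDr : right_distributive endo_mul endo_add.
Proof.
move=> h k l; apply: endoP => u w /=.
have := efunP h 1 (k u) (l u) w; rewrite mul1r => <-; congr (efun h _ w).
by apply/funext=> x; rewrite mul1r.
Qed.
Fact endo_oner_neq0 : endo1 != 0 :> E.
Proof.
apply/eqP=> /(congr1 (fun h : E => h (fun _ => 1) w0)) /= /eqP.
by rewrite oner_eq0.
Qed.

HB.instance Definition _ := GRing.Zmodule_isNzRing.Build E
  endo_mulA endo_mul1 endo_mulr1 endo_mulDl endo_mulDr endo_oner_neq0.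

Definition endo_scale (a : rat) h : E := endo_mulc (iota a) h.

Fact endo_scaleA a b h : endo_scale a (endo_scale b h) = endo_scale (a * b) h.
Proof. by apply: endoP => u w /=; rewrite rmorphM mulrA. Qed.
Fact endo_scale1 : left_id 1 endo_scale.
Proof. by move=> h; apply: endoP => u w /=; rewrite rmorph1 mul1r. Qed.
Fact endo_scaleDr : right_distributive endo_scale +%R.
Proof. by move=> a h k; apply: endoP => u w; apply: mulrDr. Qed.
Fact endo_scaleDl h : {morph endo_scale^~ h : a b / a + b}.
Proof. by move=> a b; apply: endoP => u w /=; rewrite rmorphD mulrDl. Qed.

HB.instance Definition _ := GRing.Zmodule_isLmodule.Build rat E
  endo_scaleA endo_scale1 endo_scaleDr endo_scaleDl.

Fact endo_scaleAl a h k : a *: (h * k) = (a *: h) * k.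
Proof. by apply: endoP. Qed.
HB.instance Definition _ := GRing.Lmodule_isLalgebra.Build rat E endo_scaleAl.

Lemma endoZ c h u w : h (fun w => c * u w) w = c * h u w.
Proof.
have h0 : h (fun=> 0) w = 0.
  have E0 : (fun x : W => 1 * (fun=> 0) x + (fun=> 0) x) = (fun=> 0 : K).
    by apply/funext=> x; rewrite mulr0 addr0.
  move: (efunP h 1 (fun=> 0) (fun=> 0) w); rewrite E0 mul1r.
  by move/(congr1 (fun x => x - h (fun=> 0) w)); rewrite addrK subrr => <-.
rewrite -[RHS]addr0 -[X in _ = _ + X]h0 -efunP; congr (efun h _ w).
by apply/funext=> x; rewrite addr0.
Qed.

Fact endo_scaleAr a h k : a *: (h * k) = h * (a *: k).
Proof. by apply: endoP => u w /=; rewrite -endoZ. Qed.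
HB.instance Definition _ := GRing.Lalgebra_isAlgebra.Build rat E endo_scaleAr.

Lemma endo_mulE h k u w : (h * k) u w = h (k u) w.
Proof. by []. Qed.

Lemma endo_sumE (I : Type) (r : seq I) (F : I -> E) u w :
  (\sum_(i <- r) F i) u w = \sum_(i <- r) F i u w.
Proof. by elim/big_rec2: _ => //= i x y _ <-. Qed.

End Endomorphisms.

Section MonomialMorphism.
Variables (G : choiceType) (A : algType rat) (h : G -> A).

Definition word_eval (m : {fmonom G}) : A := \prod_(l <- m : seq G) h l.

Fact word_eval_multiplicative : mmorphism word_eval.
Proof. by split=> [m n|]; rewrite /word_eval ?fmM ?big_cat ?fm1 ?big_nil. Qed.

HB.instance Definition _ := isMultiplicative.Build _ _ word_eval word_eval_multiplicative.

Definition malg_eval : {malg rat[{fmonom G}]} -> A := mmap (in_alg A) word_eval.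

HB.instance Definition _ := GRing.Additive.copy malg_eval (mmap (in_alg A) word_eval).

Fact malg_eval_multiplicative : multiplicative malg_eval.
Proof.
apply: commr_mmap_is_multiplicative => g m m'.
by rewrite /GRing.comm /= -scalerAl -scalerAr mulr1 mul1r.
Qed.
HB.instance Definition _ := GRing.isMultiplicative.Build _ _ malg_eval malg_eval_multiplicative.

Fact malg_eval_scalable : scalable malg_eval.
Proof. by move=> a g; rewrite /malg_eval mmapZ /= -scalerAl mul1r. Qed.
HB.instance Definition _ := GRing.isScalable.Build rat _ _ _ malg_eval malg_eval_scalable.

Definition eval_morphism : {lrmorphism {malg rat[{fmonom G}]} -> A} := malg_eval.

Lemma eval_morphismE m : eval_morphism << m >> = \prod_(l <- m : seq G) h l.
Proof. by rewrite /= /malg_eval mmapU /= scale1r mul1r. Qed.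

End MonomialMorphism.

Lemma lrmorphismE (G : choiceType) (A : algType rat)
    (phi : {lrmorphism {malg rat[{fmonom G}]} -> A}) p :
  phi p = \sum_(m <- msupp p) p@_m *: phi << m >>.
Proof.
rewrite {1}[p]monalgE raddf_sum; apply: eq_bigr => m _ /=.
by rewrite -linearZ; congr (phi _); apply/malgP => k; rewrite mcoeffZ !mcoeffU mulrnAr mulr1.
Qed.

(** Algebraic independence over the rationals. Exponents may repeat in the list of monomials, as
    happens when these come from the words of an element. *)
Definition independent (N : finType) (K : fieldType) (iota : {rmorphism rat -> K})
    (z : N -> K) :=
  forall (M : eqType) (r : seq M) (c : M -> rat) (k : M -> {ffun N -> nat}),
    \sum_(m <- r) iota (c m) * \prod_i z i ^+ k m i = 0 ->
    forall e, \sum_(m <- r | k m == e) c m = 0.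

Lemma exists_independent (N : finType) :
  exists (K : fieldType) (iota : {rmorphism rat -> K}) (z : N -> K),
    independent iota z.
Proof.
pose R : idomainType := mpoly.mpoly #|N| rat.
pose iota : {rmorphism rat -> {fraction R}} :=
  (@FracField.tofrac R \o @mpoly.mpolyC #|N| rat).
pose xx (m : mpoly.multinom #|N|) : {fraction R} := FracField.tofrac (mpoly.mpolyX rat m : R).
pose z i := xx (mpoly.mnm1 (enum_rank i)).
exists {fraction R}, iota, z => M r c k E e.
pose mm (e : {ffun N -> nat}) := mpoly.Multinom [tuple e (enum_val i) | i < #|N|].
have Em (e' : {ffun N -> nat}) : \prod_i z i ^+ e' i = xx (mm e').
  rewrite /xx mpoly.mpolyXE_id rmorph_prod (reindex_onto enum_rank enum_val) /=; last first.
    by move=> i _; rewrite enum_valK.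
  apply: eq_big => [i|i _]; first by rewrite enum_rankK eqxx.
  by rewrite /z rmorphXn /= mpoly.multinomE tnth_mktuple enum_rankK.
have mm_inj : injective mm.
  move=> f g /(congr1 (fun m => @mpoly.multinom_val _ m)) fg; apply/ffunP=> i.
  have := congr1 (fun t => tnth t (enum_rank i)) fg.
  by rewrite /= !tnth_mktuple enum_rankK.
have : (\sum_(m <- r) FracField.tofrac (c m *: mpoly.mpolyX rat (mm (k m)) : R)) = 0.
  apply: etrans E; apply: eq_bigr => m _; rewrite Em.
  by rewrite -mpoly.mul_mpolyC rmorphM.
rewrite -rmorph_sum => /eqP; rewrite tofrac_eq0 => /eqP.
move/(congr1 (mpoly.mcoeff (mm e))); rewrite raddf_sum mpoly.mcoeff0 /= => h; apply: etrans h.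
rewrite [LHS]big_mkcond; apply: eq_bigr => m _; rewrite mpoly.mcoeffZ mpoly.mcoeffX.
by rewrite (inj_eq mm_inj) eq_sym; case: eqP; rewrite ?mulr1 ?mulr0.
Qed.

Lemma independent_neq0 (N : finType) (K : fieldType) (iota : {rmorphism rat -> K})
  (z : N -> K) : independent iota z -> forall i, z i != 0.
Proof.
move=> zi i; apply/eqP=> z0.
have := zi unit [:: tt] (fun=> 1) (fun=> [ffun j => nat_of_bool (j == i)]).
rewrite big_seq1 (bigD1 i) //= ffunE eqxx expr1 z0 mul0r mulr0.
move=> /(_ erefl [ffun j => nat_of_bool (j == i)]).
by rewrite big_mkcond big_seq1 eqxx => /eqP; rewrite oner_eq0.
Qed.

(** Used to group the words of an element by their reduced forms; the induction removes the fiber of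
    the first entry. *)
Lemma sum_fibers0 (R : pzRingType) (V : lmodType R) (M KT : eqType) (r : seq M)
    (c : M -> R) (k : M -> KT) (g : M -> V) :
  (forall m n, m \in r -> n \in r -> k m = k n -> g m = g n) ->
  (forall t, \sum_(m <- r | k m == t) c m = 0) ->
  \sum_(m <- r) c m *: g m = 0.
Proof.
have [n] := ubnP (size r); elim: n => // n IH in r *.
case: r => [|m0 r]; first by rewrite big_nil.
move=> sr hg hc; pose t := k m0.
rewrite (bigID (fun m => k m == t)) /=.
rewrite [X in X + _](_ : _ = 0) ?add0r.
  rewrite -big_filter; apply: IH.
  - rewrite /= eqxx size_filter; apply: leq_ltn_trans (count_size _ _) _; exact: sr.
  - by move=> m m'; rewrite !mem_filter => /andP [_ h] /andP [_ h']; apply: hg.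
  move=> t'; rewrite big_filter_cond; case: (eqVneq t t') => [<-|nt].
    by rewrite big1 // => m /andP [/negPf ->].
  rewrite -[RHS](hc t'); apply: eq_bigl => m.
  by case: (k m =P t') => [->|]; rewrite ?andbF // andbT eq_sym nt.
transitivity (\sum_(m <- m0 :: r | k m == t) c m *: g m0).
  rewrite big_seq_cond [RHS]big_seq_cond; apply: eq_bigr => m /andP [mr /eqP h].
  by congr (_ *: _); apply: hg; rewrite ?inE ?eqxx.
by rewrite -scaler_suml hc scale0r.
Qed.

Lemma sum_fibers (R : pzRingType) (M KT : eqType) (r : seq M)
    (c : M -> R) (k : M -> KT) (g : M -> R) t0 (x0 : R) :
  (forall m n, m \in r -> n \in r -> k m = k n -> g m = g n) ->
  (forall t, t != t0 -> \sum_(m <- r | k m == t) c m = 0) ->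
  (forall m, m \in r -> k m = t0 -> g m = x0) ->
  \sum_(m <- r) c m * g m = (\sum_(m <- r | k m == t0) c m) * x0.
Proof.
move=> hg hc h0; rewrite (bigID (fun m => k m == t0)) /= mulr_suml.
rewrite [X in _ + X](_ : _ = 0) ?addr0.
  rewrite big_seq_cond [RHS]big_seq_cond; apply: eq_bigr => m /andP [mr /eqP h].
  by rewrite (h0 m).
rewrite -big_filter; apply: (@sum_fibers0 R R^o _ _ _ _ k).
  by move=> m m'; rewrite !mem_filter => /andP [_ h] /andP [_ h']; apply: hg.
move=> t'; rewrite big_filter_cond; case: (eqVneq t' t0) => [->|nt].
  by rewrite big1 // => m /andP [/negPf ->].
rewrite -[RHS](hc t' nt); apply: eq_bigl => m.
by case: (k m =P t') => [->|]; rewrite ?andbF // nt.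
Qed.

Lemma perm_prod_comm (R : pzSemiRingType) (I : eqType) (F : I -> R) (s t : seq I) :
  (forall i j, F i * F j = F j * F i) -> perm_eq s t ->
  \prod_(i <- s) F i = \prod_(i <- t) F i.
Proof.
move=> FC; have rem_prod i u : i \in u ->
    \prod_(j <- u) F j = F i * \prod_(j <- rem i u) F j.
  elim: u => //= j u IH; rewrite inE eq_sym; case: eqVneq => [-> _|ne /= /IH E].
    by rewrite big_cons.
  by rewrite !big_cons E !mulrA (FC i).
elim: s t => [|i s IH] t st; first by have/perm_nilP -> : perm_eq t [::] by rewrite perm_sym.
have it : i \in t by rewrite -(perm_mem st) mem_head.
rewrite (rem_prod i t) // big_cons (IH (rem i t)) //.
by rewrite -(perm_cons i); apply: perm_trans st (perm_to_rem it).
Qed.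

(** * The free group acting on functions *)

Section Representation.
Variable Q : ordered_quiver.
Notation L := (node Q * bool * bool)%type.
Notation FA := (free_alg Q).
Notation word s := (<< @FMonom (node Q * bool * bool)%type s >> : FA).

Lemma wordM (s t : seq L) : word s * word t = word (s ++ t).
Proof.
rewrite malgM_def fgmulUU mulr1; congr << _ *g _ >>; apply/eqP.
by rewrite fmP fmM.
Qed.

Lemma word_gen (l : L) : << fmu l >> = word [:: l].
Proof. by rewrite fmuE. Qed.

Lemma word_nil : word [::] = 1.
Proof. by rewrite -mpolyC1E; congr << _ *g _ >>; apply/eqP; rewrite fmP fm1. Qed.

Lemma factors_PI (A : algType rat) (phi : {lrmorphism FA -> A}) :
  (forall i f g, phi (X i f * Y i (~~ f)) = phi (Y i g * X i (~~ g))) ->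
  (forall i f p, phi (X i f * Y i (~~ f)) * phi p = phi p * phi (X i f * Y i (~~ f))) ->
  factors_P phi.
Proof.
move=> h1 h2 i; split=> [f g|f p]; first exact: h1.
by rewrite [LHS]rmorphM h2 [RHS]rmorphM.
Qed.

Lemma central_comm (A : algType rat) (phi : {lrmorphism FA -> A}) p q :
  factors_P phi -> central_in_P p -> phi p * phi q = phi q * phi p.
Proof.
move=> phiP pc; have := pc q A phi phiP.
by rewrite rmorphB !rmorphM => /eqP; rewrite subr_eq0 => /eqP.
Qed.

(* The reduced words, i.e. the elements of the free group; the algebra of
   endomorphisms of their K-valued functions contains the group algebra. *)
Definition rwords := {w : seq L | reduced w}.
Definition rw0 : rwords := exist _ [::] isT.
Definition ract (w : rwords) (s : seq L) : rwords :=
  exist _ (act (val w) s) (act_reduced s (valP w)).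

Lemma ract_cat w s t : ract w (s ++ t) = ract (ract w s) t.
Proof. by apply: val_inj; rewrite /= act_cat. Qed.

Variables (K : fieldType) (iota : {rmorphism rat -> K}) (z : node Q -> K).
Hypotheses (z_neq0 : forall i, z i != 0).

(** X_i^(f) acts by a group element and Y_i^(f) by z_i times one, so that X_i^(f) Y_i^(f+1) acts by
    the scalar z_i. *)
Definition weight (s : seq L) : K := \prod_(l <- s) (if l.1.2 then z l.1.1 else 1).

Lemma weight_cat s t : weight (s ++ t) = weight s * weight t.
Proof. exact: big_cat. Qed.

Lemma weight_neq0 s : weight s != 0.
Proof.
rewrite /weight; elim/big_rec: _ => [|l x _ h]; first exact: oner_neq0.
by rewrite mulf_neq0 //; case: ifP; rewrite ?z_neq0 ?oner_neq0.
Qed.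

Section Action.
Variables (th : L -> seq L).

Definition thw (s : seq L) : seq L := flatten (map th s).

Fact gen_op_subproof (l : L) :
  klinear (fun (u : rwords -> K) w => weight [:: l] * u (ract w (th l))).
Proof. by move=> a u v w /=; rewrite mulrDr mulrCA. Qed.
Definition gen_op l : endo rw0 iota := Endo _ _ (gen_op_subproof l).

(** The substitution [th] is a parameter: the identity serves to study the center, while [theta]
    makes the relation of an angle hold. *)
Definition rep : {lrmorphism FA -> endo rw0 iota} := eval_morphism gen_op.

Lemma rep_word s u w : rep (word s) u w = weight s * u (ract w (thw s)).
Proof.
rewrite /rep eval_morphismE /=; elim: s u w => [|l s IH] u w.
  rewrite big_nil /weight big_nil mul1r /thw /=; congr u; exact: val_inj.
rewrite big_cons [LHS]/= IH mulrA -weight_cat; congr (_ * u _).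
by rewrite -ract_cat.
Qed.

Lemma repE p u w :
  rep p u w = \sum_(m <- msupp p) iota p@_m * weight m * u (ract w (thw m)).
Proof.
rewrite (lrmorphismE rep) endo_sumE; apply: eq_bigr => m _.
rewrite -[LHS]/(iota p@_m * rep << m >> u w) -{2}(fmK m) rep_word mulrA.
by case: m.
Qed.

Hypothesis th_inv : forall l, th (ginv l) = invw (th l).

Lemma thw_cat s t : thw (s ++ t) = thw s ++ thw t.
Proof. by rewrite /thw map_cat flatten_cat. Qed.

Lemma thw1 l : thw [:: l] = th l.
Proof. exact: cats0. Qed.

Lemma thw_geq s t : geq s t -> geq (thw s) (thw t).
Proof.
suff h r : geq (thw r) (thw (rev (red r))).
  by move=> st; apply: etrans (h s) _; rewrite st; apply/esym/h.
elim/last_ind: r => // r x IH.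
rewrite -cats1 thw_cat /red act_cat -/(red r).
apply: etrans (geq_cat IH (erefl : geq (thw [:: x]) _)) _.
rewrite -thw_cat; case: (red r) => [|h v]; first by [].
rewrite [act _ _]/rstep; case: eqP => [->|_]; last by rewrite (rev_cons x) cats1.
rewrite rev_cons -cats1 !thw_cat !thw1 th_inv -catA.
rewrite -{2}[thw (rev v)]cats0; apply: geq_cat => //; exact: geqV.
Qed.

Lemma rep_pair l u w : rep (word [:: l; ginv l]) u w = z (gnode l) * u w.
Proof.
rewrite rep_word -cat1s thw_cat !thw1 th_inv; congr (_ * u _).
  rewrite /weight !big_cons big_nil mulr1.
  by case: l => [[i []] f] /=; rewrite ?mulr1 ?mul1r.
by apply: val_inj; rewrite ract_cat /= act_invw //; apply: valP.
Qed.

Lemma XYE i f : X i f * Y i (~~ f) = word [:: (i, false, f); ginv (i, false, f)].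
Proof. by rewrite /X /Y !word_gen wordM. Qed.
Lemma YXE i f : Y i f * X i (~~ f) = word [:: (i, true, f); ginv (i, true, f)].
Proof. by rewrite /X /Y !word_gen wordM. Qed.

Lemma rep_factors_P : factors_P rep.
Proof.
apply: factors_PI => [i f g|i f p]; apply: endoP => u w.
  rewrite XYE YXE; refine (etrans (rep_pair (i, false, f) u w) _).
  exact: esym (rep_pair (i, true, g) u w).
rewrite XYE !endo_mulE; refine (etrans (rep_pair (i, false, f) _ w) _).
rewrite -endoZ; congr (efun _ _ w); apply/funext => w'.
exact: esym (rep_pair (i, false, f) u w').
Qed.

End Action.

Lemma thw_id s : thw (fun l => [:: l]) s = s.
Proof. by rewrite /thw; elim: s => //= l s {2}<-. Qed.

Definition coefw (p : FA) (m : {fmonom gen Q}) := iota p@_m * weight m.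
(** The coefficient, in the group algebra over [K], of the image of [p] at a group element; like
    [red], the word [t] has its last letter first. *)
Definition coefC (p : FA) (t : seq L) :=
  \sum_(m <- msupp p | red (m : seq L) == t) coefw p m.

Section Center.
Variable p : FA.
Hypothesis p_central : central_in_P p.

Lemma central_conj l (u : rwords -> K) :
  \sum_(m <- msupp p) coefw p m * u (ract rw0 (m ++ [:: l])) =
  \sum_(m <- msupp p) coefw p m * u (ract rw0 (l :: m)).
Proof.
have := central_comm (word [:: l]) (@rep_factors_P (fun l => [:: l]) (fun=> erefl)) p_central.
move/(congr1 (fun h : endo rw0 iota => h u rw0)); rewrite !endo_mulE.
rewrite repE rep_word repE thw_id => h.
apply: (mulfI (weight_neq0 [:: l])); rewrite [RHS]mulr_sumr mulr_sumr.
apply: etrans (etrans h _).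
  apply: eq_bigr => m _; rewrite rep_word !thw_id ract_cat /coefw.
  by rewrite [LHS]mulrCA.
by rewrite mulr_sumr; apply: eq_bigr => m _; rewrite thw_id -ract_cat.
Qed.

(* The coefficients of a central element on the reduced words are invariant
   under conjugation, and the conjugate of t by l is longer than t. *)
Lemma coefC_conj l t : reduced t -> t != [::] ->
  l != ginv (head l t) -> l != last l t ->
  coefC p t = coefC p (rcons (l :: t) (ginv l)).
Proof.
move=> rt tN lh ll.
have rlt : reduced (l :: t).
  by apply: reduced_cons => //; case: t tN lh {rt ll} => //= h t _; rewrite nocancel_sym.
have rlt' : reduced (rcons (l :: t) (ginv l)).
  rewrite /reduced /= rcons_path -/(reduced _) [path _ _ _]rlt /=.
  rewrite /nocancel (inj_eq (inv_inj (@ginvK _))).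
  by case: t tN ll {rt lh rlt}.
(* The indicator of one group element extracts a single coefficient from each side of
   [central_conj]. *)
pose u (w : rwords) : K := (val w == l :: t)%:R.
have sumE (P : pred {fmonom gen Q}) :
    \sum_(m <- msupp p) coefw p m * (P m)%:R = \sum_(m <- msupp p | P m) coefw p m.
  rewrite [RHS]big_mkcond; apply: eq_bigr => m _.
  by case: (P m); rewrite ?mulr1 ?mulr0.
have := central_conj l u; rewrite /u !sumE /coefC => E.
rewrite (eq_bigl (fun m : {fmonom gen Q} => val (ract rw0 (m ++ [:: l])) == l :: t)); last first.
  move=> m /=; rewrite act_cat -/(red m); apply/eqP/eqP => [->|E'] /=.
    case: t tN lh {rt ll rlt rlt' u E} => //= h t _.
    by rewrite eq_sym; case: (h =P _) => // ->; rewrite ginvK eqxx.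
  rewrite -(@rstepK _ (red m) l) ?red_reduced // [rstep _ l]E'.
  by rewrite /= ginvK eqxx.
rewrite E; apply: eq_bigl => m /=; apply/eqP/eqP => [E'|E'].
  have : geq ([:: ginv l] ++ l :: m) ([:: ginv l] ++ rev (l :: t)).
    apply: geq_cat => //; rewrite /geq [RHS]red_id ?revK ?reduced_rev //.
  have : geq (ginv l :: l :: m) m.
    exact: (@geq_cancelV _ [:: l]).
  rewrite /geq => <- ->; rewrite red_id.
    by rewrite cat1s -rev_rcons revK.
  by rewrite cat1s -rev_rcons reduced_rev.
have actl s : act [:: l] (ginv l :: s) = red s by rewrite /act /= ginvK eqxx.
rewrite (@act_red _ [:: l] m) // E' -[l :: rcons t _]/(rcons (l :: t) _) rev_rcons.
by rewrite actl red_id ?revK // reduced_rev.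
Qed.

Lemma avoid2 (i : node Q) (a b : L) : exists l : L, l != a /\ l != b.
Proof.
pose s : seq L := [:: (i, false, false); (i, false, true); (i, true, false)].
case: (boolP (all (fun x => x \in [:: a; b]) s)) => [/allP h|/allPn [x _]].
  have us : uniq s by rewrite /= !inE !xpair_eqE /= !andbF.
  by have := uniq_leq_size us h.
by rewrite !inE negb_or => /andP [xa xb]; exists x.
Qed.

(** Conjugating by a letter that avoids two exceptions lengthens [t] without changing its
    coefficient; repeating this leads beyond the finite support of [p]. Each node supplies four
    letters, so a suitable one always exists. *)
Lemma central_support t : t != [::] -> coefC p t = 0.
Proof.
pose B := \max_(m <- msupp p) size (red (m : seq L)).
suff h n : forall t, t != [::] -> (B < size t + n)%N -> coefC p t = 0.
  by move=> tN; apply: (h B.+1) => //; rewrite addnS ltnS leq_addl.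
elim: n => [|n IH] {}t tN.
  rewrite addn0 => lt; rewrite /coefC big_seq_cond big1 // => m /andP [mp /eqP E].
  by move: lt; rewrite -E ltnNge /B (big_rem _ mp) /= leq_max leqnn.
rewrite addnS => lt; case: (boolP (reduced t)) => rt; last first.
  rewrite /coefC big1 // => m /eqP E; case/negP: rt; rewrite -E; exact: red_reduced.
have [x tx] : exists x, x \in t by case: t tN {lt rt} => // x t; exists x; rewrite inE eqxx.
have [l [l1 l2]] := avoid2 x.1.1 (ginv (head x t)) (last x t).
rewrite (@coefC_conj l) //; last 2 first.
- by case: t tN l1 {lt rt tx l2}.
- by case: t tN l2 {lt rt tx l1}.
apply: IH; first by case: (t).
by rewrite size_rcons /= !addSn; apply: leqW.
Qed.

Lemma central_rep (th : L -> seq L) (th_inv : forall l, th (ginv l) = invw (th l)) u w :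
  rep th p u w = coefC p [::] * u w.
Proof.
rewrite repE.
apply: (@sum_fibers _ _ _ _ (coefw p) (fun m : {fmonom gen Q} => red (m : seq L))
  (fun m : {fmonom gen Q} => u (ract w (thw th m)))).
- move=> m n _ _ E; congr u; apply: val_inj => /=.
  by apply: geq_act; [exact: valP | exact: thw_geq].
- exact: central_support.
- move=> m _ E; congr u; apply: val_inj => /=.
  rewrite (geq_act (valP w) (thw_geq th_inv (E : geq m [::]))) //.
Qed.

End Center.
End Representation.

(* In P every word is a product of z_i's times its reduced form, and the number
   of Y's determines the exponents of the z_i. *)
Section NormalForm.
Variables (T : eqType) (A : pzSemiRingType).
Notation L := (T * bool * bool)%type.
Variables (ev : seq L -> A) (zeta : T -> A).
Hypotheses (ev_cat : forall s t, ev (s ++ t) = ev s * ev t).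
Hypotheses (ev_pair : forall l, ev [:: l; ginv l] = zeta (gnode l)).
Hypotheses (zetaC : forall i s, zeta i * ev s = ev s * zeta i).

Lemma zetaCC i j : zeta i * zeta j = zeta j * zeta i.
Proof. by rewrite -[zeta j](ev_pair (j, false, false)) zetaC. Qed.

Definition zprod (s : seq T) : A := \prod_(i <- s) zeta i.

Lemma zprodC e s : zprod e * ev s = ev s * zprod e.
Proof.
rewrite /zprod; elim/big_rec: _ => [|i x _ IH]; first by rewrite mul1r mulr1.
by rewrite -mulrA IH !mulrA zetaC.
Qed.

Definition ycount (s : seq L) i : nat := count (fun l => l.1.2 && (l.1.1 == i)) s.

Lemma ycount_rcons s l i : ycount (rcons s l) i = (ycount s i + (l.1.2 && (l.1.1 == i)))%N.
Proof. by rewrite /ycount -cats1 count_cat /= addn0. Qed.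

Lemma normal_form s : exists e : seq T,
  ev s = zprod e * ev (rev (red s)) /\
  forall i, (count_mem i e + ycount (red s) i)%N = ycount s i.
Proof.
elim/last_ind: s => [|s l [e [E1 E2]]].
  by exists [::]; rewrite /zprod big_nil mul1r; split=> // i.
have Es : ev (rcons s l) = zprod e * ev (rcons (rev (red s)) l).
  by rewrite -!cats1 !ev_cat E1 mulrA.
have -> : red (rcons s l) = rstep (red s) l by rewrite /red -cats1 act_cat.
case: (red s) E1 E2 Es => [|h u] E1 E2 Es.
  by exists e; split=> // i; rewrite ycount_rcons -E2 -addnA /ycount /= addn0.
rewrite [rstep _ _]/rstep; case: eqP => [hl|_]; last first.
  exists e; split=> [|i]; first by rewrite Es (rev_cons l).
  by rewrite ycount_rcons -E2 /ycount /= -!addnA; congr (_ + _)%N; rewrite addnC -addnA.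
exists (gnode h :: e); split=> [|i].
  rewrite Es rev_cons -!cats1 -catA ev_cat.
  have -> : l = ginv h by rewrite hl ginvK.
  by rewrite ev_pair -zetaC mulrA /zprod big_cons -/(zprod e)
    -[zeta _](ev_pair (gnode h, false, false)) zprodC.
rewrite ycount_rcons -E2 hl; case: (l) => [[j y] f].
by rewrite /ycount /gnode /=; case: y => /=; lia.
Qed.

Lemma normal_form_eq s t : red s = red t -> ycount s =1 ycount t -> ev s = ev t.
Proof.
move=> rst yst; have [e [-> He]] := normal_form s; have [e' [-> He']] := normal_form t.
rewrite rst; congr (_ * _); apply: perm_prod_comm; first exact: zetaCC.
apply/allP=> i _ /=; apply/eqP.
by apply: (@addIn (ycount (red s) i)); rewrite He yst rst He'.
Qed.

End NormalForm.

Section FactorsP.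
Variable Q : ordered_quiver.
Notation L := (node Q * bool * bool)%type.
Notation FA := (free_alg Q).
Notation word s := (<< @FMonom (node Q * bool * bool)%type s >> : FA).
Variables (A : algType rat) (phi : {lrmorphism FA -> A}).
Hypothesis phiP : factors_P phi.

Definition zimg i : A := phi (word [:: (i, false, false); ginv (i, false, false)]).

Lemma phi_pair l : phi (word [:: l; ginv l]) = zimg (gnode l).
Proof.
case: l => [[i y] f]; have [h _] := phiP i; rewrite /zimg.
have E0 : phi (word [:: (i, false, false); ginv (i, false, false)]) =
          phi (Y i f * X i (~~ f)).
  by rewrite -(h false) XYE.
case: y; apply: etrans (esym E0); first by rewrite YXE.
by rewrite -(h f) XYE.
Qed.

Lemma zimg_central i p : zimg i * phi p = phi p * zimg i.
Proof.
have [_ /(_ false p)] := phiP i; rewrite XYE => h.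
by apply: etrans (etrans h _); rewrite rmorphM.
Qed.

Lemma phi_cat s t : phi (word (s ++ t)) = phi (word s) * phi (word t).
Proof. by rewrite -wordM rmorphM. Qed.

Lemma phi_normal_form s t : red s = red t -> ycount s =1 ycount t ->
  phi (word s) = phi (word t).
Proof.
apply: (@normal_form_eq _ _ (fun s => phi (word s)) zimg).
- exact: phi_cat.
- exact: phi_pair.
- by move=> i r; apply: zimg_central.
Qed.

End FactorsP.

Section Invertibility.
Variable Q : ordered_quiver.
Notation L := (node Q * bool * bool)%type.
Notation FA := (free_alg Q).
Variables (K : fieldType) (iota : {rmorphism rat -> K}) (z : node Q -> K).
Hypothesis z_indep : independent iota z.

Let z_neq0 := independent_neq0 z_indep.

Lemma weightE (s : seq L) : weight z s = \prod_i z i ^+ [ffun j => ycount s j] i.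
Proof.
rewrite /weight; elim: s => [|l s IH].
  by rewrite big_nil big1 // => i _; rewrite ffunE expr0.
rewrite big_cons IH (_ : (if _ then _ else _) = \prod_i z i ^+ (l.1.2 && (l.1.1 == i))).
  by rewrite -big_split; apply: eq_bigr => i _; rewrite !ffunE exprD.
case: l => [[j []] f] /=; last by rewrite big1.
rewrite (bigD1 j) //= eqxx expr1 big1 ?mulr1 // => i.
by rewrite eq_sym => /negPf ->.
Qed.

(** All coefficients at group elements vanish. By independence, so do the rational coefficients
    summed over the words with a given reduced form and given numbers of Y's, and these data
    determine the image of a word. *)
Lemma central_zero (p : FA) : central_in_P p -> coefC iota z p [::] = 0 -> zero_in_P p.
Proof.
move=> pc p0 A phi phiP; rewrite lrmorphismE.
apply: (@sum_fibers0 _ _ _ _ _ _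
  (fun m : {fmonom gen Q} => (red (m : seq L), [ffun j => ycount (m : seq L) j]))).
  move=> m n _ _ [E1 E2]; rewrite -(fmK m) -(fmK n); apply: phi_normal_form => // i.
  by have := congr1 (fun g : {ffun _} => g i) E2; rewrite !ffunE.
case=> t e.
have : coefC iota z p t = 0.
  by case: (eqVneq t [::]) => [-> //|]; apply: central_support.
rewrite /coefC -big_filter.
under eq_bigr => m _ do rewrite /coefw weightE.
move/z_indep => /(_ e); rewrite big_filter_cond => h; rewrite -[RHS]h.
by apply: eq_bigl => m; rewrite xpair_eqE.
Qed.

Lemma rep_factors_QQ (th : L -> seq L) :
  (forall l, th (ginv l) = invw (th l)) -> factors_QQ (rep iota z th).
Proof.
move=> th_inv; split; first exact: rep_factors_P.
move=> p pc pN; have cN : coefC iota z p [::] != 0.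
  by apply/eqP=> h; apply: pN; apply: central_zero.
exists (endo_mulc (coefC iota z p [::])^-1 1); split.
  by apply: endoP => u w; rewrite /= central_rep // mulrA mulVf // mul1r.
by apply: endoP => u w; rewrite [LHS]central_rep //= mulrA mulfV // mul1r.
Qed.

End Invertibility.

(** * Relations between angles *)

(** Multiplying [b a = d g] by [e] on the left and by [c] on the right gives [z a c = e d z], from
    which [z] is cancelled. *)
Lemma cancel_shift (R : pzSemiRingType) (z a b c d e g : R) :
  (forall x y, z * x = z * y -> x = y) -> z * d = d * z -> z * e = e * z ->
  e * b = z -> g * c = z -> b * a = d * g -> a * c = e * d.
Proof.
move=> reg zd ze eb gc h; apply: reg.
by rewrite mulrA -{1}eb -(mulrA e) h -!mulrA gc -zd !mulrA ze.
Qed.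

Section AngleRelations.
Variable Q : ordered_quiver.
Notation L := (node Q * bool * bool)%type.
Notation FA := (free_alg Q).
Notation word s := (<< @FMonom (node Q * bool * bool)%type s >> : FA).

Lemma antimorphism_word (h : gen Q -> gen Q) s :
  antimorphism h (word s) = word (rev (map h s)).
Proof. by rewrite /antimorphism msuppU1 big_seq_fset1 mcoeffUU scale1r. Qed.

Lemma sigma_word s : sigma (word s) = word (invw (flw s)).
Proof.
rewrite /sigma antimorphism_word; congr (<< FMonom (rev _) >>).
rewrite /flw -map_comp; apply: eq_map => l /=; rewrite -gsigE.
by case: l => [[]].
Qed.

Lemma letter_word f t (i : node Q) : letter f t i = word [:: (i, ~~ t, f)].
Proof.
by case: f; case: t; rewrite /letter /= /sigma /tau /X fmuE !antimorphism_word.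
Qed.

Lemma Delta_word g (k : node Q) : Delta g k = word (angle_word g k).
Proof.
have prodE (I : Type) (r : seq I) (F : I -> L) :
    \prod_(a <- r) word [:: F a] = word [seq F a | a <- r].
  elim: r => [|a r IH]; first by rewrite big_nil word_nil.
  by rewrite big_cons IH wordM.
rewrite /Delta /angle_word.
have -> : iter g (@sigma Q) (X k false) = word [:: (k, false, g)].
  by case: g; rewrite /= /sigma /X fmuE ?antimorphism_word.
under eq_bigr => a _ do rewrite letter_word.
rewrite prodE; under [in X in _ * X]eq_bigr => a _ do rewrite letter_word.
by rewrite prodE !wordM -catA.
Qed.

(* [holds s] is the relation Delta = sigma Delta for the word s; modulo the
   invertible z_i it says that s (flw s) = 1, and is thus invariant under the
   rotations of s (flw s). *)
Section Holds.
Variables (A : algType rat) (phi : {lrmorphism FA -> A}).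
Hypothesis phiQQ : factors_QQ phi.

Definition holds (s : seq L) := phi (word s) = phi (word (invw (flw s))).

Lemma zimg_regular i (a b : A) : zimg phi i * a = zimg phi i * b -> a = b.
Proof.
have zc : central_in_P (word [:: (i, false, false); ginv (i, false, false)]).
  move=> q B psi psiP; rewrite rmorphB !rmorphM.
  by apply/eqP; rewrite subr_eq0; apply/eqP; apply: (zimg_central psiP).
have zN : ~ zero_in_P (word [:: (i, false, false); ginv (i, false, false)]).
  have [K [iota [z /independent_neq0 z0]]] := exists_independent (node Q).
  move=> /(_ _ (rep iota z (fun l => [:: l])) (rep_factors_P _ _ (fun=> erefl))).
  move/(congr1 (fun h : endo (rw0 Q) iota => h (fun=> 1) (rw0 Q))).
  by rewrite rep_pair // mulr1 => /eqP; rewrite (negPf (z0 i)).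
have [c [cz _]] := phiQQ.2 _ zc zN.
by move/(congr1 (fun x => c * x)); rewrite !mulrA cz !mul1r.
Qed.

Lemma holds_shift l s : holds (l :: s) -> holds (rcons s (gflip l)).
Proof.
rewrite /holds -cats1 => h.
have E1 : phi (word (l :: s)) = phi (word [:: l]) * phi (word s) := phi_cat phi [:: l] s.
have E2 : phi (word (invw (flw (l :: s)))) =
    phi (word (invw (flw s))) * phi (word [:: ginv (gflip l)]).
  by rewrite -phi_cat -[l :: s]/([:: l] ++ s) flw_cat invw_cat.
have E3 : phi (word (s ++ [:: gflip l])) = phi (word s) * phi (word [:: gflip l]).
  exact: phi_cat.
have E4 : phi (word (invw (flw (s ++ [:: gflip l])))) =
    phi (word [:: ginv l]) * phi (word (invw (flw s))).
  by rewrite -phi_cat flw_cat invw_cat -{2}(gflipK l).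
have zl m : phi (word [:: ginv m]) * phi (word [:: m]) = zimg phi (gnode m).
  by rewrite -phi_cat -{2}(ginvK m) -(gnode_inv m) -(phi_pair phiQQ.1 (ginv m)).
apply: etrans E3 (etrans _ (esym E4)).
apply: (cancel_shift (@zimg_regular (gnode l)) _ _ (zl l)).
- by apply: zimg_central; case: phiQQ.
- by apply: zimg_central; case: phiQQ.
- by apply: etrans (zl (gflip l)) _; rewrite gnode_flip.
- exact: etrans (esym E1) (etrans h E2).
Qed.

End Holds.
Lemma has_flb y i s :
  has (fun l : L => gnode l == i) (flb y s) = has (fun l : L => gnode l == i) s.
Proof. by case: y; rewrite /= ?has_flw. Qed.

Lemma weight_invw_flw (K : fieldType) (z : node Q -> K) s :
  weight z (invw (flw s)) = weight z s.
Proof.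
rewrite /weight /invw /flw -map_comp (perm_big _ (permEl (perm_rev _))) big_map.
by apply: eq_bigr => [[[i y] f]] _ /=; rewrite negbK.
Qed.

(** The representation twisted by [theta] lies under QQ and satisfies the relation of [w], hence
    also the one of [s]; an indicator function evaluated at the neutral element turns the latter
    into an equality in the free group. The shift by [y] allows the retained letter to be
    [(i, y, f)], the form in which [i] occurs at the other end of an arrow. *)
Lemma imposing_theta i y f (U V w s : seq L) :
  w = U ++ (i, false, f) :: V ->
  ~~ has (fun l : L => gnode l == i) U -> ~~ has (fun l : L => gnode l == i) V ->
  imposing_implies (word w) (word (invw (flw w))) (word s) (word (invw (flw s))) ->
  geq (thetaw i y f (flb y U) (flb y V) (s ++ flw s)) [::].
Proof.
move=> wE hU hV imp; pose th := theta i y f (flb y U) (flb y V).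
have [K [iota [z zind]]] := exists_independent (node Q).
have th_inv l : th (ginv l) = invw (th l) by apply: theta_inv.
have thw_inv t : thw th (invw t) = invw (thw th t) by apply: thetaw_inv.
have QQ := rep_factors_QQ zind th_inv.
have relE t : geq (thw th (t ++ flw t)) [::] <->
    geq (thw th t) (thw th (invw (flw t))).
  rewrite thw_cat thw_inv; split=> [/geq_rot/geq_eqinv //|h].
  by apply: etrans (geq_cat h erefl) _; apply: geqV.
have /relE relw : geq (thw th (w ++ flw w)) [::].
  (* The relation solved by [theta] is that of [flb y w]; for [y = true] it is a rotation of the
     relation of [w]. *)
  have rel0 : geq (thw th (flb y w ++ flw (flb y w))) [::].
    have := @thetaw_rel _ i y f (flb y U) (flb y V).
    rewrite !has_flb => /(_ hU hV) h; apply: etrans h; congr (red (thw th _)).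
    rewrite wE flb_cat flw_cat.
    by case: (y); rewrite /= -!catA.
  case: (y) rel0 => //=; rewrite flwK.
  by rewrite !thw_cat => /geq_rot.
have := imp _ _ QQ.
have rel_rep t u : geq (thw th t) (thw th (invw (flw t))) ->
    rep iota z th (word t) u = rep iota z th (word (invw (flw t))) u.
  move=> h; apply/funext => v; rewrite !rep_word weight_invw_flw; congr (_ * u _).
  by apply: val_inj; apply: geq_act => //; apply: valP.
have -> : rep iota z th (word w) = rep iota z th (word (invw (flw w))).
  by apply: endoP => u v; rewrite (rel_rep w).
move=> /(_ erefl) h; apply/relE.
pose u (v : rwords Q) : K := (val v == red (thw th s))%:R.
have := congr1 (fun h : endo (rw0 Q) iota => h u (rw0 Q)) h.
rewrite !rep_word weight_invw_flw => /(mulfI (weight_neq0 (independent_neq0 zind) _)).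
rewrite /u /= -[act _ (thw th s)]/(red _) eqxx /=.
by case: eqP => [/esym //|_ /eqP]; rewrite oner_eq0.
Qed.

End AngleRelations.

(** * Matching the angles at the two ends of an arrow *)

Section ArrowMatch.
Variable Q : ordered_quiver.
Notation L := (node Q * bool * bool)%type.
Hypothesis ST : ST_compatible Q.

Let splitQ : is_splitting Q. Proof. by case: (oq_axioms Q). Qed.
Let loopQ : loopless Q. Proof. by case: (oq_axioms Q). Qed.
Let cycQ : no_2cycle Q. Proof. by case: (oq_axioms Q). Qed.
Let pruneQ : is_pruning Q. Proof. by case: (oq_axioms Q). Qed.

Variable a : arrow Q.
Hypothesis pa : a \in pruned Q.
Let i := src a.
Let f := srcside a.
Let j := tgt a.
Let g := tgtside a.
Let y := ~~ col a.

Let a_out : a \in out f i. Proof. by rewrite (mem_out splitQ) pa !eqxx. Qed.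
Let a_in : a \in inc g j. Proof. by rewrite (mem_inc splitQ) pa !eqxx. Qed.
Let in_j : (i, y, f) \in inw g j. Proof. exact: (map_f _ a_in). Qed.
Let out_i : (j, y, g) \in outw f i. Proof. exact: (map_f _ a_out). Qed.

Let flb_memE (l : L) s : (l \in flb y s) = ((if y then gflip l else l) \in s).
Proof. by case: y; rewrite /= ?mem_flw. Qed.

Let flb_head (s : seq L) : 
  {in s, forall l, exists2 m, m \in flb y s & gnode m = gnode l /\ m.2 = l.2}.
Proof.
move=> l hl; exists (if y then gflip l else l).
  by rewrite flb_memE; case: y; rewrite ?gflipK.
by case: y; rewrite ?gnode_flip; split=> //; case: l {hl} => [[]].
Qed.

(* Each of the two implications bounds the length of one angle word by that of
   the other; so both lengths agree, and node i occurs only once in the angle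
   word of j. *)
Lemma arrow_match : exists s0 s2,
  angle_word g j = s0 ++ (i, y, f) :: s2 /\
  s2 ++ flw s0 = flb y (outw f i ++ flw (inw f i)).
Proof.
have iV : ~~ has (fun l : L => gnode l == i) (outw f i).
  by apply/hasPn => l; apply: outw_node.
have iU : ~~ has (fun l : L => gnode l == i) (inw f i).
  by apply/hasPn => l; apply: inw_node.
have jV : ~~ has (fun l : L => gnode l == j) (outw g j).
  by apply/hasPn => l; apply: outw_node.
have jU : ~~ has (fun l : L => gnode l == j) (inw g j).
  by apply/hasPn => l; apply: inw_node.
have ij : i != j by apply: loopQ.
have iR l : l \in outw g j -> gnode l != i.
  by move=> h; rewrite eq_sym; apply: (inw_outw splitQ cycQ in_j h).
have jP l : l \in inw f i -> gnode l != j.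
  by move=> h; apply: (inw_outw splitQ cycQ h out_i).
have [st1 st2] := ST pa.
have red_rel f' (k : node Q) : reduced (outw f' k ++ flw (inw f' k)).
  have := reduced_angle_word splitQ loopQ cycQ pruneQ f' k.
  rewrite /angle_word flw_cat -cat1s -!catA => /reduced_catW [_] /reduced_catW [_].
  by rewrite catA => /reduced_catW [].
have [s0 [m [s2 [E1 E2 m0 m1]]]] : exists s0 m s2,
    [/\ angle_word g j = s0 ++ m ++ s2,
        s2 ++ flw s0 = flb y (outw f i) ++ flw (flb y (inw f i)), (0 < size m)%N
      & size m = 1%N -> m = [:: (i, y, f)]].
  apply: (@innermost_match _ i y f _ _ _ _ _ j g).
  - by rewrite has_flb.
  - by rewrite has_flb.
  - by rewrite /beta flw_flb -flb_cat reduced_flb.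
  - exact: reduced_angle_word.
  - by rewrite mem_cat in_j.
  - apply/allP => l; rewrite mem_cat inE => /or3P [hl|/eqP ->|hl]; apply/implyP=> /eqP ln.
    + by apply/eqP; apply: (inw_col splitQ pruneQ hl in_j).
    + by move: ij; rewrite -ln eqxx.
    + by have := iR _ hl; rewrite ln eqxx.
  - move=> l; rewrite mem_cat inE => /or3P [hl|/eqP -> //|hl] ln.
    + by have := inw_node splitQ loopQ hl; rewrite ln eqxx.
    + by have := outw_node splitQ loopQ hl; rewrite ln eqxx.
  - have [l l1 l2] := flb_head out_i.
    by exists l => //; rewrite mem_cat l1 orbT.
  (* The angle at [j] ends with [j] itself or with the target of an arrow from [j]; for lack of
     2-cycles this is not [i]. *)
  - apply/orP; right; rewrite last_cat /=; case: (lastP (outw g j)) iR => [|r x] iR /=.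
      by rewrite /gnode /= eq_sym.
    by rewrite last_rcons iR // mem_rcons mem_head.
  - refine (@imposing_theta Q i y f (inw f i) (outw f i) (angle_word f i) _ erefl iU iV _).
    by move: st1; rewrite !Delta_word !sigma_word.
have [t0 [n [t2 [F1 F2 n0 n1]]]] : exists s0 m s2,
    [/\ angle_word f i = s0 ++ m ++ s2,
        s2 ++ flw s0 = flb y (outw g j) ++ flw (flb y (inw g j)), (0 < size m)%N
      & size m = 1%N -> m = [:: (j, y, g)]].
  apply: (@innermost_match _ j y g _ _ _ _ _ i f).
  - by rewrite has_flb.
  - by rewrite has_flb.
  - by rewrite /beta flw_flb -flb_cat reduced_flb.
  - exact: reduced_angle_word.
  - by rewrite mem_cat inE out_i !orbT.
  - apply/allP => l; rewrite mem_cat inE => /or3P [hl|/eqP ->|hl]; apply/implyP=> /eqP ln.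
    + by have := jP _ hl; rewrite ln eqxx.
    + by move: ij; rewrite -ln eqxx.
    + by apply/eqP; apply: (outw_col splitQ pruneQ hl out_i).
  - move=> l; rewrite mem_cat inE => /or3P [hl|/eqP -> //|hl] ln.
    + by have := inw_node splitQ loopQ hl; rewrite ln eqxx.
    + by have := outw_node splitQ loopQ hl; rewrite ln eqxx.
  - have [l l1 l2] := flb_head in_j.
    by exists l => //; rewrite mem_cat l1.
  - apply/orP; left; case E: (inw f i) jP => [|x r] jP /=.
      by rewrite /angle_word E.
    by rewrite /angle_word E /= jP // mem_head.
  - refine (@imposing_theta Q j y g (inw g j) (outw g j) (angle_word g j) _ erefl jU jV _).
    by move: st2; rewrite !Delta_word !sigma_word.
have em : size m = 1%N.
  have e1 : (size (inw g j) + (size (outw g j)).+1 = size s0 + (size m + size s2))%N.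
    by rewrite -!size_cat -E1 size_cat.
  have e2 : (size s2 + size s0 = size (outw f i) + size (inw f i))%N.
    have := congr1 size E2; rewrite !size_cat !size_flw !size_flb.
    exact.
  have f1 : (size (inw f i) + (size (outw f i)).+1 = size t0 + (size n + size t2))%N.
    by rewrite -!size_cat -F1 size_cat.
  have f2 : (size t2 + size t0 = size (outw g j) + size (inw g j))%N.
    have := congr1 size F2; rewrite !size_cat !size_flw !size_flb.
    exact.
  move: e1 e2 f1 f2 m0 n0; clear; move: (size _) (size _) (size _) (size _).
  move: (size _) (size _) (size _) (size _) (size _) (size _) => *; lia.
exists s0, s2; split; first by rewrite E1 (m1 em).
by rewrite E2 flw_flb flb_cat.
Qed.

End ArrowMatch.

(** * Tilings give ST-compatible quivers *)

Section TilingST.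
Variable T : decorated_tiling.
Notation Q := (quiver_of T).
Notation L := (node Q * bool * bool)%type.

Section Holds.
Variables (A : algType rat) (phi : {lrmorphism free_alg Q -> A}).
Hypothesis phiQQ : factors_QQ phi.

Lemma holds_rot (s t : seq L) : holds phi (s ++ t) -> holds phi (t ++ flw s).
Proof.
elim: s t => [|l s IH] t; first by rewrite cats0.
move/(holds_shift phiQQ); rewrite -cats1 -catA => /IH.
by rewrite -catA.
Qed.

Lemma holds_flb y (s : seq L) : holds phi s -> holds phi (flb y s).
Proof. by case: y => // h; have := @holds_rot s [::]; rewrite cats0; apply. Qed.

Lemma holds_twisted f (k : node Q) :
  holds phi (angle_word f k) <-> holds phi (twisted_word f k).
Proof.
split; first exact: (@holds_rot (inw f k) ((k, false, f) :: outw f k)).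
rewrite -[twisted_word f k]/(((k, false, f) :: outw f k) ++ flw (inw f k)).
move=> /holds_rot/(holds_flb true); by rewrite /flb flw_cat !flwK.
Qed.

Lemma holds_same_tile (s s' : side T) : tag s = tag s' ->
  holds phi (angle_word (side_of_arc s) (glue s : node Q)) ->
  holds phi (angle_word (side_of_arc s') (glue s' : node Q)).
Proof.
move=> /same_tile [i im ->] /holds_twisted h; apply/holds_twisted.
have gl : gluing_axiom T by case: (dt_axioms T).
rewrite (twisted_word_turn gl) ?(ltnW im) //; apply: holds_flb.
by apply: holds_rot; rewrite cat_take_drop.
Qed.

End Holds.

Lemma tiling_ST : ST_compatible Q.
Proof.
move=> [b|c]; rewrite inE // => _.
rewrite /= !Delta_word !sigma_word.
have -> : src_side (inl b : arrow Q) = side_of_arc (asrc b) := srcside_inl b.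
have -> : tgt_side (inl b : arrow Q) = side_of_arc (atgt b) := tgtside_inl b.
by split=> A phi phiQQ; apply: (holds_same_tile phiQQ).
Qed.

End TilingST.

(** * The tiling of an ST-compatible quiver *)

Local Close Scope ring_scope.

Lemma uniq_split (A B : eqType) (h : A -> B) s1 x s2 t1 y t2 :
  uniq (map h (s1 ++ x :: s2)) -> s1 ++ x :: s2 = t1 ++ y :: t2 -> h x = h y ->
  [/\ s1 = t1, x = y & s2 = t2].
Proof.
move=> u E hxy.
have sz : size s1 = size t1.
  have n1 : nth (h x) (map h (s1 ++ x :: s2)) (size s1) = h x.
    by rewrite map_cat nth_cat size_map ltnn subnn.
  have n2 : nth (h x) (map h (s1 ++ x :: s2)) (size t1) = h x.
    by rewrite E map_cat nth_cat size_map ltnn subnn hxy.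
  have lt1 : size s1 < size (map h (s1 ++ x :: s2)).
    by rewrite size_map size_cat /= addnS ltnS leq_addr.
  have lt2 : size t1 < size (map h (s1 ++ x :: s2)).
    by rewrite E size_map size_cat /= addnS ltnS leq_addr.
  by apply/eqP; rewrite -(nth_uniq (h x) lt1 lt2 u) n1 n2.
by move/eqP: E; rewrite eqseq_cat // eqseq_cons => /and3P [/eqP -> /eqP -> /eqP ->].
Qed.

Lemma cat_split (A : eqType) (s t u v : seq A) x : s ++ x :: t = u ++ v -> x \notin v ->
  exists r, u = s ++ x :: r /\ t = r ++ v.
Proof.
elim: s u => [|a s IH] [|b u] /=.
- by move=> <-; rewrite mem_head.
- by move=> [-> ->] _; exists u.
- by move=> <-; rewrite inE mem_cat mem_head !orbT.
- by move=> [-> /IH h] /h [r [-> ->]]; exists r.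
Qed.

(** * Classes of slots sharing a cyclic word *)

Section SlotClasses.
Variable Q : ordered_quiver.
Hypothesis ST : ST_compatible Q.
Notation L := (node Q * bool * bool)%type.
Notation slotT := (node Q * bool)%type.
Implicit Types (s x : slotT) (l : L).

Let splitQ : is_splitting Q. Proof. by case: (oq_axioms Q). Qed.
Let loopQ : loopless Q. Proof. by case: (oq_axioms Q). Qed.
Let cycQ : no_2cycle Q. Proof. by case: (oq_axioms Q). Qed.

Definition tw s : seq L := twisted_word s.2 s.1.
Definition cyc s : seq slotT := map (@gslot _) (tw s).
Definition self_letter s : L := (s.1, false, s.2).

Lemma gslot_flip l : gslot (gflip l) = gslot l. Proof. by case: l => [[]]. Qed.

Lemma map_gslot_flw (w : seq L) : map (@gslot _) (flw w) = map (@gslot _) w.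
Proof. by rewrite /flw -map_comp; apply: eq_map => l /=; rewrite gslot_flip. Qed.

Lemma map_gslot_flb b (w : seq L) : map (@gslot _) (flb b w) = map (@gslot _) w.
Proof. by case: b; rewrite /= ?map_gslot_flw. Qed.

Lemma cyc_head s : cyc s = s :: map (@gslot _) (outw s.2 s.1) ++ map (@gslot _) (inw s.2 s.1).
Proof. by rewrite /cyc /tw /twisted_word /= map_cat map_gslot_flw; case: s. Qed.

(** This is [arrow_match] for twisted words: the word at the target is rotated to its letter at the
    source, and its colors are shifted so that this letter gets color false. *)
Lemma tw_arrow (a : arrow Q) : a \in pruned Q ->
  let l := (src a, col a, srcside a) in
  exists A B, [/\ tw (tgt a, tgtside a) = (tgt a, false, tgtside a) :: A ++ l :: B
    & tw (src a, srcside a) =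
      flb (col a) (l :: B ++ flw ((tgt a, false, tgtside a) :: A))].
Proof.
move=> pa l; have [s0 [s2 [E1 E2]]] := arrow_match ST pa.
have a_in : in_letter a \in inw (tgtside a) (tgt a).
  by apply: map_f; rewrite mem_inc // pa !eqxx.
have nin : in_letter a \notin (tgt a, false, tgtside a) :: outw (tgtside a) (tgt a).
  rewrite inE negb_or; apply/andP; split.
    by apply: contra (loopQ a) => /eqP [-> _ _].
  by apply/negP => h; have := inw_outw splitQ cycQ a_in h; rewrite eqxx.
have [r [Ei Es]] := cat_split (esym E1) nin.
exists (outw (tgtside a) (tgt a) ++ flw s0), (flw r); split.
  rewrite /tw /twisted_word /= Ei flw_cat catA; congr (_ :: _ ++ _).
  by rewrite /= negbK.
rewrite /tw /twisted_word /=.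
have -> : outw (srcside a) (src a) ++ flw (inw (srcside a) (src a)) = flb (~~ col a) (s2 ++ flw s0).
  by rewrite E2; case: (col a); rewrite /= ?flwK.
rewrite Es /l; move: (col a) => c.
have -> w : flb c ((src a, c, srcside a) :: w) = (src a, false, srcside a) :: flb c w.
  by case: (c).
congr (_ :: _).
have gen (X : seq L) : flb (~~ c) ((r ++ X) ++ flw s0) = flb c (flw r ++ flw (X ++ flw s0)).
  by case: (c); rewrite /flb -catA !flw_cat ?flwK.
exact: (gen (_ :: _)).
Qed.

Lemma perm_cyc_arrow (a : arrow Q) : a \in pruned Q ->
  perm_eq (cyc (src a, srcside a)) (cyc (tgt a, tgtside a)).
Proof.
move/tw_arrow => [A [B [E1 E2]]]; rewrite /cyc E1 E2 map_gslot_flb -cat_cons map_cat.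
rewrite map_gslot_flw perm_catC -map_cat perm_refl //.
Qed.

Lemma mem_cyc_arrow s x : x \in cyc s -> [\/ x = s,
  exists2 a : arrow Q, a \in pruned Q & s = (src a, srcside a) /\ x = (tgt a, tgtside a)
  | exists2 a : arrow Q, a \in pruned Q & x = (src a, srcside a) /\ s = (tgt a, tgtside a)].
Proof.
rewrite cyc_head inE mem_cat => /or3P [/eqP ->|/mapP [l + ->]|/mapP [l + ->]].
- by constructor 1.
- move=> /mem_outwP [a + ->]; rewrite mem_out // => /and3P [pa /eqP sa /eqP fa].
  by constructor 2; exists a => //; rewrite sa fa; case: (s).
- move=> /mem_inwP [a + ->]; rewrite mem_inc // => /and3P [pa /eqP sa /eqP fa].
  by constructor 3; exists a => //; rewrite sa fa; case: (s).
Qed.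

Lemma perm_cyc s x : x \in cyc s -> perm_eq (cyc x) (cyc s).
Proof.
case/mem_cyc_arrow => [-> //|[a pa [-> ->]]|[a pa [-> ->]]].
  by rewrite perm_sym perm_cyc_arrow.
exact: perm_cyc_arrow.
Qed.

Lemma cyc_self s : s \in cyc s. Proof. by rewrite cyc_head mem_head. Qed.

Lemma cyc_sym s x : x \in cyc s -> s \in cyc x.
Proof. by move/perm_cyc/perm_mem->; apply: cyc_self. Qed.

(** A slot occurs in [cyc s] as often as in its own cyclic list, where, for lack of loops, it occurs
    only at the head. *)
Lemma uniq_cyc s : uniq (cyc s).
Proof.
apply: count_mem_uniq => x; case xs: (x \in cyc s); last by rewrite (count_memPn _) ?xs.
rewrite -(permP (perm_cyc xs)) cyc_head /= eqxx.
rewrite (count_memPn _) //; apply/negP; rewrite mem_cat => /orP [] /mapP [l hl E].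
  by have := outw_node splitQ loopQ hl; rewrite {1}E /= eqxx.
by have := inw_node splitQ loopQ hl; rewrite {1}E /= eqxx.
Qed.

(** Since slots do not repeat, the given splitting is the one at an arrow between the two slots, and
    [tw_arrow] applies forwards or backwards. *)
Lemma tw_rot s A l B : tw s = A ++ l :: B ->
  tw (gslot l) = flb l.1.2 (l :: B ++ flw A).
Proof.
move=> E; have lc : gslot l \in cyc s by rewrite /cyc E map_cat mem_cat mem_head orbT.
have uc : uniq (map (@gslot _) (tw s)) := uniq_cyc s.
case/mem_cyc_arrow: lc => [ls|[a pa [sE lE]]|[a pa [lE sE]]].
- have E0 : tw s = [::] ++ self_letter s :: (behead (tw s)) by [].
  rewrite E in uc.
  have [-> -> ->] := uniq_split uc (etrans (esym E) E0) (etrans ls (surjective_pairing s)).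
  by rewrite cats0; case: (s).
- have [A' [B' [E1 E2]]] := tw_arrow pa; rewrite -sE in E2.
  have E3 : tw s = flb (col a) ((src a, col a, srcside a) :: B') ++
      out_letter a :: flb (col a) (flw A').
    rewrite E2 /out_letter -[_ :: B' ++ _]/((_ :: B') ++ _) flb_cat.
    by case: (col a).
  rewrite E in uc; have [-> -> ->] := uniq_split uc (etrans (esym E) E3) lE.
  rewrite -[gslot _]/(tgt a, tgtside a) E1.
  have gen c (X Y : seq L) : (tgt a, false, tgtside a) :: X ++ Y =
      flb (~~ c) ((tgt a, ~~ c, tgtside a) :: flb c (flw X) ++ flw (flb c Y)).
    case: c; first by rewrite /= !flwK.
    by rewrite -[RHS]/(_ :: flw (flw X ++ flw Y)) flw_cat !flwK.
  exact: gen.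
- have [A' [B' [E1 E2]]] := tw_arrow pa; rewrite -sE -cat_cons in E1.
  rewrite E in uc; have [-> -> ->] := uniq_split uc (etrans (esym E) E1) lE.
  by rewrite -[gslot _]/(src a, srcside a) E2.
Qed.

End SlotClasses.

Lemma nth_rot_ord (A : Type) n (x : A) (c : seq A) (a : 'I_n) j : size c = n -> j < n ->
  nth x (rot a c) j = nth x c (oshift a j).
Proof.
move=> sz jn; have an := ltn_ord a; rewrite /rot nth_cat size_drop sz nth_drop /=.
case: ltnP => h; first by rewrite modn_small // -ltn_subRL.
rewrite nth_take; last by lia.
by congr nth; rewrite -(subnK (_ : n <= a + j)) ?modnDr ?modn_small; lia.
Qed.

(** * Polygons, gluing and commutative arrows of the tiling *)

Section TilingOfQuiver.
Variable Q : ordered_quiver.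
Hypothesis ST : ST_compatible Q.
Notation L := (node Q * bool * bool)%type.
Notation slotT := (node Q * bool)%type.
Implicit Types (s x : slotT) (l : L).

Let splitQ : is_splitting Q. Proof. by case: (oq_axioms Q). Qed.
Let loopQ : loopless Q. Proof. by case: (oq_axioms Q). Qed.
Let cycQ : no_2cycle Q. Proof. by case: (oq_axioms Q). Qed.
Let pruneQ : is_pruning Q. Proof. by case: (oq_axioms Q). Qed.

Definition out_slots s := map (@gslot _) (outw s.2 s.1).
Definition in_slots s := map (@gslot _) (inw s.2 s.1).

Lemma size_cyc s : size (cyc s) = size (tw s). Proof. exact: size_map. Qed.

Lemma cycE s : cyc s = s :: out_slots s ++ in_slots s.
Proof. exact: cyc_head. Qed.

Lemma out_slots_lt s : size (out_slots s) < size (tw s).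
Proof. by rewrite -size_cyc cycE /= ltnS size_cat leq_addr. Qed.

Lemma mem_out_slots s x : (x \in out_slots s) = (s \in in_slots x).
Proof.
apply/mapP/mapP => [] [l hl ->]; last first.
  have [a + ->] := mem_inwP _ _ _ hl; rewrite mem_inc // => /and3P [pa /eqP ta /eqP fa].
  exists (out_letter a); last by rewrite /gslot /= ta fa; case: (x).
  by apply: map_f; rewrite mem_out // pa !eqxx.
have [a + ->] := mem_outwP _ _ _ hl; rewrite mem_out // => /and3P [pa /eqP ta /eqP fa].
exists (in_letter a); last by rewrite /gslot /= ta fa; case: (s).
by apply: map_f; rewrite mem_inc // pa !eqxx.
Qed.

Lemma index_out_slots s x : x != s ->
  (index x (cyc s) <= size (out_slots s)) = (x \in out_slots s).
Proof.
move=> xs; rewrite cycE /= eq_sym (negPf xs) index_cat.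
by case: ifP => h; rewrite ?index_mem // ltnNge leq_addr.
Qed.

(** To be outgoing at [s] means that [s] is incoming at [x], and in a class each other slot is
    either outgoing or incoming. This is the hypothesis of [tournament_chords]. *)
Lemma slot_tournament s x : x \in cyc s -> x != s ->
  (index x (cyc s) <= size (out_slots s)) = (size (out_slots x) < index s (cyc x)).
Proof.
move=> xc xs; have sc := cyc_sym ST xc; have sx : s != x by rewrite eq_sym.
rewrite ltnNge (index_out_slots xs) (index_out_slots sx) mem_out_slots.
have := uniq_cyc ST x; move: sc; rewrite cycE inE (negPf sx) mem_cat cons_uniq cat_uniq /=.
move=> /orP [h|h] /and4P [_ _ /hasPn d _].
  by rewrite h; apply/negP => /d; rewrite h.
by rewrite h; apply/esym; apply: d.
Qed.

(* The tiles are the classes of slots for the relation x \in cyc s; a tile is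
   encoded by the representative of its class. *)
Definition class_rep s : slotT := odflt s [pick x in cyc s].

Lemma mem_class_rep s : class_rep s \in cyc s.
Proof. by rewrite /class_rep; case: pickP => //= _; apply: cyc_self. Qed.

Lemma class_rep_eq s x : x \in cyc s -> class_rep x = class_rep s.
Proof.
move=> xs; rewrite /class_rep (eq_pick (perm_mem (perm_cyc ST xs))).
by case: pickP => //= /(_ s); rewrite cyc_self.
Qed.

Lemma size_tw_eq s x : x \in cyc s -> size (tw x) = size (tw s).
Proof. by move=> /(perm_cyc ST)/perm_size; rewrite !size_cyc. Qed.

(** A slot without arrows has a cyclic list of length one, which is no polygon; there the side of
    the arc stays free. *)
Definition tileQ : finType := {s : slotT | (class_rep s == s) && (1 < size (tw s))}.

Section Polygon.
Variable s : slotT.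
Notation n := (size (tw s)).
Implicit Types A B : 'I_n.

Definition nth_slot A : slotT := nth s (cyc s) A.

Lemma nth_slot_mem A : nth_slot A \in cyc s.
Proof. by rewrite mem_nth // size_cyc. Qed.

Lemma nth_slot_inj : injective nth_slot.
Proof. by move=> A B /eqP; rewrite nth_uniq ?size_cyc ?uniq_cyc // => /eqP/val_inj. Qed.

Lemma nth_slotE A : nth_slot A = gslot (nth (self_letter s) (tw s) A).
Proof. by rewrite /nth_slot /cyc (nth_map (self_letter s)) // size_cyc. Qed.

Lemma tw_nth_slot A : tw (nth_slot A) =
  flb (nth (self_letter s) (tw s) A).1.2 (drop A (tw s) ++ flw (take A (tw s))).
Proof.
have E : tw s = take A (tw s) ++ nth (self_letter s) (tw s) A :: drop A.+1 (tw s).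
  by rewrite -drop_nth // cat_take_drop.
by rewrite nth_slotE (tw_rot ST E) -cat_cons -drop_nth.
Qed.

Lemma cyc_nth_slot A : cyc (nth_slot A) = rot A (cyc s).
Proof.
rewrite /cyc tw_nth_slot map_gslot_flb map_cat map_gslot_flw.
by rewrite map_drop map_take.
Qed.

Lemma index_nth_slot A B : index (nth_slot B) (cyc (nth_slot A)) = cwdist A B.
Proof.
rewrite -{1}(oshift_cwdist A B) /nth_slot -(nth_rot_ord s _ _) ?size_cyc ?cwdist_lt //.
rewrite -cyc_nth_slot index_uniq ?uniq_cyc //.
by rewrite size_cyc (size_tw_eq (nth_slot_mem A)) cwdist_lt.
Qed.

Definition nth_reach A := size (out_slots (nth_slot A)).

Lemma nth_reach_lt A : nth_reach A < n.
Proof. by rewrite -(size_tw_eq (nth_slot_mem A)) out_slots_lt. Qed.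

Lemma nth_tournament A B : A != B ->
  (cwdist A B <= nth_reach A) = (nth_reach B < cwdist B A).
Proof.
move=> AB; rewrite -!index_nth_slot; apply: slot_tournament.
  by rewrite cyc_nth_slot mem_rot nth_slot_mem.
by rewrite (inj_eq nth_slot_inj) eq_sym.
Qed.

(** The doubled word gives a color to position n, just past the last side; it is [true], as the
    first letter has color [false]. *)
Definition bit (j : nat) : bool :=
  (nth (self_letter s) (tw s ++ flw (tw s)) j).1.2.

Lemma bit_size : bit n = true.
Proof. by rewrite /bit nth_cat ltnn subnn. Qed.

(* In the cyclic word of w (flw w), the color changes between consecutive sides
   exactly at the parallel angles; as the two halves of this word have opposite
   colors, there is an odd number of them. *)
Definition nth_angle A := ~~ (bit A (+) bit A.+1).

(** Modulo 2, [1 + nth_angle] is the color change, so the sum telescopes, starting from [bit 0],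
    which is false. [F] stands for the inclusion of the first [m] indices. *)
Lemma sum_nth_angle (m : nat) (F : 'I_m -> 'I_n) : (forall i, F i = i :> nat) ->
  odd (\sum_(i < m) (1 + nth_angle (F i))) = bit m.
Proof.
elim: m F => [|m IH] F hF; first by rewrite big_ord0.
rewrite big_ord_recr oddD /= IH; last by move=> i; rewrite hF.
by rewrite /nth_angle hF /=; case: (bit m); case: (bit m.+1).
Qed.

Lemma nth_admissible : odd #|[set A | ~~ nth_angle A]|.
Proof.
have h := @sum_nth_angle n id (fun=> erefl); rewrite bit_size in h.
rewrite -[is_true _]/(_ = true) -[RHS]h -sum1_card.
rewrite (eq_bigl (fun u => ~~ nth_angle u)) => [|u]; last by rewrite inE.
rewrite big_mkcond !(big_morph odd oddD (erefl _)).
by apply: eq_bigr => u _; case: (nth_angle u).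
Qed.

End Polygon.

Definition tile_polygon (p : tileQ) : decorated_polygon := {|
  nsides := size (tw (val p));
  clockwise := fun A => ~~ (nth_slot A).2;
  angle := @nth_angle (val p);
  chosen := fun A => oshift A (nth_reach A);
  nsides_ge2 := proj2 (andP (valP p));
  admissible := nth_admissible (val p);
  indicators_meet := tournament_chords (@nth_reach_lt (val p)) (@nth_tournament (val p))
|}.

(** Each removed pair is represented by its parallel arrow. *)
Definition commQ : finType := {a : arrow Q | (a \notin pruned Q) && ~~ col a}.

Definition tilingQ : tiling_data := {|
  arc := node Q;
  tile := tileQ;
  polygon := tile_polygon;
  glue := fun e => (@nth_slot (val (tag e)) (tagged e)).1;
  comm := commQ;
  csrc := fun c => src (val c);
  ctgt := fun c => tgt (val c)
|}.

Implicit Types S : side tilingQ.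

Lemma slot_nth S : slot S = @nth_slot (val (tag S)) (tagged S).
Proof.
rewrite /slot /side_of_arc /pside /= negbK.
by case: (nth_slot _).
Qed.

Lemma tilingQ_gluing : gluing_axiom tilingQ.
Proof.
move=> S S' h1 h2; have : slot S = slot S' by rewrite /slot h1 h2.
rewrite !slot_nth; case: S S' {h1 h2} => p A [q B] /= E.
have pq : p = q.
  apply: val_inj; case/andP: (valP p) => /eqP <- _; case/andP: (valP q) => /eqP <- _.
  by rewrite -(class_rep_eq (nth_slot_mem A)) E (class_rep_eq (nth_slot_mem B)).
by case: _ / pq B E => B /nth_slot_inj ->.
Qed.

Lemma tile_of_slot s : 1 < size (tw s) -> exists S, slot S = s.
Proof.
move=> ns; have rs := mem_class_rep s; have sr := cyc_sym ST rs.
have hp : (class_rep (class_rep s) == class_rep s) && (1 < size (tw (class_rep s))).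
  by rewrite (class_rep_eq rs) eqxx (size_tw_eq rs).
have hi : index s (cyc (class_rep s)) < size (tw (class_rep s)) by rewrite -size_cyc index_mem.
pose p : tileQ := exist _ (class_rep s) hp.
exists (@side_of tilingQ p (Ordinal hi : 'I_(nsides (tile_polygon p)))).
by rewrite slot_nth /nth_slot /= nth_index.
Qed.

Lemma side_reachQ S : side_reach S = size (out_slots (slot S)).
Proof.
rewrite slot_nth /side_reach /reach /= cwdist_oshift modn_small //.
exact: nth_reach_lt.
Qed.

Lemma twisted_word_slot (R : tiling_data) (S : side R) : gluing_axiom R ->
  twisted_word (slot S).2 ((slot S).1 : node (tiling_quiver R)) =
  [seq turn_letter S j | j <- iota 0 (perimeter S)].
Proof. by move=> gl; apply: twisted_word_side. Qed.

Lemma twisted_wordQ S :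
  twisted_word (slot S).2 ((slot S).1 : node (tiling_quiver tilingQ)) = tw (slot S).
Proof.
pose p := tag S; pose A := tagged S.
have n0 : 0 < nsides (tile_polygon p) by apply: ltnW; apply: nsides_ge2.
(* At the first side of the tile the word read off the polygon is that of the representative; the
   other sides follow by rotating both. *)
pose S0 : side tilingQ := @side_of tilingQ p (Ordinal n0).
have turn0j j (hj : j < nsides (tile_polygon p)) : turn S0 j = @side_of tilingQ p (Ordinal hj).
  by congr side_of; apply: val_inj; rewrite /= add0n modn_small.
have par0 j : j < nsides (tile_polygon p) -> side_parity S0 j = bit (val p) j.
  move=> hj; rewrite -(@sum_nth_angle (val p) j (fun i => widen_ord (ltnW hj) i)) //.
  congr odd; apply: eq_bigr => i _; congr (_ + nth_angle _).
  by apply: val_inj; rewrite /= add0n modn_small // (ltn_trans _ hj).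
have w0 : twisted_word (slot S0).2 ((slot S0).1 : node (tiling_quiver tilingQ)) = tw (val p).
  rewrite (twisted_word_slot _ tilingQ_gluing).
  apply: (@eq_from_nth _ (self_letter (val p))); first by rewrite size_map size_iota.
  move=> j; rewrite size_map size_iota => hj.
  rewrite (nth_map 0) ?size_iota // nth_iota // add0n /turn_letter par0 // (turn0j _ hj).
  have E := slot_nth (@side_of tilingQ p (Ordinal hj)).
  rewrite -[glue _]/(slot (@side_of tilingQ p (Ordinal hj))).1.
  rewrite -[side_of_arc _]/(slot (@side_of tilingQ p (Ordinal hj))).2 E.
  by rewrite nth_slotE /bit nth_cat hj /=; case: (nth _ _ _) => [[? ?] ?].
have -> : S = turn S0 A.
  rewrite (turn0j _ (ltn_ord A)); rewrite /A /p; case: (S) => q B /=.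
  by congr existT; apply: val_inj.
have := @twisted_word_turn tilingQ tilingQ_gluing S0 A (ltnW (ltn_ord A)).
rewrite -[glue S0]/(slot S0).1 -[side_of_arc S0]/(slot S0).2 w0 => ->.
rewrite (turn0j _ (ltn_ord A)) slot_nth tw_nth_slot par0 //.
by rewrite /bit nth_cat ltn_ord; congr (flb (nth _ _ _).1.2 _).
Qed.

(** The indicator gives the number of outgoing letters, which tells where the twisted word splits
    into its two halves; at slots without a polygon all words are empty. *)
Lemma tilingQ_words f (k : node Q) :
  inw f (k : node (tiling_quiver tilingQ)) = inw f k /\
  outw f (k : node (tiling_quiver tilingQ)) = outw f k.
Proof.
case: (@slotP tilingQ k f) => [[S E]|h].
  have [e1 e2] : (slot S).1 = k /\ (slot S).2 = f by rewrite E.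
  have := twisted_wordQ S; rewrite /tw /twisted_word e1 e2 => -[] /eqP.
  have sz : size (outw f (k : node (tiling_quiver tilingQ))) = size (outw f k).
    have := outw_side tilingQ_gluing S.
    rewrite -[glue S]/(slot S).1 -[side_of_arc S]/(slot S).2 e1 e2 => ->.
    by rewrite size_map size_iota side_reachQ /out_slots size_map e1 e2.
  by rewrite eqseq_cat // => /andP [/eqP -> /eqP /(inv_inj (@flwK _)) ->].
have le1 : ~~ (1 < size (tw (k, f))).
  by apply/negP => /tile_of_slot [S E]; apply: (h S).
rewrite (inw_noside h) (outw_noside h); move: le1.
rewrite /tw /twisted_word /= ltnS size_cat size_flw -leqNgt leqn0 addn_eq0.
by move=> /andP [/nilP -> /nilP ->].
Qed.

Lemma slot_arrow s x : x \in out_slots s -> exists2 a : arrow Q, src a = s.1 & tgt a = x.1.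
Proof.
move=> /mapP [l /mem_outwP [a + ->] ->]; rewrite mem_out // => /and3P [_ /eqP <- _].
by exists a.
Qed.

(** An arrow from the slot of [B] to that of [A] would form a 2-cycle with the commutative arrow;
    hence the arrow between them runs from [A] to [B], which places the end of the indicator on the
    required part. *)
Lemma tilingQ_comm : comm_axiom tilingQ.
Proof.
move=> c p A B /= hA hB; rewrite inE /=; set sA := nth_slot A in hA; set sB := nth_slot B in hB.
have AB : A != B.
  by apply: contra (loopQ (val c)) => /eqP AB; rewrite -hA -hB /sA AB.
have BA : B != A by rewrite eq_sym.
have sAB : sA \in cyc sB by rewrite cyc_nth_slot mem_rot nth_slot_mem.
have sne : sA != sB by rewrite (inj_eq (@nth_slot_inj _)).
case: (boolP (sA \in out_slots sB)) => [/slot_arrow [b sb tb]|].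
  by have := cycQ (val c) b; rewrite -hA -hB sb tb !eqxx.
rewrite -(index_out_slots sne) index_nth_slot -ltnNge => lt.
have le : cwdist A B <= size (out_slots sA).
  by have := nth_tournament AB; rewrite /nth_reach -/sA -/sB lt.
have lA : size (out_slots sA) < nsides (@polygon tilingQ p) := nth_reach_lt A.
rewrite -[oshift _ _]/(oshift A (size (out_slots sA))).
rewrite (cwdistD B A) cwdist_oshift (modn_small lA) (cwdistC AB).
have dn := cwdist_lt A B.
rewrite (_ : _ + _ = size (out_slots sA) - cwdist A B + nsides (@polygon tilingQ p)); last by lia.
rewrite modnDr modn_small; lia.
Qed.

(** For either color, the number of removed arrows is the minimum of the numbers of parallel and
    crossing arrows. *)
Lemma card_unprunedQ t (i j : node Q) :
  #|arrows_between t i j :\: pruned Q| = #|arrows_between false i j :\: pruned Q|.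
Proof.
case: t => //; rewrite !cardsD ![_ :&: pruned Q]setIC !pruneQ /=; lia.
Qed.

Lemma tilingQ_unpruned t (i j : node Q) :
  #|@arrows_between (tiling_quiver tilingQ) t i j :\: pruned (tiling_quiver tilingQ)| =
  #|arrows_between t i j :\: pruned Q|.
Proof.
rewrite card_unprunedQ (@card_unpruned tilingQ t i j) -(card_imset _ val_inj).
apply: eq_card => a; rewrite !inE; apply/imsetP/idP => [[c + ->]|].
  rewrite inE xpair_eqE => /andP [/= -> ->] /=.
  by have /andP [-> /negPf ->] := valP c.
move=> /and4P [pa /eqP sa /eqP ta /eqP ca].
have ha : (a \notin pruned Q) && ~~ col a by rewrite pa ca.
by exists (exist _ a ha) => //; rewrite inE /= sa ta.
Qed.

Lemma tilingQ_iso : quiver_iso (tiling_quiver tilingQ) Q.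
Proof.
have mapid (w : seq L) : map (slot_map (fun k => k)) w = w.
  by rewrite map_id_in // => [[[? ?] ?]].
apply: (@quiver_iso_words (tiling_quiver tilingQ) Q (fun k => k)) => //.
- exact: tiling_splitting.
- by exists id.
- by move=> f k; rewrite mapid; have [-> _] := tilingQ_words f k.
- by move=> f k; rewrite mapid; have [_ ->] := tilingQ_words f k.
- exact: (uniq_tiling_inw tilingQ_gluing).
- exact: (uniq_tiling_outw tilingQ_gluing).
- exact: tilingQ_unpruned.
Qed.

End TilingOfQuiver.

Lemma iso_ordered (Q Q' : quiver_data) : quiver_iso Q Q' -> is_splitting Q ->
  is_ordered_quiver Q' -> is_ordered_quiver Q.
Proof.
case=> fn [fa [fnb fab faP _]] spl [lQ cQ pQ _]; have fni := bij_inj fnb.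
split=> // [a|a b|t i j].
- by have := lQ (fa a); have [-> -> _ _] := faP a; rewrite (inj_eq fni).
- have := cQ (fa a) (fa b); have [-> -> _ _] := faP a; have [-> -> _ _] := faP b.
  by rewrite !(inj_eq fni).
have btw u : fa @: arrows_between u i j = arrows_between u (fn i) (fn j).
  apply/setP => a'; have [ga gaK gaK'] := fab; rewrite -(gaK' a').
  rewrite mem_imset ?inE; last exact: bij_inj.
  by have [-> -> -> _] := faP (ga a'); rewrite !(inj_eq fni).
have btwp : fa @: (pruned Q :&: arrows_between t i j) =
    pruned Q' :&: arrows_between t (fn i) (fn j).
  rewrite -btw; apply/setP => a'; have [ga gaK gaK'] := fab; rewrite -(gaK' a').
  rewrite in_setI !(mem_imset _ _ (bij_inj fab)) in_setI.
  by have [_ _ _ ->] := faP (ga a').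
have := pQ t (fn i) (fn j); rewrite -btwp -!btw !card_imset //; exact: bij_inj.
Qed.

Lemma ST_quiver_of_tiling (Q : ordered_quiver) : ST_compatible Q ->
  exists T : decorated_tiling, quiver_iso (quiver_of T) Q.
Proof.
move=> ST; have iso := tilingQ_iso ST.
have ord := iso_ordered iso (@tiling_splitting _) (oq_axioms Q).
have ax : is_decorated_tiling (tilingQ ST) by split; [exact: tilingQ_gluing | exact: tilingQ_comm].
by exists (DecoratedTiling ax ord).
Qed.

Theorem theorem5p7 :
  [/\ forall T : decorated_tiling, ST_compatible (quiver_of T),
      forall T T' : decorated_tiling,
        tiling_iso T T' <-> quiver_iso (quiver_of T) (quiver_of T')
    & forall Q : ordered_quiver, ST_compatible Q ->
        exists T : decorated_tiling, quiver_iso (quiver_of T) Q].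
Proof.
split=> [T|T T'|Q]; first exact: tiling_ST.
  by split; [exact: tiling_iso_quiver_iso | exact: quiver_iso_tiling_iso].
exact: ST_quiver_of_tiling.
Qed.
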